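(* Let $G$ be a profinite group, $H$ an open subgroup of $G$, and $S$ a truncation set for $H$. A choice of coset representatives for $G/H$ gives an isomorphism of Hausdorff topological abelian groups $$W^S_{H\le G}(R;M)\cong W^S_{H\le H}\big(R;M^{\otimes_R G/H}\big),$$ natural in $(R;M)\in\mathrm{Mod}$.
   Context: Conventions. All rings are commutative. $V\le_o G$ means $V$ is an open subgroup. For an $R$-module $M$ and a finite set $X$, $M^{\otimes_R X}$ is the tensor power over $R$ indexed by $X$, regarded as a discrete group. $\mathrm{Ab}_{\mathrm{Haus}}$ is the category of Hausdorff topological abelian groups. $\mathrm{Mod}$ is the category of pairs $(R;M)$ with $R$ a ring and $M$ an $R$-module; a morphism $(R;M)\to(R';M')$ is a ring homomorphism $\alpha:R\to R'$ together with an $R$-linear map $M\to\alpha^*M'$. The forgetful functor $U:\mathrm{Mod}\to\mathrm{Set}\times\mathrm{Set}$ has left adjoint $F(X,Y)=(\mathbb{Z}[X];\mathbb{Z}[X](Y))$; objects isomorphic to some $F(X,Y)$ are called free. Tensor powers. For $V\le_o G$, $g\in G$, the isomorphism $g\cdot(-):M^{\otimes_R G/V}\to M^{\otimes_R G/gVg^{-1}}$ sends $\bigotimes_{aV}m_{aV}$ to the tensor whose factor at the coset $a(gVg^{-1})$ is $m_{agV}$. For $U\le_o V\le_o G$ and coset representatives $\{g_i\}$ of $G/V$, $f_{G/V}:M^{\otimes_R G/V\times V/U}\to M^{\otimes_R G/U}$ is induced by the bijection $(g_iV,sU)\mapsto g_isU$. For $n\in M^{\otimes_R G/V}$, $n^{\otimes_R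 V/U}\in M^{\otimes_R G/V\times V/U}$ is its tensor power indexed by $V/U$. Ghost map. A truncation set $S$ for $H$ is a set of open subgroups of $H$ closed under $H$-conjugation and upwards closed among open subgroups of $H$. Let $\underline{S}\subseteq S$ contain one representative of each $H$-conjugacy class in $S$, and fix coset representatives for $G/V$ for each $V\in\underline{S}$. Put $\mathrm{gh}^S_{H\le G}(R;M)=\big(\prod_{U\in S}M^{\otimes_R G/U}\big)^H$ ($H$ acting through the maps $h\cdot(-)$; subspace of the product topology). The ghost map $w:\prod_{V\in\underline{S}}M^{\otimes_R G/V}\to\mathrm{gh}^S_{H\le G}(R;M)$ has components $$w_U(n)=\sum_{V\in\underline{S}}\ \sum_{hV\in (H/V)^U}h\cdot f_{G/V}\big(n_V^{\otimes_R V/h^{-1}Uh}\big),\qquad (H/V)^U=\{hV: h^{-1}Uh\le V\}.$$ Witt vectors. For $(T;Q)$ free, $\mathrm{im}(w)$ is a closed subgroup of $\mathrm{gh}^S_{H\le G}(T;Q)$, independent of the choices and functorial; put $W^S_{H\le G}(T;Q)=\mathrm{im}(w)$. For general $(R;M)$, $W^S_{H\le G}(R;M)$ is the coequaliser in $\mathrm{Ab}_{\mathrm{Haus}}$ (quotient by the closure of the subgroup of differences) of $W^S_{H\le G}(FUFU(R;M))\rightrightarrows W^S_{H\le G}(FU(R;M))$ induced by the canonical presentation $FUFU(R;M)\rightrightarrows FU(R;M)\to(R;M)$. $W^S_{H\le H}$ is the same construction with the ambient group $G$ replaced by $H$. *)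

(* Defs.v *)
From HB Require Import structures.
From mathcomp Require Import all_boot all_order all_algebra.
From mathcomp Require Import finmap monalg.
From mathcomp Require Import all_classical.
From mathcomp Require Import topology normedtype.
Set Implicit Arguments. Unset Strict Implicit. Unset Printing Implicit Defensive.
Import GRing.Theory.
Local Open Scope classical_set_scope.
Local Open Scope ring_scope.
Local Open Scope quotient_scope.

Section SubgroupGen.
Variables (V : zmodType) (D : set V).

Definition subgroup_gen : {pred V} :=
  fun x => `[< forall P : {pred V}, zmod_closed P -> D `<=` [set` P] ->
                 x \in P >].

Lemma subgroup_gen_closed : zmod_closed subgroup_gen.
Proof.
split=> [|x y]; first by apply/asboolP => P [].
move=> /asboolP xP /asboolP yP; apply/asboolP => P cP DP.
by apply: cP.2; [exact: xP|exact: yP].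
Qed.

HB.instance Definition _ :=
  GRing.isZmodClosed.Build V subgroup_gen subgroup_gen_closed.

End SubgroupGen.

(* The product of the T i, each discrete, with the product topology. *)
Definition dprod (I : Type) (T : I -> zmodType) : Type := forall i, T i.

Section DiscreteProduct.
Variables (I : Type) (T : I -> zmodType).
Local Notation P := (dprod T).

HB.instance Definition _ := Topological.copy P
  (prod_topology (fun i => discrete_topology (T i))).

Let add (x y : P) : P := fun i => x i + y i.
Let opp (x : P) : P := fun i => - x i.
Let zero : P := fun i => 0.

Fact dprod_addA : associative add.
Proof. by move=> x y z; apply: functional_extensionality_dep => i; apply: addrA. Qed.
Fact dprod_addC : commutative add.
Proof. by move=> x y; apply: functional_extensionality_dep => i; apply: addrC. Qed.
Fact dprod_add0 : left_id zero add.
Proof. by move=> x; apply: functional_extensionality_dep => i; apply: add0r. Qed.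
Fact dprod_addN : left_inverse zero opp add.
Proof. by move=> x; apply: functional_extensionality_dep => i; apply: addNr. Qed.

HB.instance Definition _ := GRing.isZmodule.Build P
  dprod_addA dprod_addC dprod_add0 dprod_addN.

Fact dprod_nbhs_coord (z : P) i : nbhs z [set t : P | t i = z i].
Proof.
have /cvg_sup/(_ i) : nbhs z --> z by apply: cvg_id.
apply; exists [set t : P | t i = z i]; split => //.
by exists [set z i] => //; apply: discrete_open.
Qed.

Fact dprod_sub_continuous : continuous (fun x : P * P => x.1 - x.2).
Proof.
move=> [x y]; apply/cvg_sup => i A [_ [[C _ <-] Cxy sCA]].
exists ([set t : P | t i = x i], [set t : P | t i = y i]).
  by split; apply: dprod_nbhs_coord.
move=> [u v] [/= ui vi]; apply: sCA => /=.
have dB (s t : P) : (s - t) i = s i - t i by [].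
by rewrite dB ui vi -dB.
Qed.

HB.instance Definition _ :=
  PreTopologicalNmodule_isTopologicalZmodule.Build P dprod_sub_continuous.
End DiscreteProduct.

Section Subspace.
Variables (E : topologicalZmodType) (P : zmodClosed E).

Record tsub := TSub { tsub_val :> E; _ : tsub_val \in P }.
HB.instance Definition _ := [isSub for tsub_val].
HB.instance Definition _ := [Choice of tsub by <:].
HB.instance Definition _ := [SubChoice_isSubZmodule of tsub by <:].
HB.instance Definition _ := Topological.copy tsub (initial_topology tsub_val).

Fact tsub_sub_continuous : continuous (fun x : tsub * tsub => x.1 - x.2).
Proof.
have cv : continuous tsub_val by apply: initial_continuous.
apply: continuous_comp_initial => -[x y] /=.
apply: (@continuous_comp _ _ _ (fun z : tsub * tsub => (z.1 : E, z.2 : E))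
  (fun z : E * E => z.1 - z.2)); last exact: sub_continuous.
apply: cvg_pair => /=.
  by apply: (@cvg_comp _ _ _ fst tsub_val _ (nbhs x)); [exact: cvg_fst|exact: cv].
by apply: (@cvg_comp _ _ _ snd tsub_val _ (nbhs y)); [exact: cvg_snd|exact: cv].
Qed.

HB.instance Definition _ :=
  PreTopologicalNmodule_isTopologicalZmodule.Build tsub tsub_sub_continuous.
End Subspace.

(* E modulo the closure of the subgroup generated by D; when D is the set of
   differences f x - g x, this is the coequaliser of f and g among Hausdorff
   topological abelian groups. *)
Section HausdorffQuotient.
Variables (E : topologicalZmodType) (D : set E).

Definition closed_gen : {pred E} :=
  fun x => `[< closure [set` subgroup_gen D] x >].

Fact closed_gen_closed : zmod_closed closed_gen.
Proof.
split=> [|x y /asboolP cx /asboolP cy]; apply/asboolP.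
  by apply: subset_closure; apply: rpred0.
move=> A Axy.
have [[B C] /= [Bx Cy] sBC] := @sub_continuous E (x, y) A Axy.
have [x' [gx' Bx']] := cx _ Bx; have [y' [gy' Cy']] := cy _ Cy.
exists (x' - y'); split; first exact: rpredB.
exact: (sBC (x', y')).
Qed.

HB.instance Definition _ :=
  GRing.isZmodClosed.Build E closed_gen closed_gen_closed.

Definition hquot : Type := Quotient.quot closed_gen.
HB.instance Definition _ := ZmodQuotient.on hquot.

Definition hquot_open (U : set hquot) := open (\pi_hquot @^-1` U).

Fact hquot_openT : hquot_open setT.
Proof. exact: openT. Qed.
Fact hquot_openI : setI_closed hquot_open.
Proof. by move=> U V oU oV; apply: openI. Qed.
Fact hquot_open_bigU (J : Type) (f : J -> set hquot) :
  (forall i, hquot_open (f i)) -> hquot_open (\bigcup_i f i).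
Proof. by move=> of_; apply: bigcup_open => i _; apply: of_. Qed.

HB.instance Definition _ :=
  isOpenTopological.Build hquot hquot_openT hquot_openI hquot_open_bigU.

Fact hquot_nbhs (x : E) (A : set E) :
  nbhs x A -> nbhs (\pi_hquot x) (\pi_hquot @` A).
Proof.
rewrite nbhsE => -[B [oB Bx] sBA]; rewrite nbhsE.
exists (\pi_hquot @` B); last by move=> _ [b Bb <-]; exists b => //; apply: sBA.
split; last by exists x.
rewrite /open/= /hquot_open openE => z [b Bb eqbz].
have cN : z - b \in closed_gen by rewrite Quotient.idealrBE eqbz.
have /= := @sub_continuous E (z, z - b) B.
rewrite /= opprB addrCA subrr addr0 => /(_ (open_nbhs_nbhs (conj oB Bb))).
move=> [[C1 C2] /= [C1z C2b] sC]; apply: filterS C1z => c C1c.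
exists (c - (z - b)); first by apply: (sC (_, _)); split => //; apply: nbhs_singleton.
apply/eqP; rewrite -Quotient.idealrBE; rewrite addrAC subrr sub0r.
by rewrite rpredN.
Qed.

Fact hquot_sub_continuous : continuous (fun x : hquot * hquot => x.1 - x.2).
Proof.
move=> [x y] A /=; rewrite -[x]reprK -[y]reprK.
set a := repr x; set b := repr y => Aab.
have pc : continuous (\pi_hquot : E -> hquot) by apply/continuousP.
have piB u v : \pi_hquot u - \pi_hquot v = \pi_hquot (u - v) by rewrite !piE.
move: Aab; rewrite piB => /pc Aab.
have [[B C] /= [Ba Cb] sBC] := @sub_continuous E (a, b) _ Aab.
exists (\pi_hquot @` B, \pi_hquot @` C); first by split; apply: hquot_nbhs.
move=> [_ _] /= [[u Bu <-] [v Cv <-]]; rewrite piB; exact: (sBC (u, v)).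
Qed.

HB.instance Definition _ :=
  PreTopologicalNmodule_isTopologicalZmodule.Build hquot hquot_sub_continuous.

Lemma hquot_hausdorff : hausdorff_space hquot.
Proof.
move=> p q; have [x ->] : exists x, p = \pi_hquot x.
  by exists (repr p); rewrite reprK.
have [y ->] : exists y, q = \pi_hquot y by exists (repr q); rewrite reprK.
move=> clpq; apply/eqP; rewrite -Quotient.idealrBE.
apply/asboolP; rewrite (iffLR (closure_id _) (@closed_closure _ _)) => A Axy.
have [[B C] /= [Bx Cy] sBC] := @sub_continuous E (x, y) A Axy.
have [_ [[u Bu <-] [v Cv /eqP]]] := clpq _ _ (hquot_nbhs Bx) (hquot_nbhs Cy).
rewrite -Quotient.idealrBE => vu.
have uvN : u - v \in closed_gen by rewrite -opprB rpredN.
by exists (u - v); split; [move/asboolP: uvN|apply: (sBC (u, v))].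
Qed.
End HausdorffQuotient.

Definition is_topological_iso (A B : topologicalZmodType) (f : A -> B) :=
  [/\ {morph f : x y / x + y}, continuous f &
      exists g : B -> A, [/\ cancel f g, cancel g f & continuous g]].

(* The free R-module on Y: finitely supported functions Y -> R. Unlike {malg},
   it allows R to be the zero ring. *)
Section FreeModule.
Variables (R : pzRingType) (Y : choiceType).

Definition fin_supported : {pred Y -> R^o} :=
  fun f => `[< finite_set [set y | f y <> 0] >].

Fact fin_supported_closed : subsemimod_closed fin_supported.
Proof.
split=> [|a f /asboolP ff]; last first.
  by apply/asboolP; apply: sub_finite_set ff => y /= af f0; apply: af; rewrite
    scalrfctE/= f0 scaler0.
split=> [|f g /asboolP ff /asboolP fg]; apply/asboolP.
  by apply: (sub_finite_set _ (finite_set0 Y)) => y /=.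
have fU : finite_set ([set y | f y <> 0] `|` [set y | g y <> 0]).
  by rewrite finite_setU.
apply: sub_finite_set fU => y /= fgy.
have [f0|/eqP f0] := eqVneq (f y) 0; [right=> g0|by left].
by apply: fgy; rewrite addrfctE/= f0 g0 addr0.
Qed.

HB.instance Definition _ :=
  GRing.isSubmodClosed.Build R (Y -> R^o) fin_supported fin_supported_closed.

Record freemod := FreeMod { freemod_val :> Y -> R^o;
                            _ : freemod_val \in fin_supported }.
HB.instance Definition _ := [isSub for freemod_val].
HB.instance Definition _ := [Choice of freemod by <:].
HB.instance Definition _ := [SubChoice_isSubLmodule of freemod by <:].

Definition fm_gen (y : Y) : freemod :=
  insubd 0 (fun z => (z == y)%:R).

End FreeModule.

(* The additive map with r.[y] |-> a r *: phi y, semilinear over a. *)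
Definition fm_lift (R R' : pzRingType) (M : lmodType R') (Y : choiceType)
    (a : R -> R') (phi : Y -> M) (x : freemod R Y) : M :=
  \sum_(y \in [set: Y]) a (x y) *: phi y.

(* Z[X], on an arbitrary set of variables. *)
Definition Zpoly (X : choiceType) : comPzRingType := {malg int[{cmonom X}]}.

Definition Zpoly_var (X : choiceType) (x : X) : Zpoly X := << ucm x >>.

Definition Zpoly_lift (X : choiceType) (R : comPzRingType) (f : X -> R)
    (p : Zpoly X) : R :=
  \sum_(m <- msupp p) (p@_m)%:~R * \prod_(x <- finsupp m) f x ^+ m x.

Section SubmoduleQuotient.
Variables (R : pzRingType) (V : lmodType R) (D : set V).

Definition submod_gen : {pred V} :=
  fun x => `[< forall P : {pred V}, submod_closed P -> D `<=` [set` P] ->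
                 x \in P >].

Fact submod_gen_closed : submod_closed submod_gen.
Proof.
split=> [|a x y]; first by apply/asboolP => P [].
move=> /asboolP xP /asboolP yP; apply/asboolP => P cP DP.
by apply: cP.2; [exact: xP|exact: yP].
Qed.

HB.instance Definition _ := GRing.isSubmodClosed.Build R V submod_gen
  (GRing.submod_closed_semi submod_gen_closed).

Definition submod_quot : Type := {ideal_quot submod_gen}.
HB.instance Definition _ := ZmodQuotient.on submod_quot.

Definition sq_scale (a : R) (x : submod_quot) : submod_quot :=
  \pi_submod_quot (a *: repr x).

Fact sq_scale_pi a x : sq_scale a (\pi_submod_quot x) = \pi_submod_quot (a *: x).
Proof.
apply/eqP; rewrite -Quotient.idealrBE -scalerBr.
have memE z : (z \in (submod_gen : zmodClosed V)) = (z \in submod_gen) by [].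
rewrite memE; apply: rpredZ; rewrite -memE.
by rewrite Quotient.idealrBE reprK.
Qed.

Fact sq_piP (x : submod_quot) : exists y, x = \pi_submod_quot y.
Proof. by exists (repr x); rewrite reprK. Qed.

Fact sq_scaleA a b x : sq_scale a (sq_scale b x) = sq_scale (a * b) x.
Proof. by have [y ->] := sq_piP x; rewrite !sq_scale_pi scalerA. Qed.
Fact sq_scale1 : left_id 1 sq_scale.
Proof. by move=> x; have [y ->] := sq_piP x; rewrite sq_scale_pi scale1r. Qed.
Fact sq_scaleDr : right_distributive sq_scale +%R.
Proof.
move=> a x y; have [u ->] := sq_piP x; have [v ->] := sq_piP y.
by rewrite -raddfD !sq_scale_pi -raddfD scalerDr.
Qed.
Fact sq_scaleDl x : {morph sq_scale^~ x : a b / a + b}.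
Proof.
by move=> a b; have [y ->] := sq_piP x; rewrite !sq_scale_pi scalerDl raddfD.
Qed.

HB.instance Definition _ := GRing.Zmodule_isLmodule.Build R submod_quot
  sq_scaleA sq_scale1 sq_scaleDr sq_scaleDl.
End SubmoduleQuotient.

(* M^{(x)_R I}: the free R-module on I-indexed families in M, modulo linearity
   in each coordinate. Only finite I are used below. *)

Section TensorPower.
Variables (R : comPzRingType) (M : lmodType R) (I : Type).

Definition tpow_rel : set (freemod R (I -> M)) :=
  [set z | exists (i : I) (m m1 m2 : I -> M) (r : R),
    [/\ forall j, j <> i -> m j = m1 j /\ m j = m2 j,
        m i = r *: m1 i + m2 i &
        z = fm_gen R m - r *: fm_gen R m1 - fm_gen R m2]].

Definition tpow : Type := submod_quot tpow_rel.
HB.instance Definition _ := GRing.Lmodule.on tpow.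

Definition tens (m : I -> M) : tpow := \pi_(submod_quot tpow_rel) (fm_gen R m).

End TensorPower.

(* The map [tens m |-> phi m], semilinear over a; it is meaningful for a ring
   homomorphism a and a phi that is a-semilinear in each coordinate, since it
   is computed on a representative. *)
Definition tpow_lift (R : comPzRingType) (M : lmodType R) (I : Type)
    (R' : comPzRingType) (N : lmodType R') (a : R -> R')
    (phi : (I -> M) -> N) (t : tpow M I) : N :=
  fm_lift a phi (repr (t : submod_quot (@tpow_rel R M I))).

Definition tpow_map (R R' : comPzRingType) (M : lmodType R) (M' : lmodType R')
    (I : Type) (a : R -> R') (f : M -> M') : tpow M I -> tpow M' I :=
  tpow_lift a (fun m => tens (f \o m)).

(* For a bijection theta = Some \o b, the isomorphism sending the tensor of m to
   the tensor whose factor at j is m (b j). The option is there because the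
   coset maps below are computed on subsets of G and then cast to cosets. *)
Definition tpow_reindex (R : comPzRingType) (M : lmodType R) (I J : Type)
    (theta : J -> option I) : tpow M I -> tpow M J :=
  tpow_lift id (fun m => tens (fun j => oapp m 0 (theta j))).

(* An isomorphism for finite J. *)
Definition tpow_curry (R : comPzRingType) (M : lmodType R) (I J : Type) :
    tpow M (I * J) -> tpow (tpow M I) J :=
  tpow_lift id (fun m => tens (fun j => tens (fun i => m (i, j)))).

(* The tensor power of n indexed by J, as an element of the tensor power of M
   indexed by I * J. *)
Definition tpow_power (R : comPzRingType) (M : lmodType R) (I J : Type)
    (n : tpow M I) : tpow M (I * J) :=
  xget 0 [set z | tpow_curry z = tens (fun _ : J => n)].

(* FU (R;M) = (Zpoly R; FU M), its action on morphisms (a, f), and the counit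
   (eps_ring, eps_mod) : FU (R;M) -> (R;M). *)
Section FreeResolution.
Implicit Types R : comPzRingType.

Definition FU R (M : lmodType R) : lmodType (Zpoly R) := freemod (Zpoly R) M.

Definition FU_ring R R' (a : R -> R') : Zpoly R -> Zpoly R' :=
  Zpoly_lift (fun x => Zpoly_var (a x)).

Definition FU_mod R R' (M : lmodType R) (M' : lmodType R') (a : R -> R')
    (f : M -> M') : FU M -> FU M' :=
  fm_lift (FU_ring a) (fun y => fm_gen (Zpoly R') (f y)).

Definition eps_ring R : Zpoly R -> R := Zpoly_lift id.

Definition eps_mod R (M : lmodType R) : FU M -> M := fm_lift (@eps_ring R) id.

End FreeResolution.

HB.mixin Record isProfinite G of Group G & Topological G := {
  mulg_continuous : continuous (fun x : G * G => (x.1 * x.2)%g);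
  invg_continuous : continuous (fun x : G => (x^-1)%g);
  profinite_compact : compact [set: G];
  profinite_hausdorff : hausdorff_space G;
  profinite_disconnected : totally_disconnected [set: G]
}.

#[short(type="profiniteGroupType")]
HB.structure Definition ProfiniteGroup :=
  { G of isProfinite G & Group G & Topological G }.

Section Cosets.
Variable G : profiniteGroupType.
Implicit Types (A H K U V : set G) (a g h : G).
Local Open Scope group_scope.

Definition open_subgroup V :=
  [/\ open V, V 1, forall x y, V x -> V y -> V (x * y) &
      forall x, V x -> V x^-1].

Definition ltrans a A : set G := [set a * x | x in A].
Definition rtrans A a : set G := [set x * a | x in A].
Definition conjs h U : set G := [set h * u * h^-1 | u in U].
Definition cosets K V : set (set G) := [set ltrans a V | a in K].

Definition truncation_set H (S : set (set G)) :=
  [/\ forall U, S U -> open_subgroup U /\ U `<=` H,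
      forall U h, S U -> H h -> S (conjs h U) &
      forall U V, S U -> open_subgroup V -> U `<=` V -> V `<=` H -> S V].

Definition conj_transversal H (S S0 : set (set G)) :=
  S0 `<=` S /\
  forall U, S U -> exists! V, S0 V /\ exists2 h, H h & V = conjs h U.

Definition coset_reps K V (rep : set G -> G) :=
  forall A, cosets K V A -> A (rep A).

End Cosets.

(* The construction for open subgroups H <= K of G, K being the ambient group:
   the theory for the pair H <= G is K = setT and the one for H <= H is K = H.
   S0 is the set of representatives of the H-conjugacy classes in S, and
   rep V picks representatives of the cosets in K/V for V in S0. *)
Section Witt.
Variables (G : profiniteGroupType) (K H : set G).
Variables (S S0 : set (set G)) (rep : set G -> set G -> G).

Section Ghost.
Variables (R : comPzRingType) (M : lmodType R).

(* g.(-), for U' = conjs g U: the factor at a U' is the old one at a U' g = a g U. *)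
Definition tact (g : G) (U U' : set G) :
    tpow M (cosets K U) -> tpow M (cosets K U') :=
  tpow_reindex (fun A => insub (rtrans (val A) g)).

Definition ghost_group :=
  dprod (fun U : S => tpow M (cosets K (val U)) : zmodType).
HB.instance Definition _ := TopologicalZmodule.on ghost_group.

(* gh_{H <= K}: the points fixed by H. *)
Definition ghost_fixed : set ghost_group :=
  [set x | forall (U U' : S) (h : G), H h -> val U' = conjs h (val U) ->
     tact h (val U') (x U) = x U'].

(* The inverse a U |-> (a V, rep(a V)^-1 a U) of the bijection
   (g_i V, s U) |-> g_i s U. *)
Definition coset_split (U V : set G) (A : cosets K U) :
    option (cosets K V * cosets V U) :=
  let B := [set (a * v)%g | a in val A & v in V] in
  match insub B, insub (ltrans (rep V B)^-1%g (val A)) with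
  | Some B', Some C' => Some (B', C')
  | _, _ => None
  end.

Definition tconcat (U V : set G) :
    tpow M (cosets K V * cosets V U) -> tpow M (cosets K U) :=
  tpow_reindex (@coset_split U V).

(* (H/V)^U *)
Definition fixed_cosets (V U : set G) : set (set G) :=
  [set A | exists h, [/\ H h, A = ltrans h V & conjs h^-1%g U `<=` V]].

(* The summand at h V does not depend on the element h of the coset A. The
   coordinates n V for V outside of S0 are not used. *)
Definition ghost_map (n : forall V : set G, tpow M (cosets K V)) :
    ghost_group :=
  fun U => \sum_(V \in S0) \sum_(A \in fixed_cosets V (val U))
    let h := xget 1%g A in
    let Uh := conjs h^-1%g (val U) in
    tact h (val U) (tconcat (tpow_power (cosets V Uh) (n V)) : tpow M (cosets K Uh)).

(* W(R;M) for free (R;M), as a topological subgroup of the ghost group. The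
   image of ghost_map is contained in ghost_fixed, and it is already a subgroup
   if (R;M) is free; generating a subgroup only makes the definition total. *)
Definition witt_free : topologicalZmodType :=
  tsub (subgroup_gen (ghost_fixed `&` range ghost_map)).

End Ghost.

Section GhostFunctor.
Variables (R R' : comPzRingType) (M : lmodType R) (M' : lmodType R').
Variables (a : R -> R') (f : M -> M').

Definition ghost_group_map (x : ghost_group M) : ghost_group M' :=
  fun U => tpow_map a f (x U).

(* The restriction of ghost_group_map; for a morphism (a, f) of Mod, it does map
   witt_free M to witt_free M', so that the default value 0 is not used. *)
Definition witt_free_map (x : witt_free M) : witt_free M' :=
  insubd 0 (ghost_group_map (val x)).

End GhostFunctor.

Section WittVectors.
Variables (R : comPzRingType) (M : lmodType R).

Definition witt_differences : set (witt_free (FU M)) :=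
  range (fun x : witt_free (FU (FU M)) =>
    witt_free_map (@eps_ring (Zpoly R)) (@eps_mod (Zpoly R) (FU M)) x
    - witt_free_map (FU_ring (@eps_ring R)) (FU_mod (@eps_ring R) (@eps_mod R M)) x).

Definition witt : topologicalZmodType := hquot witt_differences.

(* The ghost map of W(R;M), induced by that of witt_free (FU M) and the counit. *)
Definition witt_ghost (q : witt) : ghost_group M :=
  ghost_group_map (@eps_ring R) (@eps_mod R M) (val (repr q)).

End WittVectors.

Definition witt_map (R R' : comPzRingType) (M : lmodType R) (M' : lmodType R')
    (a : R -> R') (f : M -> M') (q : witt M) : witt M' :=
  \pi_(hquot (@witt_differences R' M'))
    (witt_free_map (FU_ring a) (FU_mod a f) (repr (q : hquot (@witt_differences R M)))).

End Witt.

(* For sigma representing the cosets in K/H, the isomorphism from the tensor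
   power of M over K/U to the tensor power over H/U of the tensor power of M over
   K/H, induced by the bijection (sigma(A) H, h U) |-> sigma(A) h U. *)
Definition tpow_assoc (G : profiniteGroupType) (K H U : set G)
    (sigma : set G -> G) (R : comPzRingType) (M : lmodType R) :
    tpow M (cosets K U) -> tpow (tpow M (cosets K H)) (cosets H U) :=
  tpow_lift id (fun m => tens (fun C : cosets H U =>
    tens (fun A : cosets K H =>
      oapp m 0 (insub (ltrans (sigma (val A)) (val C)))))).

(* Main.v *)
Require Import Defs.
From HB Require Import structures.
From mathcomp Require Import all_boot all_order all_algebra.
From mathcomp Require Import finmap monalg.
From mathcomp Require Import all_classical.
From mathcomp Require Import topology normedtype.
Set Implicit Arguments.
Unset Strict Implicit.
Unset Printing Implicit Defensive.
Import GRing.Theory.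
Local Open Scope classical_set_scope.
Local Open Scope ring_scope.
Local Open Scope quotient_scope.

(** Let K be the ambient group (G or H). A family consists of an H-set D all of
    whose fixed point sets D^U, U in S, are finite, and an equivariant map mu from
    D to the functions on K. Its value is the ghost vector whose component at U is
    the sum over x in D^U of the pure tensor with factor mu x a at aU.

    Over a free module, the image of the ghost map is the set of differences of
    values of families. Expanding the tensor powers of sums of pure tensors, a ghost
    vector is the value of a family of colourings. Conversely, subtracting the ghost
    vector of representatives of the orbits whose stabilisers have lowest rank leaves
    a difference of families of larger rank, and one concludes by recursion.

    By the bijection (sigma(A)H, hU) |-> sigma(A)hU, families over G in M are the
    same as families over H of pure tensors in the tensor power of M over G/H, and
    by multilinearity every family in that tensor power expands into pure tensors.
    So for Q free, W_{H<=G}(T;Q) is identified with the differences of families over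
    H in the tensor power of Q.

    Two families in Q = FU M, or in its tensor power, that agree after the counit
    lift to a family in FU FU M, or in its tensor power: a reflexive pair of
    homomorphisms of groups is the kernel pair of its coequaliser, and tensor powers
    preserve reflexive coequalisers. Hence semilinear maps that agree after the
    counit agree in W. The tensor power of FU M and FU of the tensor power of M map
    to each other compatibly with the counits, so these maps induce mutually inverse
    isomorphisms, and naturality holds for the same reason. *)

(** * Semilinear maps and tensor powers *)

(** The ghost map depends on orbit representatives, on coset representatives and on the ambient
    group, and it is not additive; families carry none of these choices. Their decisive property is
    that mu can be composed with any function, additive or not. So lifts along the counit may be
    chosen element by element and then applied to a whole ghost vector.

    That the image of the ghost map is a group is a genuine assertion, since a family has no
    negative. S may be infinite, so the recursion on the rank need not end, but it converges: if all
    stabilisers have rank at least k, the value vanishes at every U of rank below k, and each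
    component is settled after finitely many steps.

    The tensor power of FU M over G/H is free, but on the functions from G/H to M, so it is not FU
    of the tensor power: the two sides of the isomorphism come with different presentations. Lifts
    through the resolution exist exactly and not just up to closure, so closures enter only through
    continuity. *)

Definition ring_hom (R R' : pzRingType) (a : R -> R') :=
  [/\ a 1 = 1, {morph a : x y / x + y} & {morph a : x y / x * y}].

(** A predicate on bare functions, because the maps in the definition of W, such as [FU_ring] and
    [tpow_map], are not packaged as morphisms. *)
Definition semilin (R R' : pzRingType) (M : lmodType R) (M' : lmodType R')
    (a : R -> R') (f : M -> M') :=
  {morph f : x y / x + y} /\ forall r x, f (r *: x) = a r *: f x.

Section Additive.
Variables (U V : zmodType) (f : U -> V).
Hypothesis fD : {morph f : x y / x + y}.

Lemma morph_add0 : f 0 = 0.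
Proof. by apply: (addrI (f 0)); rewrite -fD !addr0. Qed.

Lemma morph_addN x : f (- x) = - f x.
Proof. by apply: (addrI (f x)); rewrite -fD !subrr morph_add0. Qed.

Lemma morph_addB x y : f (x - y) = f x - f y.
Proof. by rewrite fD morph_addN. Qed.

Lemma morph_add_sum (I : Type) (r : seq I) (P : pred I) (F : I -> U) :
  f (\sum_(i <- r | P i) F i) = \sum_(i <- r | P i) f (F i).
Proof. exact: (big_morph f fD morph_add0). Qed.

End Additive.

Lemma ring_hom_rmorphism (R R' : pzRingType) (a : {rmorphism R -> R'}) : ring_hom a.
Proof. by split; [exact: rmorph1|exact: rmorphD|exact: rmorphM]. Qed.

Lemma semilin_linear (R R' : pzRingType) (M : lmodType R) (M' : lmodType R')
  (a : {rmorphism R -> R'}) (f : {linear M -> M' | a \; *:%R}) : semilin a f.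
Proof. by split=> [x y|r x]; rewrite ?linearD ?linearZ. Qed.

Lemma semilin_id (R : pzRingType) (M : lmodType R) :
  semilin (id : R -> R) (id : M -> M).
Proof. by []. Qed.

Lemma semilin_comp (R R' R'' : pzRingType) (M : lmodType R) (M' : lmodType R')
    (M'' : lmodType R'') (a : R -> R') (b : R' -> R'') (f : M -> M')
    (g : M' -> M'') :
  semilin a f -> semilin b g -> semilin (b \o a) (g \o f).
Proof.
by move=> [fD fZ] [gD gZ]; split=> [x y|r x] /=; rewrite ?fD ?gD ?fZ ?gZ.
Qed.

Lemma semilin_compE (R R' R'' : pzRingType) (M : lmodType R) (M' : lmodType R')
    (M'' : lmodType R'') (a : R -> R') (b : R' -> R'') (c : R -> R'')
    (f : M -> M') (g : M' -> M'') :
  semilin a f -> semilin b g -> (forall r, b (a r) = c r) ->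
  semilin c (fun x => g (f x)).
Proof.
move=> [fD fZ] [gD gZ] ba; split=> [x y|r x] /=; first by rewrite fD gD.
by rewrite fZ gZ ba.
Qed.

(* The witness is [x] - [y] + s y. *)
Lemma reflexive_pair (A B : zmodType) (C : Type) (d0 d1 : A -> B) (e : B -> C)
    (gen s : B -> A) :
  {morph d0 : x y / x + y} -> {morph d1 : x y / x + y} ->
  cancel gen d0 -> (forall x y, e x = e y -> d1 (gen x) = d1 (gen y)) ->
  cancel s d0 -> cancel s d1 ->
  forall x y, e x = e y -> exists z, d0 z = x /\ d1 z = y.
Proof.
move=> d0D d1D genK ge s0 s1 x y xy; exists (gen x - gen y + s y).
rewrite d0D d1D (morph_addB d0D) (morph_addB d1D) !genK (ge _ _ xy) s0 s1.
by rewrite subrK subrr add0r.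
Qed.

Lemma semilin_comp_id (R : pzRingType) (M M' M'' : lmodType R) (f : M -> M')
    (g : M' -> M'') :
  semilin id f -> semilin id g -> semilin id (g \o f).
Proof. exact: semilin_comp. Qed.

Lemma ring_hom_id (R : pzRingType) : ring_hom (id : R -> R).
Proof. by []. Qed.

Lemma ring_hom_comp (R R' R'' : pzRingType) (a : R -> R') (b : R' -> R'') :
  ring_hom a -> ring_hom b -> ring_hom (b \o a).
Proof.
move=> [a1 aD aM] [b1 bD bM].
by split=> [|x y|x y] /=; rewrite ?a1 ?b1 ?aD ?bD ?aM ?bM.
Qed.

(** * The universal property of Z[X] *)

Section ZpolyLift.
Variables (X : choiceType) (R : comPzRingType) (f : X -> R).

Let mon (m : {cmonom X}) : R := \prod_(x <- finsupp m) f x ^+ m x.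

Let monE (d : {fset X}) (m : {cmonom X}) : (finsupp m `<=` d)%fset ->
  mon m = \prod_(x <- d) f x ^+ m x.
Proof.
move=> md; rewrite /mon (big_fset_incl _ md) // => i _.
by rewrite -cmE_neq0 negbK => /eqP ->.
Qed.

Let monM m1 m2 : mon (mmul m1 m2) = mon m1 * mon m2.
Proof.
rewrite (monE (fsubsetUl (finsupp m1) (finsupp m2))).
rewrite (monE (fsubsetUr (finsupp m1) (finsupp m2))) {1}/mon mdomD.
by rewrite -big_split; apply: eq_bigr => i _; rewrite cmM exprD.
Qed.

Local Notation L := (Zpoly_lift f).

Let LE (d : {fset {cmonom X}}) (p : Zpoly X) : (msupp p `<=` d)%fset ->
  L p = \sum_(m <- d) (p@_m)%:~R * mon m.
Proof.
move=> pd; rewrite /Zpoly_lift (big_fset_incl _ pd) // => m _.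
by rewrite -mcoeff_eq0 => /eqP ->; rewrite mul0r.
Qed.

Let LD : {morph L : p q / p + q}.
Proof.
move=> p q.
have sp := fsubsetUl (msupp p) (msupp q); have sq := fsubsetUr (msupp p) (msupp q).
rewrite (LE sp) (LE sq) (LE (msuppD_le p q)) -big_split; apply: eq_bigr => m _.
by rewrite mcoeffD intrD mulrDl.
Qed.

Let LU c m : L << c *g m >> = c%:~R * mon m.
Proof. by rewrite (LE msuppU_le) big_seq_fset1 mcoeffUU. Qed.

Let LM : {morph L : p q / p * q}.
Proof.
move=> p q; rewrite malgME.
rewrite (morph_add_sum LD) [L p]/Zpoly_lift big_distrl; apply: eq_bigr => i _.
rewrite (morph_add_sum LD) [L q]/Zpoly_lift big_distrr; apply: eq_bigr => j _.
by rewrite LU monM intrM /= -!mulrA; congr (_ * _); rewrite mulrCA.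
Qed.

Let L1 : L 1 = 1.
Proof. by rewrite LU mul1r /mon mdom1 big_seq_fset0. Qed.

Lemma Zpoly_lift_hom : ring_hom L.
Proof. by split; [exact: L1|exact: LD|exact: LM]. Qed.

Lemma Zpoly_lift_var x : L (Zpoly_var x) = f x.
Proof. by rewrite LU mul1r /mon mdomU big_seq_fset1 cmUU. Qed.

End ZpolyLift.

Lemma ring_hom_int (R R' : pzRingType) (a : R -> R') (z : int) : ring_hom a ->
  a z%:~R = z%:~R.
Proof.
move=> [a1 aD aM].
have aN n : a n%:R = n%:R.
  elim: n => [|n IH]; first exact: (morph_add0 aD).
  by rewrite -addn1 !natrD aD IH a1.
case: z => n; first exact: aN.
exact: etrans (morph_addN aD _) (congr1 _ (aN n.+1)).
Qed.

(** On monomials by induction on the degree, one variable being split off at a time; the values on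
    the integer coefficients are forced. *)
Lemma Zpoly_hom_ext (X : choiceType) (R : pzRingType) (a b : Zpoly X -> R) :
  ring_hom a -> ring_hom b -> (forall x, a (Zpoly_var x) = b (Zpoly_var x)) ->
  a =1 b.
Proof.
move=> ha hb ab p; have [a1 aD aM] := ha; have [b1 bD bM] := hb.
have abM (x q : Zpoly X) : a x = b x -> a q = b q -> a (x * q) = b (x * q).
  by move=> abx abq; rewrite aM bM abx abq.
have abU n (m : {cmonom X}) : mdeg m = n ->
    a (<< m >> : {malg int[{cmonom X}]}) = b (<< m >> : {malg int[{cmonom X}]}).
  elim: n m => [m /mdeg_eq0I ->|n IH m mn]; first by rewrite a1 b1.
  have [m0|[i im]] := fset_0Vmem (finsupp m).
    by move: mn; rewrite mdegE m0 big_seq_fset0.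
  have mE : m = mmul (ucm i) (divcm m (ucm i)).
    apply/eqP/cmP => j; rewrite cmM divcmE ucmE.
    have [<-|_] := eqVneq i j; last by rewrite subn0.
    by rewrite subnKC // lt0n cmE_neq0.
  have -> : << m >> = Zpoly_var i * (<< divcm m (ucm i) >> : Zpoly X) :> Zpoly X.
    by rewrite [RHS]fgmulUU mulr1 -mE.
  apply: abM (ab i) (IH _ _).
  by apply/eqP; rewrite -eqSS -add1n -(mdegU i) -mdegM -mE mn.
rewrite [p]monalgE (morph_add_sum aD) (morph_add_sum bD); apply: eq_bigr => m _.
pose q : Zpoly X := << m >>.
have -> : << p@_m *g m >> = (p@_m)%:~R * q :> Zpoly X.
  rewrite mulrzl; apply/esym/malgP => k; rewrite mcoeffU -[p@_m in RHS]intz.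
  by rewrite raddfMz /= mcoeffU1; case: eqP => _; rewrite ?mul0rz.
by apply: abM (abU _ m erefl); rewrite !ring_hom_int.
Qed.

(** * The universal property of free modules *)

Section FreeModuleLift.
Variables (R R' : pzRingType) (Y : choiceType).

Lemma freemod_finite (x : freemod R Y) : finite_set [set y | x y <> 0].
Proof. by case: x => x /= /asboolP. Qed.

Lemma freemodP (x y : freemod R Y) : (forall i, x i = y i) -> x = y.
Proof. by move=> xy; apply/val_inj/funext. Qed.

Lemma fm_genE (y z : Y) : fm_gen R y z = (z == y)%:R.
Proof.
rewrite /fm_gen /insubd insubT //; apply/asboolP.
by apply: (sub_finite_set _ (finite_set1 y)) => z' /=; case: eqP.
Qed.

Lemma freemod_sumE (I : Type) (r : seq I) (F : I -> freemod R Y) y :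
  (\sum_(i <- r) F i) y = \sum_(i <- r) F i y.
Proof.
by apply: (big_morph (fun x : freemod R Y => x y)).
Qed.

Lemma freemod_sum (s : seq Y) (x : freemod R Y) : uniq s ->
  (forall y, x y <> 0 -> y \in s) -> x = \sum_(y <- s) (x y : R) *: fm_gen R y.
Proof.
move=> us xs; apply: freemodP => z; rewrite freemod_sumE.
have zE y : ((x y : R) *: fm_gen R y : freemod R Y) z = x y * (z == y)%:R.
  by rewrite -fm_genE.
under eq_bigr do rewrite zE.
have [zs|zs] := boolP (z \in s).
  rewrite (bigD1_seq z) //= eqxx mulr1 big1 ?addr0 // => i.
  by rewrite eq_sym => /negPf ->; rewrite mulr0.
rewrite big_seq big1 => [|i si].
  by apply: contrapT => /xs; rewrite (negPf zs).
by case: eqP si => [<-|]; rewrite ?mulr0 // (negPf zs).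
Qed.

Lemma freemod_supp2 (x y : freemod R Y) :
  exists2 s : seq Y, uniq s &
    forall i, (x i <> 0 -> i \in s) /\ (y i <> 0 -> i \in s).
Proof.
have fU : finite_set ([set i | x i <> 0] `|` [set i | y i <> 0]).
  by rewrite finite_setU; split; apply: freemod_finite.
exists (fset_set ([set i | x i <> 0] `|` [set i | y i <> 0])) => [|i].
  exact: fset_uniq.
by rewrite in_fset_set // inE; split=> ?; [left|right].
Qed.

Variables (M' : lmodType R') (a : R -> R') (phi : Y -> M').

Lemma fm_liftE (s : seq Y) (x : freemod R Y) : a 0 = 0 -> uniq s ->
  (forall y, x y <> 0 -> y \in s) ->
  fm_lift a phi x = \sum_(y <- s) a (x y) *: phi y.
Proof.
move=> a0 us xs; rewrite /fm_lift; rewrite (fsbigE s) // => [|y _ ys].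
  by apply: eq_bigl => y; rewrite in_setT.
suff -> : x y = 0 by rewrite a0 scale0r.
by apply: contrapT => /xs; rewrite (negPf ys).
Qed.

Hypothesis ha : ring_hom a.

Lemma ring_hom0 : a 0 = 0.
Proof. by case: ha => _ aD _; apply: morph_add0. Qed.

Lemma fm_lift_semilin : semilin a (fm_lift a phi).
Proof.
have a0 := ring_hom0; have [a1 aD aM] := ha; split=> [x y|r x].
  have [s us xys] := freemod_supp2 x y.
  rewrite !(fm_liftE a0 us); first rewrite -big_split.
  - by apply: eq_bigr => i _ /=; rewrite aD scalerDl.
  - by move=> i /(xys i).2.
  - by move=> i /(xys i).1.
  - move=> i; apply: contra_notT => si; change (x i + y i = 0).
    have /contra_not/(_ (negP si))/contrapT -> := (xys i).1.
    by have /contra_not/(_ (negP si))/contrapT -> := (xys i).2; rewrite addr0.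
have [s us xs] := freemod_supp2 x x.
rewrite !(fm_liftE a0 us); first rewrite scaler_sumr.
- by apply: eq_bigr => i _; rewrite scalerA -aM.
- by move=> i /(xs i).2.
- move=> i; apply: contra_notT => si; change (r * x i = 0).
  by have /contra_not/(_ (negP si))/contrapT -> := (xs i).2; rewrite mulr0.
Qed.

Lemma fm_lift_gen y : fm_lift a phi (fm_gen R y) = phi y.
Proof.
have [a1 _ _] := ha.
rewrite (fm_liftE (s := [:: y]) ring_hom0) //.
  by rewrite big_seq1 fm_genE eqxx a1 scale1r.
by move=> z; rewrite fm_genE inE; case: eqP.
Qed.

End FreeModuleLift.

Lemma semilin_sum (R R' : pzRingType) (M : lmodType R) (M' : lmodType R')
    (a : R -> R') (f : M -> M') (I : Type) (r : seq I) (c : I -> R) (F : I -> M) :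
  semilin a f -> f (\sum_(i <- r) c i *: F i) = \sum_(i <- r) a (c i) *: f (F i).
Proof.
by move=> [fD fZ]; rewrite (morph_add_sum fD); apply: eq_bigr => i _; rewrite fZ.
Qed.

Lemma freemod_ext (R R' : pzRingType) (Y : choiceType) (M' : lmodType R')
    (a : R -> R') (f g : freemod R Y -> M') :
  semilin a f -> semilin a g -> (forall y, f (fm_gen R y) = g (fm_gen R y)) ->
  f =1 g.
Proof.
move=> hf hg fg x; have [s us xs] := freemod_supp2 x x.
rewrite [x](freemod_sum us); last by move=> i /(xs i).1.
by rewrite (semilin_sum _ _ _ hf) (semilin_sum _ _ _ hg); apply: eq_bigr => i _; rewrite fg.
Qed.

Section SubmoduleQuotientTheory.
Variables (R : pzRingType) (V : lmodType R) (D : set V).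

Lemma submod_gen_ind (P : V -> Prop) :
  P 0 -> (forall a x y, P x -> P y -> P (a *: x + y)) -> D `<=` P ->
  forall x, x \in submod_gen D -> P x.
Proof.
move=> P0 PD DP x /asboolP /(_ (fun y => `[<P y>])) xP.
suff /asboolP : x \in (fun y => `[<P y>] : bool) by [].
apply: xP => [|y Dy]; last by apply/asboolP/DP.
split=> [|a y z]; first exact/asboolP.
by move=> /asboolP Py /asboolP Pz; apply/asboolP/PD.
Qed.

Lemma submod_gen_sub x : D x -> x \in submod_gen D.
Proof. by move=> Dx; apply/asboolP => P cP; apply. Qed.

Lemma sq_pi_eq (x y : V) :
  \pi_(submod_quot D) x = \pi_(submod_quot D) y <-> x - y \in submod_gen D.
Proof.
have memE z : (z \in (submod_gen D : zmodClosed V)) = (z \in submod_gen D) by [].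
by rewrite -memE Quotient.idealrBE; split=> [->|/eqP].
Qed.

Lemma sq_pi_semilin : semilin id (\pi_(submod_quot D) : V -> submod_quot D).
Proof.
split=> [x y|r x]; first exact: raddfD.
by rewrite -[LHS]/(\pi_(submod_quot D) (r *: x)) -sq_scale_pi.
Qed.

End SubmoduleQuotientTheory.

(** The shape of [tpow_rel]: comparing functions that agree off i, instead of updating one, works
    for an index type without decidable equality. *)
Definition multilin (R R' : pzRingType) (M : lmodType R) (N : lmodType R')
    (I : Type) (a : R -> R') (phi : (I -> M) -> N) :=
  forall (i : I) (m m1 m2 : I -> M) (r : R),
    (forall j, j <> i -> m j = m1 j /\ m j = m2 j) -> m i = r *: m1 i + m2 i ->
    phi m = a r *: phi m1 + phi m2.

Section TensorTheory.
Variables (R : comPzRingType) (M : lmodType R) (I : Type).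
Local Notation T := (tpow M I).

Lemma tens_multilin : multilin id (@tens R M I).
Proof.
move=> i m m1 m2 r mE miE.
have [piD piZ] := sq_pi_semilin (@tpow_rel R M I).
rewrite /tens -piZ -piD; apply/sq_pi_eq/submod_gen_sub.
by exists i, m, m1, m2, r; split; rewrite // opprD addrA.
Qed.

Lemma tpow_repr (t : T) : exists x : freemod R (I -> M),
  t = \pi_(submod_quot (@tpow_rel R M I)) x.
Proof. exact: sq_piP. Qed.

Lemma tpow_span (t : T) : exists s : seq (R * (I -> M)),
  t = \sum_(c <- s) c.1 *: tens c.2.
Proof.
have [x ->] := tpow_repr t; have [s us xs] := freemod_supp2 x x.
exists [seq (x y : R, y) | y <- s]; rewrite big_map /=.
rewrite {1}[x](freemod_sum us); last by move=> i /(xs i).1.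
exact: (semilin_sum _ _ _ (sq_pi_semilin _)).
Qed.

Variables (R' : pzRingType) (N : lmodType R') (a : R -> R').

Lemma tpow_ext (f g : T -> N) :
  semilin a f -> semilin a g -> (forall m, f (tens m) = g (tens m)) -> f =1 g.
Proof.
move=> hf hg fg t; have [s ->] := tpow_span t.
by rewrite (semilin_sum _ _ _ hf) (semilin_sum _ _ _ hg); apply: eq_bigr => i _; rewrite fg.
Qed.

End TensorTheory.

Section TensorLift.
Variables (R : comPzRingType) (M : lmodType R) (I : Type).
Variables (R' : comPzRingType) (N : lmodType R') (a : R -> R').
Variable phi : (I -> M) -> N.
Hypotheses (ha : ring_hom a) (hphi : multilin a phi).

(** A multilinear phi kills the relations, so the representative on which [tpow_lift] is computed
    does not matter. *)
Let liftE x : tpow_lift a phi (\pi_(submod_quot (@tpow_rel R M I)) x) = fm_lift a phi x.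
Proof.
rewrite /tpow_lift; set y := repr _.
have [fD fZ] := fm_lift_semilin phi ha.
suff E z : z \in submod_gen (@tpow_rel R M I) -> fm_lift a phi z = 0.
  apply/subr0_eq; rewrite -(morph_addB fD); apply/E/sq_pi_eq.
  by rewrite reprK.
move: z; apply: submod_gen_ind => [|r z w z0 w0|z].
- exact: morph_add0 fD.
- by rewrite fD fZ z0 w0 scaler0 addr0.
- move=> [i [m [m1 [m2 [r [mE miE ->]]]]]].
  rewrite !(morph_addB fD) fZ !fm_lift_gen // (hphi mE miE).
  by rewrite -addrA -opprD subrr.
Qed.

Lemma tpow_lift_semilin : semilin a (tpow_lift a phi : tpow M I -> N).
Proof.
have [fD fZ] := fm_lift_semilin phi ha.
have [piD piZ] := sq_pi_semilin (@tpow_rel R M I).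
split=> [t u|r t]; have [x ->] := tpow_repr t.
  by have [y ->] := tpow_repr u; rewrite -piD !liftE.
by rewrite -piZ !liftE.
Qed.

Lemma tpow_lift_tens m : tpow_lift a phi (tens m : tpow M I) = phi m.
Proof. by rewrite liftE fm_lift_gen. Qed.

End TensorLift.

Definition upd (J : eqType) (M : Type) (m : J -> M) (j : J) (x : M) : J -> M :=
  fun i => if i == j then x else m i.

Lemma upd_same (J : eqType) (M : Type) (m : J -> M) j x : upd m j x j = x.
Proof. by rewrite /upd eqxx. Qed.

Lemma upd_other (J : eqType) (M : Type) (m : J -> M) j x i :
  i <> j -> upd m j x i = m i.
Proof. by rewrite /upd; case: eqP. Qed.

(** * Expansion of a multilinear map on sums *)

Section MultilinearExpansion.
Variables (R R' : pzRingType) (M : lmodType R) (N : lmodType R').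
Variables (J : choiceType) (a : R -> R') (phi : (J -> M) -> N).
Hypotheses (ha : ring_hom a) (hphi : multilin a phi).

Lemma multilin_updD m j r x y :
  phi (upd m j (r *: x + y)) = a r *: phi (upd m j x) + phi (upd m j y).
Proof.
by apply: (hphi (i := j)) => [i ij|]; rewrite ?upd_same // !upd_other.
Qed.

Lemma multilin_upd0 m j : phi (upd m j 0) = 0.
Proof.
have := multilin_updD m j 1 0 0; rewrite scaler0 addr0; have [-> _ _] := ha.
by rewrite scale1r => /eqP; rewrite addrC -subr_eq subrr => /eqP <-.
Qed.

Lemma multilin_updZ m j r x : phi (upd m j (r *: x)) = a r *: phi (upd m j x).
Proof. by rewrite -[r *: x]addr0 multilin_updD multilin_upd0 addr0. Qed.

Lemma multilin_upd_sum m j (K : Type) (s : seq K) (F : K -> M) :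
  phi (upd m j (\sum_(k <- s) F k)) = \sum_(k <- s) phi (upd m j (F k)).
Proof.
elim: s => [|k s IH]; first by rewrite !big_nil multilin_upd0.
rewrite !big_cons -IH -{1}[F k]scale1r multilin_updD.
by have [-> _ _] := ha; rewrite scale1r.
Qed.

Definition choices (k : J -> nat) : set (J -> nat) :=
  [set c | forall j, (c j < k j)%N].

(** Fixing the value 0 off s makes each choice on s a single function, so that the induction on s
    counts it once. *)
Let choices_on (k : J -> nat) (s : seq J) : set (J -> nat) :=
  [set c | forall j, if j \in s then (c j < k j)%N else c j == 0%N].

Let choices_bij k j s : j \notin s ->
  set_bij (`I_(k j) `*` choices_on k s) (choices_on k (j :: s))
    (fun p => upd p.2 j p.1).
Proof.
move=> js; split=> [[i c] /= [ik cs] l|[i c] [i' c'] /[!inE] /= -[_ cs] [_ cs']|c cs].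
- by rewrite inE /upd; have := cs l; case: (eqVneq l j) => [->|_].
- move=> E; have := congr1 (@^~ j) E; rewrite /= !upd_same => ->; congr pair.
  apply: funext => l; have := congr1 (@^~ l) E.
  have [->|/eqP lj] := eqVneq l j; last by rewrite !upd_other.
  by have := cs j; have := cs' j; rewrite (negPf js) => /eqP -> /eqP ->.
exists (c j, upd c j 0%N) => /=.
  split=> [|l]; first by have := cs j; rewrite inE eqxx.
  rewrite /upd; have := cs l; rewrite inE.
  by case: (eqVneq l j) => [->|] //; rewrite (negPf js).
by apply: funext => l; rewrite /upd; case: eqP => [->|].
Qed.

Let choices_fin k s : uniq s -> finite_set (choices_on k s).
Proof.
elim: s => [_|j s IH /= /andP[js us]].
  apply: (sub_finite_set _ (finite_set1 (fun=> 0%N))) => c /= c0.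
  by apply: funext => j; apply/eqP/c0.
have [_ _ cov] := choices_bij k js; apply: (sub_finite_set cov).
by apply/finite_image/finite_setX; [exact: finite_II|exact: IH].
Qed.

(** The statement is for all m because the induction step moves the coordinate j from s into m. *)
Let multilin_expand_on (k : J -> nat) (z : J -> nat -> M) s m : uniq s ->
  phi (fun j => if j \in s then \sum_(i < k j) z j i else m j) =
  \sum_(c \in choices_on k s) phi (fun j => if j \in s then z j (c j) else m j).
Proof.
elim: s m => [m _|j s IH m /= /andP[js us]].
  rewrite (_ : choices_on k [::] = [set fun=> 0%N]) ?fsbig_set1 //.
  by apply/seteqP; split=> [c c0|c -> //]; apply: funext => j; apply/eqP/c0.
have E F : (fun l => if l \in j :: s then F l else m l) =
    (fun l => if l \in s then F l else upd m j (F j) l) :> (J -> M).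
  apply: funext => l; rewrite inE /upd.
  by case: (eqVneq l j) => [->|_ //]; rewrite (negPf js).
rewrite E IH //.
have bij := @choices_bij k j s js.
rewrite [RHS](reindex_fsbig _ _ _ _ bij).
rewrite -(@pair_fsbig _ _ _ nat (J -> nat : choiceType) _ _ (fun i c =>
  phi (fun l => if l \in j :: s then z l (upd c j i l) else m l))) /=;
  [|exact: finite_II|exact: choices_fin].
rewrite exchange_fsbig; [|exact: finite_II|exact: choices_fin].
apply: eq_fsbigr => c _; rewrite -fsbig_ord.
have U F x : (fun l => if l \in s then F l else upd m j x l) =
    upd (fun l => if l \in s then F l else m l) j x.
  apply: funext => l; rewrite /upd.
  by case: (eqVneq l j) => [->|_ //]; rewrite (negPf js).
rewrite U multilin_upd_sum; apply: eq_bigr => i _.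
congr phi; apply: funext => l; rewrite inE /upd.
by case: (eqVneq l j) => [->|].
Qed.

Hypothesis fJ : finite_set [set: J].

Let enumJ : seq J := fset_set [set: J].
Let enumJP j : j \in enumJ.
Proof. by rewrite in_fset_set // inE. Qed.

Let choices_onE k : choices k = choices_on k enumJ.
Proof. by apply/seteqP; split=> c ck j; have := ck j; rewrite enumJP. Qed.

Lemma finite_choices k : finite_set (choices k).
Proof. by rewrite choices_onE; apply/choices_fin/fset_uniq. Qed.

Lemma multilin_expand (k : J -> nat) (z : J -> nat -> M) :
  phi (fun j => \sum_(i < k j) z j i) =
  \sum_(c \in choices k) phi (fun j => z j (c j)).
Proof.
have := multilin_expand_on k z 0 (fset_uniq (fset_set [set: J])).
rewrite choices_onE; congr (_ = _).
  by congr phi; apply: funext => j; rewrite enumJP.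
by apply: eq_fsbigr => c _; congr phi; apply: funext => j; rewrite enumJP.
Qed.

End MultilinearExpansion.

Lemma multilin_tens (R : comPzRingType) (R' : pzRingType) (M : lmodType R) (I : Type)
    (N : lmodType R') (a : R -> R') (f : tpow M I -> N) :
  semilin a f -> multilin a (f \o @tens R M I).
Proof.
by move=> [fD fZ] i m m1 m2 r mE miE; rewrite /= (tens_multilin mE miE) fD fZ.
Qed.

(** Recording the position of each y i in an enumeration of S i turns the points of the box into
    choices. *)
Lemma finite_box (I Y : choiceType) (S : I -> set Y) : finite_set [set: I] ->
  (forall i, finite_set (S i)) -> finite_set [set y : I -> Y | forall i, S i (y i)].
Proof.
move=> fI fS; set B := [set y | _].
have [->|/set0P[y0 _]] := eqVneq B set0; first exact: finite_set0.
pose s i : seq Y := fset_set (S i).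
apply: (sub_finite_set _ (finite_image
  (fun (c : I -> nat) i => nth (y0 i) (s i) (c i)) (finite_choices fI (fun i => size (s i))))).
move=> y By; exists (fun i => index (y i) (s i)).
  by move=> i; rewrite index_mem in_fset_set // inE; apply: By.
by apply: funext => i; rewrite nth_index // in_fset_set // inE; apply: By.
Qed.

Definition spans (R : pzRingType) (M : lmodType R) (Y : Type) (e : Y -> M) :=
  forall x, exists s : seq (R * Y), x = \sum_(c <- s) c.1 *: e c.2.

Lemma freemod_spans (T : pzRingType) (Y : choiceType) : spans (@fm_gen T Y).
Proof.
move=> x; have [s us xs] := freemod_supp2 x x.
exists [seq (x y : T, y) | y <- s]; rewrite big_map /=.
exact: freemod_sum us (fun i => (xs i).1).
Qed.

Section SpanTensor.
Variables (T : comPzRingType) (Q : lmodType T) (Y : Type) (e : Y -> Q).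
Variable I : choiceType.
Hypotheses (Qe : spans e) (fI : finite_set [set: I]).

Lemma multilin_span_ext (R' : pzRingType) (N : lmodType R') (a : T -> R')
    (f g : (I -> Q) -> N) : ring_hom a -> multilin a f -> multilin a g ->
  (forall y : I -> Y, f (fun i => e (y i)) = g (fun i => e (y i))) -> f =1 g.
Proof.
move=> ha hf hg fg q.
(* Induction on a list s off which q takes values among the e y; expanding the coordinate j shortens
   the list. *)
suff H (s : seq I) : forall q : I -> Q,
    (forall i, i \notin s -> exists y : Y, q i = e y) -> f q = g q.
  by apply: (H (fset_set [set: I])) => i; rewrite in_fset_set // in_setT.
elim: s => [{}q qs|j s IH {}q qs].
  by have [y qy] := choice (fun i => qs i isT); rewrite (funext qy).
have qE : q = upd q j (q j).
  by apply: funext => i; rewrite /upd; case: eqP => [->|].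
have [t qtE] := Qe (q j).
rewrite {}qtE in qE; rewrite (congr1 f qE) (congr1 g qE).
rewrite (multilin_upd_sum ha hf) (multilin_upd_sum ha hg).
apply: eq_bigr => y _; rewrite (multilin_updZ ha hf) (multilin_updZ ha hg).
congr (_ *: _); apply: IH => i si; have [->|/eqP ij] := eqVneq i j.
  by exists y.2; rewrite upd_same.
by rewrite upd_other //; apply: qs; rewrite inE negb_or si andbT; apply/eqP.
Qed.

Lemma tpow_span_ext (R' : pzRingType) (N : lmodType R') (a : T -> R')
    (f g : tpow Q I -> N) : ring_hom a -> semilin a f -> semilin a g ->
  (forall y : I -> Y, f (tens (fun i => e (y i))) = g (tens (fun i => e (y i)))) ->
  f =1 g.
Proof.
move=> ha hf hg fg; apply: (tpow_ext hf hg).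
exact: (multilin_span_ext ha (multilin_tens hf) (multilin_tens hg)).
Qed.

End SpanTensor.

(** * Tensor powers of free modules *)

Section FreeTensor.
Variables (T : comPzRingType) (Y : choiceType) (I : choiceType).
Hypothesis fI : finite_set [set: I].

Variables (N : lmodType T) (g : (I -> Y) -> N).

(** The tensor power of a free module is free on the functions I -> Y, the coefficient of y in a
    pure tensor being the product of the coefficients of the factors. This is the linear map with
    value g y on the basis element y. *)
Definition free_tens_val (q : I -> freemod T Y) : N :=
  \sum_(y \in [set: I -> Y]) (\prod_(i <- fset_set [set: I]) q i (y i)) *: g y.

Let prodD (F : I -> T) i : \prod_(j <- fset_set [set: I]) F j =
  F i * \prod_(j <- fset_set [set: I] | j != i) F j.
Proof. by rewrite (bigD1_seq i) ?fset_uniq // in_fset_set // inE. Qed.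

Let free_tens_valE (B : set (I -> Y)) (q : I -> freemod T Y) :
  (forall y, (forall i, q i (y i) <> 0) -> B y) ->
  free_tens_val q =
  \sum_(y \in B) (\prod_(i <- fset_set [set: I]) q i (y i)) *: g y.
Proof.
move=> qB; apply/esym/fsbig_widen => // y [_ /= By].
have [/qB //|/existsNP[i /contrapT q0]] := pselect (forall i, q i (y i) <> 0).
by rewrite (prodD _ i) q0 mul0r scale0r.
Qed.

Lemma free_tens_val_multilin : multilin id free_tens_val.
Proof.
move=> i m m1 m2 r mE miE.
pose S j := [set y | m j y <> 0] `|` ([set y | m1 j y <> 0] `|` [set y | m2 j y <> 0]).
pose B := [set y : I -> Y | forall j, S j (y j)].
have fB : finite_set B.
  by apply: finite_box => // j; rewrite /S !finite_setU; split;
     [|split]; apply: freemod_finite.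
rewrite !(@free_tens_valE B); first last.
- by move=> y my j; left; apply: my.
- by move=> y my j; right; left; apply: my.
- by move=> y my j; right; right; apply: my.
rewrite !fsbig_finite // scaler_sumr -big_split; apply: eq_bigr => y _ /=.
rewrite !(prodD _ i) scalerA -scalerDl; congr (_ *: _).
rewrite mulrA [m i]miE -[(r *: m1 i + m2 i) _]/(r * m1 i (y i) + m2 i (y i)) mulrDl.
by congr (_ * _ + _ * _); apply: eq_bigr => j /eqP /mE[E1 E2]; rewrite -?E1 -?E2.
Qed.

Definition free_tens : tpow (freemod T Y) I -> N := tpow_lift id free_tens_val.

Lemma free_tens_semilin : semilin id free_tens.
Proof. exact: tpow_lift_semilin (ring_hom_id T) free_tens_val_multilin. Qed.

Lemma free_tens_gen y : free_tens (tens (fun i => fm_gen T (y i))) = g y.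
Proof.
rewrite /free_tens (tpow_lift_tens (ring_hom_id T) free_tens_val_multilin).
rewrite (@free_tens_valE [set y]) => [|z zy].
  by rewrite fsbig_set1 big1 ?scale1r // => i _; rewrite fm_genE eqxx.
by apply: funext => i; have := zy i; rewrite fm_genE; case: eqP.
Qed.

End FreeTensor.

Lemma free_tens_spans (T : comPzRingType) (Y I : choiceType) :
  finite_set [set: I] ->
  spans (fun y : I -> Y => tens (fun i => fm_gen T (y i)) : tpow (freemod T Y) I).
Proof.
move=> fI t; pose e (y : I -> Y) : tpow (freemod T Y) I := tens (fun i => fm_gen T (y i)).
have hx := free_tens_semilin fI (@fm_gen T (I -> Y : choiceType)).
have hl := fm_lift_semilin e (ring_hom_id T).
(* Expanding t in the basis and summing up again returns t, so t is a combination of the e y. *)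
have <- : fm_lift id e (free_tens (@fm_gen T (I -> Y : choiceType)) t) = t.
  apply: (tpow_span_ext (@freemod_spans T Y) fI (ring_hom_id T)
    (semilin_comp hx hl) (semilin_id _)) => y /=.
  by rewrite free_tens_gen // fm_lift_gen.
have [s ->] := freemod_spans (free_tens (@fm_gen T (I -> Y : choiceType)) t).
exists s; rewrite (semilin_sum _ _ _ hl); apply: eq_bigr => c _.
by rewrite fm_lift_gen.
Qed.

Section TensorMap.
Variables (R R' : comPzRingType) (M : lmodType R) (M' : lmodType R') (I : Type).
Variables (a : R -> R') (f : M -> M').
Hypotheses (ha : ring_hom a) (hf : semilin a f).

Let map_multilin : multilin a (fun m : I -> M => tens (f \o m)).
Proof.
move=> i m m1 m2 r mE miE; case: hf => fD fZ.
apply: (tens_multilin (i := i)) => [j ji|] /=; last by rewrite miE fD fZ.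
by have [-> //] := mE j ji; split=> //; have [<- <-] := mE j ji.
Qed.

Lemma tpow_map_semilin : semilin a (tpow_map a f : tpow M I -> tpow M' I).
Proof. exact: tpow_lift_semilin. Qed.

Lemma tpow_map_tens (m : I -> M) : tpow_map a f (tens m) = tens (f \o m).
Proof. exact: (tpow_lift_tens ha map_multilin). Qed.

End TensorMap.

Section TensorBijections.
Variables (R : comPzRingType) (M : lmodType R).

Lemma tens_bij_multilin (I J : Type) (b : J -> I) (u : I -> J) :
  cancel b u -> cancel u b ->
  multilin id (fun m : I -> M => tens (fun j => m (b j))).
Proof.
move=> bK uK i m m1 m2 r mE miE.
apply: (tens_multilin (i := u i)) => [j ji|]; last by rewrite uK.
by apply: mE => bj; apply: ji; rewrite -bj bK.
Qed.

Variables (I J K : Type) (b : I -> J -> K) (u : K -> I) (v : K -> J).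
Hypotheses (uvK : forall k, b (u k) (v k) = k).
Hypotheses (uK : forall i j, u (b i j) = i) (vK : forall i j, v (b i j) = j).

(** b is a bijection from I * J to K, with inverse (u, v). The instances are [pair], which gives
    [tpow_curry], and the joining of cosets, which gives [tpow_assoc]. *)
Definition tens2 (m : K -> M) : tpow (tpow M I) J :=
  tens (fun j => tens (fun i => m (b i j))).

Lemma tens2_multilin : multilin id tens2.
Proof.
move=> k m m1 m2 r mE mkE.
apply: (tens_multilin (i := v k)) => [j jk|].
  have bk i : b i j <> k by move=> bij; apply: jk; rewrite -bij vK.
  by split; congr tens; apply: funext => i; have [] := mE _ (bk i).
apply: (tens_multilin (i := u k)) => [i ik|]; last by rewrite uvK.
by apply: mE => bk; apply: ik; rewrite -bk uK.
Qed.

Definition tpow2 : tpow M K -> tpow (tpow M I) J := tpow_lift id tens2.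

Lemma tpow2_semilin : semilin id tpow2.
Proof. exact: tpow_lift_semilin (ring_hom_id R) tens2_multilin. Qed.

Lemma tpow2_tens m : tpow2 (tens m) = tens2 m.
Proof. exact: tpow_lift_tens (ring_hom_id R) tens2_multilin _. Qed.

End TensorBijections.

Section FreeTensorBijections.
Variables (T : comPzRingType) (Y : choiceType).
Local Notation Q := (freemod T Y).
Variables (I J K : choiceType) (b : I -> J -> K) (u : K -> I) (v : K -> J).
Hypotheses (uvK : forall k, b (u k) (v k) = k).
Hypotheses (uK : forall i j, u (b i j) = i) (vK : forall i j, v (b i j) = j).
Hypotheses (fI : finite_set [set: I]) (fJ : finite_set [set: J]).

(** The inner tensor powers are replaced by free modules on I -> Y; then the outer one is a tensor
    power of a free module, and the map is prescribed on its basis. *)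
Definition tpow2_inv (t : tpow (tpow Q I) J) : tpow Q K :=
  free_tens (fun y : J -> (I -> Y) => tens (fun k => fm_gen T (y (v k) (u k))))
    (tpow_map id (free_tens (@fm_gen T (I -> Y : choiceType))) t).

Let map_semilin := tpow_map_semilin J (ring_hom_id T)
  (free_tens_semilin fI (@fm_gen T (I -> Y : choiceType))).

Lemma tpow2_inv_semilin : semilin id tpow2_inv.
Proof. exact: semilin_comp map_semilin (free_tens_semilin fJ _). Qed.

Lemma tpow2_inv_tens (y : I -> J -> Y) :
  tpow2_inv (tens (fun j => tens (fun i => fm_gen T (y i j)))) =
  tens (fun k => fm_gen T (y (u k) (v k))).
Proof.
rewrite /tpow2_inv (tpow_map_tens _ (free_tens_semilin fI _)) //.
rewrite -[RHS](free_tens_gen fJ (fun y : J -> (I -> Y) =>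
  tens (fun k => fm_gen T (y (v k) (u k)))) (fun j i => y i j)).
by congr free_tens; congr tens; apply: funext => j /=; rewrite free_tens_gen.
Qed.

Lemma finite_bij2 : finite_set [set: K].
Proof.
apply: (sub_finite_set _ (finite_image (fun p => b p.1 p.2) (finite_setX fI fJ))).
by move=> k _; exists (u k, v k) => /=.
Qed.

Lemma tpow2K : cancel (@tpow2 T Q I J K b) tpow2_inv.
Proof.
suff E : tpow2_inv \o (@tpow2 T Q I J K b) =1 id by [].
apply: (tpow_span_ext (@freemod_spans T Y) finite_bij2 (ring_hom_id T)) => [||y].
- have h2 := @tpow2_semilin T Q _ _ _ _ _ _ uvK uK vK.
  exact: semilin_comp_id h2 tpow2_inv_semilin.
- exact: semilin_id.
rewrite /= (tpow2_tens uvK uK vK) /tens2.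
rewrite (tpow2_inv_tens (fun i j => y (b i j))).
by congr tens; apply: funext => k; rewrite uvK.
Qed.

Lemma tpow2_invK : cancel tpow2_inv (@tpow2 T Q I J K b).
Proof.
suff E : (@tpow2 T Q I J K b) \o tpow2_inv =1 id by [].
apply: (tpow_span_ext (free_tens_spans (T := T) (Y := Y) fI) fJ (ring_hom_id T)) => [||y].
- have h2 := @tpow2_semilin T Q _ _ _ _ _ _ uvK uK vK.
  exact: semilin_comp_id tpow2_inv_semilin h2.
- exact: semilin_id.
rewrite /= (tpow2_inv_tens (fun i j => y j i)) (tpow2_tens uvK uK vK) /tens2.
by congr tens; apply: funext => j; congr tens; apply: funext => i; rewrite uK vK.
Qed.

End FreeTensorBijections.

Section FreeTensorPower.
Variables (T : comPzRingType) (Y I J : choiceType).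
Hypotheses (fI : finite_set [set: I]) (fJ : finite_set [set: J]).
Local Notation Q := (freemod T Y).

(** By multilinearity the right-hand side is a preimage of the constant tensor on n under
    [tpow_curry]. That map is injective over a free module, so the arbitrary preimage in
    [tpow_power] is this one. *)
Lemma tpow_powerE (k : nat) (m : nat -> I -> Q) :
  tpow_power J (\sum_(i < k) tens (m i)) =
  \sum_(c \in choices (fun _ : J => k)) tens (fun p : I * J => m (c p.2) p.1).
Proof.
have uvK (p : I * J) : (p.1, p.2) = p by case: p.
have curryE : @tpow_curry T Q I J = @tpow2 T Q I J _ pair by [].
have [cD _] := @tpow2_semilin T Q _ _ _ _ _ _ uvK (fun _ _ => erefl) (fun _ _ => erefl).
set n := \sum_(i < k) _; set z0 := (X in _ = X).
have z0E : tpow_curry z0 = tens (fun _ : J => n).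
  rewrite /n (multilin_expand (ring_hom_id T) (@tens_multilin T _ J) fJ
    (fun=> k) (fun _ i => tens (m i))) /z0.
  rewrite !fsbig_finite; [|exact: finite_choices|exact: finite_choices].
  rewrite curryE (morph_add_sum cD); apply: eq_bigr => c _.
  by rewrite (tpow2_tens uvK).
apply: (can_inj (tpow2K (u := fst) (v := snd) uvK (fun _ _ => erefl) (fun _ _ => erefl) fI fJ)).
rewrite -curryE z0E /tpow_power.
by case: xgetP => [z -> //|/(_ z0)].
Qed.

End FreeTensorPower.

(** Each scalar is absorbed into the factor at i0. Families carry no coefficients, so elements have
    to be brought into this form. *)
Lemma tpow_pure_sum (R : comPzRingType) (M : lmodType R) (I : choiceType) (i0 : I)
  (t : tpow M I) : exists s : seq (I -> M), t = \sum_(m <- s) tens m.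
Proof.
have [s ->] := tpow_span t.
exists [seq upd c.2 i0 (c.1 *: c.2 i0) | c <- s]; rewrite big_map.
apply: eq_bigr => -[r m] _ /=.
rewrite (multilin_updZ (ring_hom_id R) (@tens_multilin R M I)).
by congr (_ *: tens _); apply: funext => i; rewrite /upd; case: eqP => [->|].
Qed.

(** * The canonical free resolution *)

Section FreeResolution.
Implicit Types R : comPzRingType.

Lemma FU_ring_hom R R' (a : R -> R') : ring_hom (FU_ring a).
Proof. exact: Zpoly_lift_hom. Qed.

Lemma FU_ring_var R R' (a : R -> R') x :
  FU_ring a (Zpoly_var x) = Zpoly_var (a x).
Proof. exact: Zpoly_lift_var. Qed.

Lemma eps_ring_hom R : ring_hom (@eps_ring R).
Proof. exact: Zpoly_lift_hom. Qed.

Lemma eps_ring_var R (x : R) : eps_ring (Zpoly_var x) = x.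
Proof. exact: Zpoly_lift_var. Qed.

Lemma FU_mod_semilin R R' (M : lmodType R) (M' : lmodType R') (a : R -> R')
  (f : M -> M') : semilin (FU_ring a) (FU_mod a f).
Proof. exact: fm_lift_semilin (FU_ring_hom a). Qed.

Lemma FU_mod_gen R R' (M : lmodType R) (M' : lmodType R') (a : R -> R')
  (f : M -> M') y : FU_mod a f (fm_gen _ y) = fm_gen _ (f y).
Proof. exact: fm_lift_gen (FU_ring_hom a) _. Qed.

Lemma eps_mod_semilin R (M : lmodType R) : semilin (@eps_ring R) (@eps_mod R M).
Proof. exact: fm_lift_semilin (eps_ring_hom R). Qed.

Lemma eps_mod_gen R (M : lmodType R) (y : M) : eps_mod (fm_gen _ y) = y.
Proof. exact: fm_lift_gen (eps_ring_hom R) _. Qed.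

Lemma eps_ring_natural R R' (a : R -> R') (r : Zpoly R) : ring_hom a ->
  eps_ring (FU_ring a r) = a (eps_ring r).
Proof.
move=> ha; move: r; apply: Zpoly_hom_ext => [||x].
- exact: ring_hom_comp (FU_ring_hom a) (eps_ring_hom R').
- exact: ring_hom_comp (eps_ring_hom R) ha.
- by rewrite FU_ring_var !eps_ring_var.
Qed.

Lemma eps_mod_natural R R' (M : lmodType R) (M' : lmodType R') (a : R -> R')
    (f : M -> M') (q : FU M) : ring_hom a -> semilin a f ->
  eps_mod (FU_mod a f q) = f (eps_mod q).
Proof.
move=> ha hf; move: q.
have h1 := semilin_compE (FU_mod_semilin a f) (@eps_mod_semilin R' M')
  (fun r => eps_ring_natural r ha).
have h2 := semilin_compE (@eps_mod_semilin R M) hf (fun=> erefl).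
apply: (freemod_ext h1 h2) => y.
by rewrite FU_mod_gen !eps_mod_gen.
Qed.

Variables (R : comPzRingType) (M : lmodType R).

(** The degeneracy of the resolution, generators going to generators on generators. It is a common
    section of the two face maps and makes the pair reflexive. *)
Definition unit_ring : Zpoly R -> Zpoly (Zpoly R) :=
  Zpoly_lift (fun r => Zpoly_var (Zpoly_var r)).

Definition unit_mod : FU M -> FU (FU M) :=
  fm_lift unit_ring (fun m => fm_gen _ (fm_gen _ m : FU M)).

Local Notation d0r := (@eps_ring (Zpoly R)).
Local Notation d1r := (FU_ring (@eps_ring R)).
Local Notation d0 := (@eps_mod (Zpoly R) (FU M)).
Local Notation d1 := (FU_mod (@eps_ring R) (@eps_mod R M)).

Let unit_ring_hom : ring_hom unit_ring. Proof. exact: Zpoly_lift_hom. Qed.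

Lemma unit_mod_semilin : semilin unit_ring unit_mod.
Proof. exact: fm_lift_semilin. Qed.

Let unit_mod_gen m : unit_mod (fm_gen _ m) = fm_gen _ (fm_gen _ m : FU M).
Proof. exact: fm_lift_gen. Qed.

Lemma unit_ring_d0 r : d0r (unit_ring r) = r.
Proof.
move: r; apply: Zpoly_hom_ext => [||x].
- exact: ring_hom_comp unit_ring_hom (eps_ring_hom _).
- exact: ring_hom_id.
- by rewrite /unit_ring Zpoly_lift_var eps_ring_var.
Qed.

Lemma unit_ring_d1 r : d1r (unit_ring r) = r.
Proof.
move: r; apply: Zpoly_hom_ext => [||x].
- exact: ring_hom_comp unit_ring_hom (FU_ring_hom _).
- exact: ring_hom_id.
- by rewrite /unit_ring Zpoly_lift_var FU_ring_var eps_ring_var.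
Qed.

Lemma unit_mod_d0 q : d0 (unit_mod q) = q.
Proof.
move: q; have h := semilin_compE unit_mod_semilin (@eps_mod_semilin _ (FU M)) unit_ring_d0.
apply: (freemod_ext h (semilin_id _)) => m.
by rewrite unit_mod_gen eps_mod_gen.
Qed.

Lemma unit_mod_d1 q : d1 (unit_mod q) = q.
Proof.
move: q; have h := semilin_compE unit_mod_semilin
  (FU_mod_semilin (@eps_ring R) (@eps_mod R M)) unit_ring_d1.
apply: (freemod_ext h (semilin_id _)) => m.
by rewrite unit_mod_gen FU_mod_gen eps_mod_gen.
Qed.

(** The generator on u goes to u under d0 and to the generator on [eps_ring u] under d1, and the
    latter is the same for u'. *)
Lemma eps_ring_pair (u u' : Zpoly R) : eps_ring u = eps_ring u' ->
  exists z, d0r z = u /\ d1r z = u'.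
Proof.
have [_ e0D _] := eps_ring_hom (Zpoly R).
have [_ e1D _] := FU_ring_hom (@eps_ring R).
apply: (reflexive_pair e0D e1D (@eps_ring_var _) _ unit_ring_d0 unit_ring_d1).
by move=> x y xy; apply: etrans (FU_ring_var _ _) (etrans (congr1 _ xy) (esym (FU_ring_var _ _))).
Qed.

Lemma eps_mod_pair (q q' : FU M) : eps_mod q = eps_mod q' ->
  exists z, d0 z = q /\ d1 z = q'.
Proof.
have [e0D _] := @eps_mod_semilin _ (FU M).
have [e1D _] := FU_mod_semilin (@eps_ring R) (@eps_mod R M).
apply: (reflexive_pair e0D e1D (@eps_mod_gen _ _) _ unit_mod_d0 unit_mod_d1).
by move=> x y xy; apply: etrans (FU_mod_gen _ _ _) (etrans (congr1 _ xy) (esym (FU_mod_gen _ _ _))).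
Qed.

End FreeResolution.

Lemma fm_lift_coef (R R' : pzRingType) (Y : choiceType) (a : R -> R')
    (x : freemod R Y) y : ring_hom a ->
  (fm_lift a (@fm_gen R' Y) x : freemod R' Y) y = a (x y).
Proof.
move=> ha; have [s us xs] := freemod_supp2 x x.
have us' := undup_uniq (y :: s).
rewrite (fm_liftE _ (ring_hom0 ha) us') => [|z /(xs z).1 zs]; last first.
  by rewrite mem_undup inE zs orbT.
rewrite freemod_sumE (bigD1_seq y) //=; last by rewrite -[if _ then _ else _]/(undup (y :: s)) mem_undup inE eqxx.
rewrite big1 ?addr0 => [|z zy].
  by rewrite -[LHS]/(a (x y) * fm_gen R' y y) fm_genE eqxx mulr1.
by rewrite -[LHS]/(a (x z) * fm_gen R' z y) fm_genE eq_sym (negPf zy) mulr0.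
Qed.

(* The tensor power of a reflexive coequaliser is again one, and a reflexive
   pair of homomorphisms of groups is the kernel pair of its coequaliser. *)
Section TensorCoequaliser.
Variables (R T T1 : comPzRingType) (M : lmodType R) (Q : lmodType T).
Variables (Q1 : lmodType T1) (I : choiceType).
Variables (a0 a1 : T1 -> T) (d0 d1 : Q1 -> Q) (a : T -> R) (e : Q -> M).
Variables (sr : T -> T1) (s : Q -> Q1) (gr : R -> T) (g : M -> Q).
Hypotheses (ha0 : ring_hom a0) (ha1 : ring_hom a1) (ha : ring_hom a).
Hypotheses (hd0 : semilin a0 d0) (hd1 : semilin a1 d1) (he : semilin a e).
Hypotheses (hsr : ring_hom sr) (hs : semilin sr s).
Hypotheses (sr0 : cancel sr a0) (sr1 : cancel sr a1).
Hypotheses (s0 : cancel s d0) (s1 : cancel s d1).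
Hypotheses (grK : cancel gr a) (gK : cancel g e).
Hypothesis ring_pair : forall u u', a u = a u' -> exists z, a0 z = u /\ a1 z = u'.
Hypothesis mod_pair : forall q q', e q = e q' -> exists z, d0 z = q /\ d1 z = q'.
Hypothesis Qg : spans (fun m : I -> M => tens (fun i => g (m i))).

Local Notation D0 := (@tpow_map _ _ _ _ I a0 d0).
Local Notation D1 := (@tpow_map _ _ _ _ I a1 d1).
Local Notation E := (@tpow_map _ _ _ _ I a e).

Let hD0 : semilin a0 D0. Proof. exact: tpow_map_semilin. Qed.
Let hD1 : semilin a1 D1. Proof. exact: tpow_map_semilin. Qed.
Let hE : semilin a E. Proof. exact: tpow_map_semilin. Qed.

Let hS : semilin sr (@tpow_map _ _ _ _ I sr s). Proof. exact: tpow_map_semilin. Qed.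

Let S0 : cancel (@tpow_map _ _ _ _ I sr s) D0.
Proof.
apply: (tpow_ext (semilin_compE hS hD0 sr0) (semilin_id _)) => m.
by rewrite !tpow_map_tens //; congr tens; apply: funext => i /=.
Qed.

Let S1 : cancel (@tpow_map _ _ _ _ I sr s) D1.
Proof.
apply: (tpow_ext (semilin_compE hS hD1 sr1) (semilin_id _)) => m.
by rewrite !tpow_map_tens //; congr tens; apply: funext => i /=.
Qed.

(** The goal is that L contains the kernel of E. The section (sr, s) makes L a submodule. *)
Let L : set (tpow Q I) := [set t | exists z, t = D0 z - D1 z].

Let LD t t' : L t -> L t' -> L (t + t').
Proof.
move=> [z ->] [z' ->]; exists (z + z').
by rewrite hD0.1 hD1.1 opprD addrACA.
Qed.

Let LZ r t : L t -> L (r *: t).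
Proof.
by move=> [z ->]; exists (sr r *: z); rewrite hD0.2 hD1.2 sr0 sr1 scalerBr.
Qed.

Let L0 : L 0.
Proof. by exists 0; rewrite (morph_add0 hD0.1) (morph_add0 hD1.1) subrr. Qed.

(** If z lies over u and 0, then z times the degenerate element on t lies over [u *: t] and 0. *)
Let L_ker u t : a u = 0 -> L (u *: t).
Proof.
rewrite -(ring_hom0 ha) => /ring_pair[z [zu z0]].
exists (z *: tpow_map sr s t).
by rewrite hD0.2 hD1.2 zu z0 scale0r subr0 S0.
Qed.

Let L_tens (q q' : I -> Q) : (forall i, e (q i) = e (q' i)) -> L (tens q - tens q').
Proof.
move=> qq'; have [z zE] := choice (fun i => mod_pair (qq' i)).
exists (tens z); rewrite !tpow_map_tens //.
by congr (tens _ - tens _); apply: funext => i; case: (zE i).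
Qed.

(** F maps onto [tpow Q I] by lam, and by kap to the free module of which [tpow M I] is a quotient;
    relations are compared there. *)
Let F := freemod T (I -> M : choiceType).
Let lam : F -> tpow Q I := fm_lift id (fun m : I -> M => tens (fun i => g (m i))).
Let kap : F -> freemod R (I -> M : choiceType) := fm_lift a (@fm_gen R (I -> M : choiceType)).

Let hlam : semilin id lam. Proof. exact: fm_lift_semilin (ring_hom_id _). Qed.
Let hkap : semilin a kap. Proof. exact: fm_lift_semilin. Qed.

Let lam_ker (x : F) : kap x = 0 -> L (lam x).
Proof.
move=> kx; have [t ut xt] := freemod_supp2 x x.
rewrite (freemod_sum ut (fun i => (xt i).1)) (semilin_sum _ _ _ hlam).
apply: (big_ind L) => // m _; apply: L_ker.
by rewrite -(fm_lift_coef _ _ ha) -/(kap x) kx.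
Qed.

(** The sections gr and g lift the coefficients and tensors of a relation. They are not additive,
    but the factor g (m i) and the combination [gr r *: g (m1 i) + g (m2 i)] have the same image
    under e, so [L_tens] absorbs the error. *)
Let kernel_rel (x : freemod R (I -> M : choiceType)) :
  x \in submod_gen (@tpow_rel R M I) -> exists y, kap y = x /\ L (lam y).
Proof.
move: x; apply: submod_gen_ind => [|r x y [x' [<- Lx]] [y' [<- Ly]]|x].
- by exists 0; rewrite (morph_add0 hkap.1) (morph_add0 hlam.1).
- exists (gr r *: x' + y'); rewrite hkap.1 hkap.2 grK hlam.1 hlam.2; split=> //.
  exact/LD/Ly/LZ.
move=> [i [m [m1 [m2 [r [mE miE ->]]]]]].
exists (fm_gen T m - gr r *: fm_gen T m1 - fm_gen T m2).
have lamg n : lam (fm_gen T n) = tens (fun i => g (n i)).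
  exact: fm_lift_gen (ring_hom_id _) _.
have kapg n : kap (fm_gen T n) = fm_gen R n by apply: fm_lift_gen.
rewrite !(morph_addB hkap.1) hkap.2 !kapg grK; split=> //.
rewrite !(morph_addB hlam.1) hlam.2 !lamg -addrA -opprD.
pose q j := if j == i then gr r *: g (m1 i) + g (m2 i) else g (m j).
rewrite -(tens_multilin (i := i) (m := q)); first apply: L_tens => j.
- rewrite /q; case: eqP => [->|//].
  by rewrite he.1 he.2 grK !gK miE.
- move=> j ji; rewrite /q; case: eqP => // _.
  by have [<- <-] := mE j ji.
- by rewrite /q eqxx.
Qed.

Lemma tpow_pair (t t' : tpow Q I) : E t = E t' ->
  exists z, D0 z = t /\ D1 z = t'.
Proof.
move=> tt'; have [z zE] : L (t - t').
  have [w wE] := Qg (t - t').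
  pose x : F := \sum_(c <- w) c.1 *: fm_gen T c.2.
  have lx : lam x = t - t'.
    rewrite /x (semilin_sum _ _ _ hlam) wE; apply: eq_bigr => c _.
    by rewrite [X in _ *: X](fm_lift_gen _ (ring_hom_id _)).
  have kx : \pi_(submod_quot (@tpow_rel R M I)) (kap x) = 0.
    rewrite /x (semilin_sum _ _ _ hkap) (semilin_sum _ _ _ (sq_pi_semilin _)).
    transitivity (E (t - t')); last by rewrite (morph_addB hE.1) tt' subrr.
    rewrite wE (semilin_sum _ _ _ hE); apply: eq_bigr => c _.
    rewrite [X in \pi_ _ X](fm_lift_gen _ ha) tpow_map_tens //.
    by congr (_ *: tens _); apply: funext => i /=.
  (* kap x is a relation of [tpow M I]; it has a lift y with lam y in L, and the coefficients of x -
     y lie in the kernel of a. *)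
  have [y [ky Ly]] : exists y, kap y = kap x /\ L (lam y).
    apply: kernel_rel; rewrite -[kap x]subr0; apply/sq_pi_eq.
    by rewrite kx (morph_add0 (sq_pi_semilin _).1).
  rewrite -lx -[x](subrK y) hlam.1; apply: LD Ly; apply: lam_ker.
  by rewrite (morph_addB hkap.1) ky subrr.
(* Subtracting the degenerate element on D1 z leaves an element over t - t' and 0; the one on t'
   adds t' on both sides. *)
exists (z - tpow_map sr s (D1 z) + tpow_map sr s t').
by rewrite hD0.1 hD1.1 (morph_addB hD0.1) (morph_addB hD1.1) !S0 !S1 -zE subrK subrr add0r.
Qed.

End TensorCoequaliser.

Lemma FU_tpow_pair (R : comPzRingType) (M : lmodType R) (I : choiceType)
    (t t' : tpow (FU M) I) : finite_set [set: I] ->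
  tpow_map (@eps_ring R) (@eps_mod R M) t = tpow_map (@eps_ring R) (@eps_mod R M) t' ->
  exists z, tpow_map (@eps_ring (Zpoly R)) (@eps_mod (Zpoly R) (FU M)) z = t /\
    tpow_map (FU_ring (@eps_ring R)) (FU_mod (@eps_ring R) (@eps_mod R M)) z = t'.
Proof.
move=> fI; apply: tpow_pair.
- exact: eps_ring_hom.
- exact: FU_ring_hom.
- exact: eps_ring_hom.
- exact: eps_mod_semilin.
- exact: FU_mod_semilin.
- exact: eps_mod_semilin.
- exact: (Zpoly_lift_hom (fun r => Zpoly_var (Zpoly_var r))).
- exact: unit_mod_semilin.
- exact: unit_ring_d0.
- exact: unit_ring_d1.
- exact: unit_mod_d0.
- exact: unit_mod_d1.
- exact: eps_ring_var.
- exact: eps_mod_gen.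
- exact: eps_ring_pair.
- exact: eps_mod_pair.
- exact: (@free_tens_spans (Zpoly R) M I fI).
Qed.

(** * Cosets and truncation sets *)

Section Cosets.
Variable G : profiniteGroupType.
Implicit Types (A H K U V W : set G) (a b g h x : G).
Local Open Scope group_scope.

Lemma ltransP a A x : ltrans a A x <-> A (a^-1 * x).
Proof.
split=> [[y Ay <-]|Ax]; first by rewrite mulKg.
by exists (a^-1 * x) => //; rewrite mulVKg.
Qed.

Lemma rtransP a A x : rtrans A a x <-> A (x * a^-1).
Proof.
split=> [[y Ay <-]|Ax]; first by rewrite mulgK.
by exists (x * a^-1) => //; rewrite mulgVK.
Qed.

Lemma conjsP a A x : conjs a A x <-> A (a^-1 * x * a).
Proof.
split=> [[y Ay <-]|Ax]; first by rewrite !mulgA mulVg mul1g mulgVK.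
by exists (a^-1 * x * a) => //; rewrite !mulgA mulgV mul1g mulgK.
Qed.

Lemma conjs1 A : conjs 1 A = A.
Proof. by apply/seteqP; split=> x; rewrite conjsP invg1 mul1g mulg1. Qed.

Lemma conjsM a b A : conjs (a * b) A = conjs a (conjs b A).
Proof. by apply/seteqP; split=> x; rewrite !conjsP invgM !mulgA. Qed.

Lemma conjsK a A : conjs a^-1 (conjs a A) = A.
Proof. by rewrite -conjsM mulVg conjs1. Qed.

Lemma conjsVK a A : conjs a (conjs a^-1 A) = A.
Proof. by rewrite -conjsM mulgV conjs1. Qed.

Lemma conjs_sub a A B : conjs a A `<=` conjs a B <-> A `<=` B.
Proof.
split=> AB x; last by rewrite !conjsP => /AB.
by move=> Ax; have := AB (a * x * a^-1);
  rewrite !conjsP !mulgA mulVg mul1g mulgVK; apply.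
Qed.

Lemma conjs_subV a A B : conjs a^-1 A `<=` B <-> A `<=` conjs a B.
Proof. by rewrite -(conjs_sub a) conjsVK. Qed.

Lemma ltransM a b A : ltrans (a * b) A = ltrans a (ltrans b A).
Proof. by apply/seteqP; split=> x; rewrite !ltransP invgM mulgA. Qed.

Lemma ltrans1 A : ltrans 1 A = A.
Proof. by apply/seteqP; split=> x; rewrite ltransP invg1 mul1g. Qed.

Lemma ltrans_rtrans a b A : ltrans a (rtrans A b) = rtrans (ltrans a A) b.
Proof. by apply/seteqP; split=> x; rewrite !(ltransP,rtransP) mulgA. Qed.

Lemma rtransM a b A : rtrans A (a * b) = rtrans (rtrans A a) b.
Proof. by apply/seteqP; split=> x; rewrite !rtransP invgM mulgA. Qed.

Lemma rtrans1 A : rtrans A 1 = A.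
Proof. by apply/seteqP; split=> x; rewrite rtransP invg1 mulg1. Qed.

Lemma ltrans_conjs a A : ltrans a A = rtrans (conjs a A) a.
Proof.
apply/seteqP; split=> x; rewrite ltransP rtransP conjsP !mulgA.
  by rewrite mulgVK.
by rewrite mulgVK.
Qed.

Section OpenSubgroup.
Variable V : set G.
Hypothesis oV : open_subgroup V.

Lemma osub1 : V 1. Proof. by case: oV. Qed.
Lemma osubM x y : V x -> V y -> V (x * y). Proof. by case: oV => _ _ + _; apply. Qed.
Lemma osubV x : V x -> V x^-1. Proof. by case: oV => _ _ _; apply. Qed.
Lemma osubVE x : V x^-1 <-> V x.
Proof. by split=> /osubV; rewrite ?invgK. Qed.
Lemma osubMl x y : V x -> V (x * y) <-> V y.
Proof. by move=> Vx; split=> [/(osubM (osubV Vx))|/(osubM Vx)]; rewrite ?mulKg. Qed.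
Lemma osubMr x y : V y -> V (x * y) <-> V x.
Proof.
move=> Vy; split=> [Vxy|Vx]; last exact: osubM.
by rewrite -(mulgK y x); apply/osubM/osubV.
Qed.

Lemma ltrans_self a : ltrans a V a.
Proof. by apply/ltransP; rewrite mulVg; apply: osub1. Qed.

Lemma ltrans_mem a v : V v -> ltrans (a * v) V = ltrans a V.
Proof.
move=> Vv; apply/seteqP; split=> x; rewrite !ltransP invgM -mulgA.
  by move/osubMl; apply; apply: osubV.
by move=> Vx; apply/osubM => //; apply: osubV.
Qed.

Lemma ltrans_eq a x : ltrans a V x -> ltrans x V = ltrans a V.
Proof. by move=> /ltransP Vx; rewrite -(mulVKg a x) ltrans_mem. Qed.

Lemma cosets_eq K C x : cosets K V C -> C x -> C = ltrans x V.
Proof. by move=> [a Ka <-] /ltrans_eq. Qed.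

Lemma cosets_xget K C : cosets K V C -> C (xget 1 C).
Proof. by move=> [a Ka <-]; apply: (xgetI 1); apply: ltrans_self. Qed.

Lemma cosets_div K C x y : cosets K V C -> C x -> C y -> V (x^-1 * y).
Proof. by move=> KC Cx; rewrite (cosets_eq KC Cx) => /ltransP. Qed.

Lemma osub_conjs g : open_subgroup (conjs g V).
Proof.
split=> [||x y|x].
- have -> : conjs g V = (fun x => g^-1 * x * g) @^-1` V.
    by apply/seteqP; split=> x /conjsP.
  apply: open_comp; last by case: oV.
  move=> x _; apply: (@continuous_comp _ _ _ (fun x => (g^-1 * x, g)) (fun z => z.1 * z.2)).
    apply: (@cvg_pair _ _ _ _ (nbhs (g^-1 * x)) (nbhs g)); last exact: cvg_cst.
    apply: (@continuous_comp _ _ _ (fun x => (g^-1, x)) (fun z => z.1 * z.2)).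
      by apply: (@cvg_pair _ _ _ _ (nbhs g^-1) (nbhs x)); [exact: cvg_cst|exact: cvg_id].
    exact: mulg_continuous.
  exact: mulg_continuous.
- by apply/conjsP; rewrite mulg1 mulVg; apply: osub1.
- move=> /conjsP Vx /conjsP Vy; apply/conjsP.
  by have := osubM Vx Vy; rewrite !mulgA mulgK.
- move=> /conjsP Vx; apply/conjsP; have := osubV Vx.
  by rewrite !invgM invgK mulgA.
Qed.

Lemma open_ltrans a : open (ltrans a V).
Proof.
have -> : ltrans a V = (fun x => a^-1 * x) @^-1` V.
  by apply/seteqP; split=> x /ltransP.
apply: open_comp; last by case: oV.
move=> x _; apply: (@continuous_comp _ _ _ (fun x => (a^-1, x)) (fun z => z.1 * z.2)).
  by apply: (@cvg_pair _ _ _ _ (nbhs a^-1) (nbhs x)); [exact: cvg_cst|exact: cvg_id].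
exact: mulg_continuous.
Qed.

(** Compactness in its near-covering form, for the filter of all large finite sets of cosets: on the
    neighbourhood xV of x the coset is constant, so it suffices that the finite set contains it. *)
Lemma finite_cosetsT : finite_set (cosets setT V).
Proof.
pose F : set_system {fset (set G)} :=
  [set Z | exists D0 : {fset (set G)}, forall D, (D0 `<=` D)%fset -> Z D].
have FF : Filter F.
  split=> [|Z Z' [D0 ZD0] [D1 ZD1]|Z Z' ZZ' [D0 ZD0]].
  - by exists fset0.
  - exists (D0 `|` D1)%fset => D D01; split; [apply: ZD0|apply: ZD1].
      exact: fsubset_trans (fsubsetUl _ _) D01.
    exact: fsubset_trans (fsubsetUr _ _) D01.
  - by exists D0 => D /ZD0/ZZ'.
have /compact_near_coveringP/(_ _ F (fun D x => ltrans x V \in D) FF) := @profinite_compact G.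
case=> [x _|D0 D0P]; last first.
  apply: (sub_finite_set _ (finite_fset D0)) => _ [x _ <-] /=.
  exact: D0P (fsubset_refl _) x I.
exists (ltrans x V, [set D | ltrans x V \in D]) => /=.
  split; last by exists [fset ltrans x V]%fset => D; rewrite fsub1set.
  by apply: open_nbhs_nbhs; split; [exact: open_ltrans|exact: ltrans_self].
by move=> [y D] /= [/ltrans_eq -> ].
Qed.

Lemma finite_cosets K : finite_set (cosets K V).
Proof.
by apply: sub_finite_set finite_cosetsT => _ [a _ <-]; exists a.
Qed.

Lemma finite_cosetsE K : finite_set [set: cosets K V].
Proof. by rewrite (eq_finite_set (card_setT _)); apply: finite_cosets. Qed.

Lemma osub_above W : W 1 -> (forall x y, W x -> W y -> W (x * y)) ->
  (forall x, W x -> W x^-1) -> V `<=` W -> open_subgroup W.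
Proof.
move=> W1 WM WV VW; split=> //.
have -> : W = \bigcup_(a in W) ltrans a V.
  apply/seteqP; split=> [x Wx|x [a Wa /ltransP /VW Wx]].
    by exists x => //; apply: ltrans_self.
  by have := WM _ _ Wa Wx; rewrite mulVKg.
by apply: bigcup_open => a _; apply: open_ltrans.
Qed.

(** An overgroup of V is the union of the cosets of V that it contains, and V has finitely many
    cosets. *)
Lemma finite_above : finite_set [set W | open_subgroup W /\ V `<=` W].
Proof.
pose F : {fset (set G)} := fset_set (cosets setT V).
apply: (sub_finite_set _ (finite_image
  (fun X : {fset (set G)} => \bigcup_(A in [set` X]) A) (finite_fset (fpowerset F)))).
move=> W [oW VW]; 
pose X : {fset (set G)} := fset_set (cosets setT V `&` [set A | A `<=` W]).
have XE A : (A \in X) = (A \in cosets setT V `&` [set A | A `<=` W]).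
  by rewrite in_fset_set //; apply: finite_setIl; apply: finite_cosetsT.
exists X.
  rewrite /= fpowersetE; apply/fsubsetP => A; rewrite XE inE => -[VA _].
  by rewrite in_fset_set ?inE //; apply: finite_cosetsT.
apply/seteqP; split=> [x [A /=]|x Wx]; first by rewrite XE inE => -[_]; apply.
exists (ltrans x V); last exact: ltrans_self.
rewrite /= XE inE; split; first by exists x.
by move=> y /ltransP /VW; case: oW => _ _ WM _ /(WM _ _ Wx); rewrite mulVKg.
Qed.

End OpenSubgroup.

Lemma cosets_mem K U C a : open_subgroup K -> U `<=` K -> cosets K U C -> C a -> K a.
Proof.
move=> oK UK [b Kb <-] /ltransP /UK Kba.
by have := osubM oK Kb Kba; rewrite mulVKg.
Qed.

End Cosets.

Lemma tpow_reindexE (R : comPzRingType) (M : lmodType R) (I J : Type)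
    (theta : J -> option I) (b : J -> I) (u : I -> J) :
  (forall j, theta j = Some (b j)) -> cancel b u -> cancel u b ->
  semilin id (@tpow_reindex R M I J theta) /\
  forall m, tpow_reindex theta (tens m : tpow M I) = tens (fun j => m (b j)).
Proof.
move=> tb bK uK; rewrite /tpow_reindex.
have -> : (fun m : I -> M => tens (fun j => oapp m 0 (theta j))) =
    (fun m => tens (fun j => m (b j))).
  by apply: funext => m; congr tens; apply: funext => j; rewrite tb.
have h := tens_bij_multilin (M := M) bK uK.
split; first exact: tpow_lift_semilin (ring_hom_id _) h.
by move=> m; rewrite (tpow_lift_tens (ring_hom_id _) h).
Qed.

(** C may be infinite, as S0 is: only the fibres over the finite image of B contribute. *)
Lemma fsum_fibers (V : zmodType) (Z Y : choiceType) (B : set Z) (C : set Y)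
    (g : Z -> Y) (F : Z -> V) : finite_set B -> (forall z, B z -> C (g z)) ->
  \sum_(y \in C) \sum_(z \in B `&` g @^-1` [set y]) F z = \sum_(z \in B) F z.
Proof.
move=> fB BC.
have fgB : finite_set (g @` B) by apply: finite_image.
rewrite -(@fsbig_widen _ _ _ _ (g @` B)); first last.
- move=> y [_ /= gy]; apply: fsbig1 => z [Bz gz]; exfalso; apply: gy; exists z => //.
- by move=> _ [z Bz <-]; apply: BC.
under eq_fsbigr do rewrite fsbig_mkcondr.
rewrite exchange_fsbig //; apply: eq_fsbigr => z /set_mem Bz.
rewrite -(@fsbig_widen _ _ _ _ [set g z]); first last.
- move=> y [_ /= gy]; case: ifPn => //; rewrite inE => zy.
  by case: gy; rewrite zy.
- by move=> _ ->; exists z.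
by rewrite fsbig_set1 ifT // inE.
Qed.

Section Action.
Variables (G : profiniteGroupType) (K : set G).
Variables (R : comPzRingType) (M : lmodType R).
Hypothesis oK : open_subgroup K.
Local Open Scope group_scope.

Let mkcoset (U A : set G) (KA : cosets K U A) : cosets K U := SigSub (mem_set KA).

Lemma cosets_rtrans (U C : set G) h : K h -> cosets K (conjs h U) C ->
  cosets K U (rtrans C h).
Proof.
move=> Kh [a Ka <-]; exists (a * h); first exact: (osubM oK).
by rewrite ltransM (ltrans_conjs h) ltrans_rtrans.
Qed.

Lemma cosets_rtransV (U C : set G) h : K h -> cosets K U C ->
  cosets K (conjs h U) (rtrans C h^-1).
Proof.
move=> Kh UC; apply: cosets_rtrans; first exact: (osubV oK).
by rewrite -conjsM mulVg conjs1.
Qed.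

(** f is a function on all subsets of G, so that the formula needs no cast between the two types of
    cosets. *)
Lemma tactE (h : G) (U : set G) : K h ->
  semilin id (@tact G K R M h U (conjs h U)) /\
  forall f : set G -> M,
    @tact G K R M h U (conjs h U) (tens (fun C : cosets K U => f (val C))) =
    tens (fun C : cosets K (conjs h U) => f (rtrans (val C) h)).
Proof.
move=> Kh.
pose b (C : cosets K (conjs h U)) : cosets K U :=
  mkcoset (cosets_rtrans Kh (set_mem (valP C))).
pose u (C : cosets K U) : cosets K (conjs h U) :=
  mkcoset (cosets_rtransV Kh (set_mem (valP C))).
have tb C : insub (rtrans (val C) h) = Some (b C).
  by rewrite insubT ?(valP (b C)) // => p; congr Some; apply: val_inj.
have bK : cancel b u by move=> C; apply: val_inj; rewrite /= -rtransM mulgV rtrans1.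
have uK : cancel u b by move=> C; apply: val_inj; rewrite /= -rtransM mulVg rtrans1.
have [hl ht] := tpow_reindexE M tb bK uK.
by split=> // f; rewrite /tact ht.
Qed.

Definition coset_mul (C V : set G) : set G := [set a * v | a in C & v in V].

Lemma coset_mulE (U V C : set G) a : open_subgroup U -> open_subgroup V ->
  U `<=` V -> cosets K U C -> C a -> coset_mul C V = ltrans a V.
Proof.
move=> oU oV UV KC Ca; rewrite (cosets_eq oU KC Ca).
apply/seteqP; split=> [_ [x /ltransP Ux] [v Vv <-]|x /ltransP Vx].
  by apply/ltransP; rewrite mulgA; apply: (osubM oV) => //; apply: UV.
by exists a; [exact: ltrans_self|exists (a^-1 * x); rewrite // mulVKg].
Qed.

Section Concat.
Variables (U V : set G) (rep : set G -> set G -> G).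
Hypotheses (oU : open_subgroup U) (oV : open_subgroup V).
Hypotheses (UV : U `<=` V) (VK : V `<=` K) (hrep : coset_reps K V (rep V)).

Let CV (C : set G) : cosets K U C -> cosets K V (coset_mul C V).
Proof.
move=> KC; have [a Ka aC] := KC; have Ca : C a by rewrite -aC; apply: ltrans_self.
by exists a => //; rewrite (coset_mulE oU oV UV KC Ca).
Qed.

Let Crep (C : set G) : cosets K U C ->
  cosets V U (ltrans (rep V (coset_mul C V))^-1 C).
Proof.
move=> KC; have [a Ka aC] := KC; have Ca : C a by rewrite -aC; apply: ltrans_self.
exists ((rep V (coset_mul C V))^-1 * a); last by rewrite ltransM aC.
have r := hrep (CV KC); apply: (cosets_div oV (CV KC) r).
by exists a => //; exists 1; [exact: osub1|rewrite mulg1].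
Qed.

Let repK (B : set G) : cosets K V B -> K (rep V B).
Proof.
move=> VB; have [a Ka aB] := VB; have := hrep VB; rewrite -{1}aB => /ltransP/VK.
by move/(osubM oK Ka); rewrite mulVKg.
Qed.

Let inv_coset (B C : set G) : cosets K V B -> cosets V U C ->
  cosets K U (ltrans (rep V B) C).
Proof.
move=> VB [v Vv <-]; exists (rep V B * v); last by rewrite ltransM.
by apply: (osubM oK); [exact: repK|exact: VK].
Qed.

Definition coset_fst (C : cosets K U) : cosets K V :=
  SigSub (mem_set (CV (set_mem (valP C)))).

Definition coset_snd (C : cosets K U) : cosets V U :=
  SigSub (mem_set (Crep (set_mem (valP C)))).

Definition coset_join (B : cosets K V) (C : cosets V U) : cosets K U :=
  SigSub (mem_set (inv_coset (set_mem (valP B)) (set_mem (valP C)))).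

Lemma coset_join_split C : coset_join (coset_fst C) (coset_snd C) = C.
Proof. by apply: val_inj; rewrite /= -ltransM mulgV ltrans1. Qed.

Lemma coset_fst_join B C : coset_fst (coset_join B C) = B.
Proof.
have KC := set_mem (valP (coset_join B C)); have VB := set_mem (valP B).
have UC := set_mem (valP C); have [v Vv vC] := UC; apply: val_inj.
have Cv : val (coset_join B C) (rep V (val B) * v).
  by rewrite /= -vC; apply/ltransP; rewrite mulKg; apply: ltrans_self.
rewrite [LHS](coset_mulE oU oV UV KC Cv) (ltrans_mem oV) //.
by rewrite -(cosets_eq oV VB (hrep VB)).
Qed.

Lemma coset_snd_join B C : coset_snd (coset_join B C) = C.
Proof.
apply: val_inj; have := congr1 val (coset_fst_join B C).
by rewrite /= => ->; rewrite -ltransM mulVg ltrans1.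
Qed.

Lemma tconcatE :
  semilin id (@tconcat G K rep R M U V) /\
  forall f : set G -> set G -> M,
    tconcat rep (tens (fun p : cosets K V * cosets V U => f (val p.1) (val p.2))) =
    tens (fun C : cosets K U => f (coset_mul (val C) V)
             (ltrans (rep V (coset_mul (val C) V))^-1 (val C))).
Proof.
pose b C := (coset_fst C, coset_snd C).
pose u (p : cosets K V * cosets V U) := coset_join p.1 p.2.
have tb C : @coset_split G K rep U V C = Some (b C).
  rewrite /coset_split /= (insubT (fun x => x \in cosets K V) (valP (coset_fst C))).
  rewrite (insubT (fun x => x \in cosets V U) (valP (coset_snd C))).
  by congr Some; rewrite /b; congr pair; apply: val_inj.
have bK : cancel b u by move=> C; apply: coset_join_split.
have uK : cancel u b.
  by move=> [B C]; rewrite /b /u coset_fst_join coset_snd_join.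
have [hl ht] := tpow_reindexE M tb bK uK.
by split=> // f; rewrite /tconcat ht.
Qed.

End Concat.

End Action.

(** * Truncation sets and the rank of a subgroup *)

Section Truncation.
Variables (G : profiniteGroupType) (H : set G) (S : set (set G)).
Hypotheses (oH : open_subgroup H) (hS : truncation_set H S).
Local Open Scope group_scope.

Lemma trunc_open U : S U -> open_subgroup U.
Proof. by case: hS => h _ _ /h[]. Qed.

Lemma trunc_sub U : S U -> U `<=` H.
Proof. by case: hS => h _ _ /h[]. Qed.

Lemma trunc_conjs U h : S U -> H h -> S (conjs h U).
Proof. by case: hS => _ h' _; apply: h'. Qed.

Lemma trunc_up U V : S U -> open_subgroup V -> U `<=` V -> V `<=` H -> S V.
Proof. by case: hS => _ _; apply. Qed.

(* A conjugation-invariant stand-in for the index of V in H. *)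
Definition rank (V : set G) : nat := #|` fset_set [set W | S W /\ V `<=` W]|.

Lemma finite_rank V : S V -> finite_set [set W | S W /\ V `<=` W].
Proof.
move=> SV; apply: sub_finite_set (finite_above (trunc_open SV)) => W [SW VW].
by split=> //; apply: trunc_open.
Qed.

Lemma rank_le V W : S V -> V `<=` W -> (rank W <= rank V)%N.
Proof.
move=> SV VW; have fV := finite_rank SV.
have sWV : [set X | S X /\ W `<=` X] `<=` [set X | S X /\ V `<=` X].
  by move=> X [SX WX]; split=> //; apply: subset_trans WX.
apply: fsubset_leq_card; apply/fsubsetP => X.
rewrite !in_fset_set //; first by rewrite !inE; apply: sWV.
exact: sub_finite_set fV.
Qed.

Lemma rank_lt V W : S V -> S W -> V `<=` W -> V <> W -> (rank W < rank V)%N.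
Proof.
move=> SV SW VW VneW; have fV := finite_rank SV; have fW := finite_rank SW.
apply: fproper_ltn_card; rewrite fproperE; apply/andP; split.
  apply/fsubsetP => X; rewrite !in_fset_set // !inE => -[SX WX]; split=> //.
  exact: subset_trans WX.
apply/fsubsetPn; exists V; rewrite in_fset_set //; first by apply/mem_set; split.
by apply/negP => /set_mem[_ WV]; apply: VneW; apply/seteqP.
Qed.

Lemma rank_conjs V h : S V -> H h -> rank (conjs h V) = rank V.
Proof.
suff le g W : S W -> H g -> (rank W <= rank (conjs g W))%N.
  move=> SV Hh; apply/eqP; rewrite eqn_leq (le h) // andbT.
  rewrite -{2}(conjsK h V); apply: le; first exact: trunc_conjs.
  exact: (osubV oH).
move=> SW Hg; have fW := finite_rank SW.
have SgW := trunc_conjs SW Hg; have fgW := finite_rank SgW.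
have im : [set X | S X /\ conjs g W `<=` X] = conjs g @` [set X | S X /\ W `<=` X].
  apply/seteqP; split=> [X [SX WX]|_ [X [SX WX] <-]].
    exists (conjs g^-1 X); last exact: conjsVK.
    split; first by apply: trunc_conjs => //; apply: (osubV oH).
    by rewrite -(conjs_sub g) conjsVK.
  by split; [exact: trunc_conjs|rewrite conjs_sub].
rewrite [X in (_ <= X)%N]/rank.
have -> : fset_set [set X | S X /\ conjs g W `<=` X] =
    imfset imfset_key (conjs g) (mem (fset_set [set X | S X /\ W `<=` X])).
  apply/fsetP => X; rewrite in_fset_set // im; apply/idP/imfsetP => /=.
    by rewrite inE => -[Y YW <-]; exists Y => //; rewrite in_fset_set // inE.
  by move=> [Y]; rewrite in_fset_set // inE => YW ->; rewrite inE; exists Y.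
by rewrite card_imfset //=; apply: (can_inj (conjsK g)).
Qed.

End Truncation.

(** * Families of pure tensors *)

Section PureTensors.
Variables (G : profiniteGroupType) (K : set G).
Local Open Scope group_scope.

(** mu is read off at an arbitrary element of each coset. For x fixed by U, equivariance makes mu x
    invariant under right translation by U on K, so the element does not matter. *)
Definition pure (R : comPzRingType) (M : lmodType R) (U : set G) (mu : G -> M) :
    tpow M (cosets K U) :=
  tens (fun C : cosets K U => mu (xget 1 (val C))).

Definition fixpts (X : Type) (act : G -> X -> X) (U : set G) : set X :=
  [set x | forall u, U u -> act u x = x].

Definition stab (H : set G) (X : Type) (act : G -> X -> X) (x : X) : set G :=
  [set h | H h /\ act h x = x].

(* H acts on D, and on functions on K by right translation; mu is equivariant.
   The values of mu outside of D and K play no role. *)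
Definition is_family (H : set G) (S : set (set G)) (M : Type) (X : choiceType)
    (act : G -> X -> X) (D : set X) (mu : X -> G -> M) :=
  [/\ forall x, act 1 x = x,
      forall g h x, act (g * h) x = act g (act h x),
      forall h x, H h -> D x -> D (act h x),
      forall h x a, H h -> D x -> K a -> mu (act h x) a = mu x (a * h) &
      forall U, S U -> finite_set (D `&` fixpts act U)].

Lemma tens_pure (R : comPzRingType) (M : lmodType R) (U : set G)
    (f : cosets K U -> M) (mu : G -> M) :
  open_subgroup U -> (forall C a, val C a -> f C = mu a) -> tens f = pure U mu.
Proof.
move=> oU fmu; congr tens; apply: funext => C; apply: fmu.
exact: (cosets_xget oU (set_mem (valP C))).
Qed.

Lemma tpow_map_pure (R R' : comPzRingType) (M : lmodType R) (M' : lmodType R')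
    (a : R -> R') (f : M -> M') U (mu : G -> M) : ring_hom a -> semilin a f ->
  tpow_map a f (pure U mu) = pure U (f \o mu).
Proof. by move=> ha hf; rewrite /pure tpow_map_tens. Qed.

End PureTensors.

Section Families.
Variables (G : profiniteGroupType) (K H : set G) (S : set (set G)).
Hypotheses (oK : open_subgroup K) (oH : open_subgroup H) (HK : H `<=` K).
Hypothesis hS : truncation_set H S.
Local Open Scope group_scope.

Local Notation pure := (@pure G K).
Local Notation rank := (rank S).

Section FixedPoints.
Variables (M : Type) (X : choiceType) (act : G -> X -> X) (D : set X).
Variable mu : X -> G -> M.
Hypothesis fam : is_family K H S act D mu.

Lemma fixpts_stab x U : S U -> (D `&` fixpts act U) x -> S (stab H act x) /\ U `<=` stab H act x.
Proof.
move=> SU [Dx Ux]; have [a1 aM aD amu fD] := fam.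
have Us : U `<=` stab H act x.
  by move=> u Uu; split; [exact: (trunc_sub hS SU)|exact: Ux].
split=> //; apply: (trunc_up hS SU) => // [|h []//].
apply: (osub_above (trunc_open hS SU)) => // [|g h [Hg gx] [Hh hx]|g [Hg gx]].
- by split; [exact: osub1|exact: a1].
- by split; [exact: osubM|rewrite aM hx].
- by split; [exact: osubV|rewrite -{1}gx -aM mulVg].
Qed.

Lemma family_mul x U a u : S U -> (D `&` fixpts act U) x -> K a -> U u ->
  mu x (a * u) = mu x a.
Proof.
move=> SU [Dx Ux] Ka Uu; have [a1 aM aD amu fD] := fam.
by rewrite -amu ?Ux //; apply: (trunc_sub hS SU).
Qed.

Lemma family_coset x U C a : S U -> (D `&` fixpts act U) x -> cosets K U C ->
  C a -> mu x (xget 1 C) = mu x a.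
Proof.
move=> SU Ux KC Ca; have oU := trunc_open hS SU.
have Cx := cosets_xget oU KC.
rewrite -(mulVKg a (xget 1 C)); apply: (family_mul SU) => //.
  by apply: (cosets_mem oK _ KC Ca) => v /(trunc_sub hS SU)/HK.
exact (cosets_div oU KC Ca Cx).
Qed.

Lemma fixpts_conjs x U h : D x -> H h ->
  (D `&` fixpts act (conjs h U)) (act h x) <-> (D `&` fixpts act U) x.
Proof.
have [a1 aM aD amu fD] := fam => Dx Hh; split=> -[_ Ux]; (split=> [|u]; first by [|exact: aD]).
- move=> Uu; have /(congr1 (act h^-1)) := Ux (h * u * h^-1) (ex_intro2 _ _ u Uu erefl).
  by rewrite -!aM !mulgA mulVg mul1g mulgVK a1.
- by move=> [v Uv <-]; rewrite -!aM mulgVK aM Ux.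
Qed.

Lemma stab_conjs x h : H h -> stab H act (act h x) = conjs h (stab H act x).
Proof.
have [a1 aM aD amu fD] := fam => Hh; apply/seteqP; split=> g; rewrite conjsP.
  move=> [Hg gx]; split; first by apply: osubM => //; apply: osubM => //; apply: osubV.
  by rewrite !aM gx -aM mulVg a1.
move=> [Hg gx]; split.
  have := osubM oH (osubM oH Hh Hg) (osubV oH Hh).
  by rewrite !mulgA mulgV mul1g mulgK.
by have := congr1 (act h) gx; rewrite -!aM !mulgA mulgV mul1g.
Qed.

End FixedPoints.

Section Values.
Variables (R : comPzRingType) (M : lmodType R).
Local Notation ghost := (ghost_group K S M).

Definition fam_val (X : choiceType) (act : G -> X -> X) (D : set X)
    (mu : X -> G -> M) : ghost :=
  fun U => (\sum_(x \in D `&` fixpts act (val U)) pure (val U) (mu x))%R.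

(** k filters the values of families. A point whose stabiliser is not in S is fixed by no U in S, so
    the bound concerns only stabilisers in S. *)
Definition fam (k : nat) (x : ghost) :=
  exists (X : choiceType) (act : G -> X -> X) (D : set X) (mu : X -> G -> M),
  [/\ is_family K H S act D mu,
      forall y, D y -> S (stab H act y) -> (k <= rank (stab H act y))%N &
      x = fam_val act D mu].

Lemma tact_pure (X : choiceType) (act : G -> X -> X) (D : set X)
    (mu : X -> G -> M) h U x : is_family K H S act D mu -> S U -> H h ->
  (D `&` fixpts act U) x ->
  tact h (conjs h U) (pure U (mu x)) = pure (conjs h U) (mu (act h x)).
Proof.
move=> fD SU Hh DUx; have [a1 aM aD amu _] := fD; have [Dx Ux] := DUx.
have SU' := trunc_conjs hS SU Hh.
have [_ tE] := tactE M oK U (HK Hh).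
rewrite /pure (tE (fun C => mu x (xget 1 C))); apply: tens_pure => [|C a Ca].
  exact (trunc_open hS SU').
have KC := set_mem (valP C).
have Ka : K a.
  by apply: (cosets_mem oK _ KC Ca) => v /(trunc_sub hS SU')/HK.
rewrite amu //; apply: (family_coset fD SU DUx).
  exact (cosets_rtrans oK (HK Hh) KC).
by apply/rtransP; rewrite mulgK.
Qed.

(** h maps the fixed points of U bijectively to those of its conjugate and, by equivariance, takes
    the tensor of x to that of hx. *)
Lemma fam_fixed k x : fam k x -> ghost_fixed H x.
Proof.
move=> [X [act [D [mu [fD _ ->]]]]] U U' h Hh UU'.
have SU := set_mem (valP U); have [tl _] := tactE M oK (val U) (HK Hh).
have [a1 aM aD amu ffin] := fD; rewrite /fam_val UU'.
rewrite [X in tact _ _ X]fsbig_finite; last exact: ffin.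
rewrite (morph_add_sum tl.1) -fsbig_finite; last exact: ffin.
have bij : set_bij (D `&` fixpts act (val U))
    (D `&` fixpts act (conjs h (val U))) (act h).
  split=> [y DUx|y z _ _ /(congr1 (act h^-1))|y DUx].
  - by apply/(fixpts_conjs fD) => //; case: DUx.
  - by rewrite -!aM mulVg !a1.
  have Dx : D (act h^-1 y) by apply: aD; [exact: osubV|case: DUx].
  exists (act h^-1 y); last by rewrite -aM mulgV a1.
  by apply/(fixpts_conjs fD _ Dx Hh); rewrite -aM mulgV a1.
rewrite (reindex_fsbig _ _ _ _ bij); apply: eq_fsbigr => y /set_mem DUx.
exact: (tact_pure fD SU Hh DUx).
Qed.

(** The stabiliser of a point fixed by U contains U, so its rank is at most that of U. *)
Lemma fam_vanish k x (U : S) : fam k x -> (rank (val U) < k)%N -> x U = 0%R.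
Proof.
move=> [X [act [D [mu [fD rD ->]]]]] Uk; apply: fsbig1 => y DUy; exfalso.
have SU := set_mem (valP U); have [Sy Uy] := fixpts_stab fD SU DUy.
have Dy : D y by case: DUy.
have := leq_trans (rD y Dy Sy) (rank_le hS SU Uy).
by rewrite leqNgt Uk.
Qed.

Lemma fam0 k : fam k 0%R.
Proof.
exists nat, (fun _ => id), set0, (fun _ _ => 0%R); split=> //.
  by split=> // U _; rewrite set0I.
by apply: functional_extensionality_dep => U; rewrite /fam_val set0I fsbig_set0.
Qed.

Lemma famD k x y : fam k x -> fam k y -> fam k (x + y)%R.
Proof.
move=> [X [act [D [mu [fD rD ->]]]]] [X' [act' [D' [mu' [fD' rD' ->]]]]].
pose act2 g (z : X + X') : X + X' :=
  match z with inl x => inl (act g x) | inr x => inr (act' g x) end.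
pose D2 : set (X + X')%type := inl @` D `|` inr @` D'.
pose mu2 (z : X + X') := match z with inl x => mu x | inr x => mu' x end.
have [a1 aM aD amu af] := fD; have [a1' aM' aD' amu' af'] := fD'.
have D2U U : D2 `&` fixpts act2 U =
    inl @` (D `&` fixpts act U) `|` inr @` (D' `&` fixpts act' U).
  apply/seteqP; split=> [z [[[w Dw <-]|[w Dw <-]] Uz]|z [[w [Dw Uw] <-]|[w [Dw Uw] <-]]].
  - by left; exists w => //; split=> // u /Uz [].
  - by right; exists w => //; split=> // u /Uz [].
  - by split; [left; exists w|move=> u Uu /=; rewrite Uw].
  - by split; [right; exists w|move=> u Uu /=; rewrite Uw].
exists (X + X')%type, act2, D2, mu2; split.
- split=> [[z|z]|g h [z|z]|h z Hh [[w Dw <-]|[w Dw <-]]||U SU] /=.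
  + by rewrite a1.
  + by rewrite a1'.
  + by rewrite aM.
  + by rewrite aM'.
  + by left; exists (act h w) => //; apply: aD.
  + by right; exists (act' h w) => //; apply: aD'.
  + by move=> h z a Hh [[w Dw <-]|[w Dw <-]] Ka /=; [apply: amu|apply: amu'].
  + by rewrite D2U finite_setU; split; apply: finite_image; [apply: af|apply: af'].
- have s1 w : stab H act2 (inl w) = stab H act w.
    by apply/seteqP; split=> h [Hh hw]; split=> //=; [case: hw|rewrite hw].
  have s2 w : stab H act2 (inr w) = stab H act' w.
    by apply/seteqP; split=> h [Hh hw]; split=> //=; [case: hw|rewrite hw].
  by move=> z [[w Dw <-]|[w Dw <-]]; rewrite ?s1 ?s2; [apply: rD|apply: rD'].
- apply: functional_extensionality_dep => U; have SU := set_mem (valP U).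
  rewrite /fam_val D2U fsbigU0; first last.
  + by move=> z [[w _ <-] [w' _]].
  + exact/finite_image/af'.
  + exact/finite_image/af.
  by rewrite !fsbig_image // => ? ? _ _ [].
Qed.

(** Disjoint unions make [fam] a monoid; negatives have to be added formally. *)
Definition fam_diff k (x : ghost) :=
  exists y z, [/\ fam k y, fam k z & x = (y - z)%R].

Lemma fam_diff_fam k x : fam k x -> fam_diff k x.
Proof. by move=> kx; exists x, 0%R; split; rewrite ?subr0 //; apply: fam0. Qed.

Lemma fam_diff_sub k x y : fam_diff k x -> fam_diff k y -> fam_diff k (x - y)%R.
Proof.
move=> [x1 [x2 [kx1 kx2 ->]]] [y1 [y2 [ky1 ky2 ->]]].
exists (x1 + y2)%R, (x2 + y1)%R; split; [exact: famD|exact: famD|].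
by rewrite opprB addrACA opprD.
Qed.

Lemma fam_diff0 k : fam_diff k 0%R.
Proof. exact/fam_diff_fam/fam0. Qed.

Lemma fam_diff_vanish k x (U : S) : fam_diff k x -> (rank (val U) < k)%N -> x U = 0%R.
Proof.
move=> [y [z [ky kz ->]]] Uk.
by rewrite -[LHS]/(y U - z U)%R (fam_vanish ky Uk) (fam_vanish kz Uk) subrr.
Qed.

End Values.

Lemma fam_val_map (R R' : comPzRingType) (M : lmodType R) (M' : lmodType R')
    (a : R -> R') (f : M -> M') (X : choiceType) (act : G -> X -> X) (D : set X)
    (mu : X -> G -> M) : ring_hom a -> semilin a f -> is_family K H S act D mu ->
  ghost_group_map a f (fam_val act D mu) = fam_val act D (fun x => f \o mu x).
Proof.
move=> ha hf fD; have [a1 aM aD amu af] := fD.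
apply: functional_extensionality_dep => U; have SU := set_mem (valP U).
have tl := tpow_map_semilin (cosets K (val U)) ha hf.
rewrite /ghost_group_map /fam_val !fsbig_finite ?(morph_add_sum tl.1);
  [|exact: af|exact: af].
by apply: eq_bigr => y _; rewrite tpow_map_pure.
Qed.

(** f is an arbitrary function. This is what allows lifts along the counit to be chosen
    elementwise. *)
Lemma family_comp (M M' : Type) (f : M -> M') (X : choiceType) (act : G -> X -> X)
    (D : set X) (mu : X -> G -> M) : is_family K H S act D mu ->
  is_family K H S act D (fun x => f \o mu x).
Proof. by move=> [a1 aM aD amu af]; split=> // h y b Hh Dy Kb; rewrite /= amu. Qed.

Lemma fam_map (R R' : comPzRingType) (M : lmodType R) (M' : lmodType R')
    (a : R -> R') (f : M -> M') k x : ring_hom a -> semilin a f ->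
  fam k x -> fam k (ghost_group_map a f x : ghost_group K S M').
Proof.
move=> ha hf [X [act [D [mu [fD rD ->]]]]].
rewrite (fam_val_map ha hf fD); exists X, act, D, (fun x => f \o mu x); split=> //.
exact: family_comp.
Qed.

Lemma fam_diff_map (R R' : comPzRingType) (M : lmodType R) (M' : lmodType R')
    (a : R -> R') (f : M -> M') k x : ring_hom a -> semilin a f ->
  fam_diff k x -> fam_diff k (ghost_group_map a f x : ghost_group K S M').
Proof.
move=> ha hf [y [z [fy fz ->]]].
exists (ghost_group_map a f y), (ghost_group_map a f z); split; try exact: fam_map.
apply: functional_extensionality_dep => U.
have [tD _] := tpow_map_semilin (cosets K (val U)) ha hf.
by rewrite /ghost_group_map -[LHS]/(tpow_map a f (y U - z U)%R) (morph_addB tD).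
Qed.

Lemma pure_ext (R : comPzRingType) (M : lmodType R) U (mu mu' : G -> M) : S U ->
  (forall a, K a -> mu a = mu' a) -> pure U mu = pure U mu'.
Proof.
move=> SU mm; congr tens; apply: funext => C; apply: mm.
have KC := set_mem (valP C); apply: (cosets_mem oK _ KC).
  by move=> v /(trunc_sub hS SU)/HK.
exact (cosets_xget (trunc_open hS SU) KC).
Qed.

Lemma fam_val_ext (R : comPzRingType) (M : lmodType R) (X : choiceType)
    (act : G -> X -> X) (D : set X) (mu mu' : X -> G -> M) :
  (forall x a, D x -> K a -> mu x a = mu' x a) -> fam_val act D mu = fam_val act D mu'.
Proof.
move=> mm; apply: functional_extensionality_dep => U.
apply: eq_fsbigr => x /set_mem[Dx _]; apply: pure_ext => [|a Ka]; last exact: mm.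
exact: set_mem (valP U).
Qed.

End Families.

(** * The image of the ghost map *)

(* tpow_power picks an arbitrary preimage under tpow_curry; this holds for free
   modules, where tpow_curry is injective. *)
Definition has_powers (T : comPzRingType) (Q : lmodType T) :=
  forall (I J : choiceType) (k : nat) (m : nat -> I -> Q),
  finite_set [set: I] -> finite_set [set: J] ->
  tpow_power J (\sum_(i < k) tens (m i)) =
  \sum_(c \in choices (fun _ : J => k)) tens (fun p : I * J => m (c p.2) p.1).

Lemma FU_has_powers (R : comPzRingType) (M : lmodType R) : has_powers (FU M).
Proof. by move=> I J k m fI fJ; apply: tpow_powerE. Qed.

Section GhostExpansion.
Variables (G : profiniteGroupType) (K H : set G) (S S0 : set (set G)).
Variable rep : set G -> set G -> G.
Hypotheses (oK : open_subgroup K) (oH : open_subgroup H) (HK : H `<=` K).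
Hypotheses (hS : truncation_set H S) (hS0 : conj_transversal H S S0).
Hypothesis hrep : forall V, S0 V -> coset_reps K V (rep V).
Variables (T : comPzRingType) (Q : lmodType T).
Hypothesis hQ : has_powers Q.

Local Notation pure := (@pure G K).

Let S0S V : S0 V -> S V. Proof. by case: hS0 => h _; apply: h. Qed.

Definition pure_sum (V : set G) (l : seq (set G -> Q)) : tpow Q (cosets K V) :=
  \sum_(m <- l) tens (fun C : cosets K V => m (val C)).

Lemma pure_sum_span V (t : tpow Q (cosets K V)) : exists l, t = pure_sum V l.
Proof.
have KV : cosets K V (ltrans 1%g V) by exists 1%g => //; apply: osub1.
have [s ->] := tpow_pure_sum (SigSub (mem_set KV) : cosets K V) t.
pose ext (m : cosets K V -> Q) (C : set G) := oapp m 0 (insub C).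
exists (map ext s); rewrite /pure_sum big_map.
by apply: eq_bigr => m _; congr tens; apply: funext => C; rewrite /ext valK.
Qed.

Definition fixed_index (U : set G) : set (set G * set G) :=
  [set p | S0 p.1 /\ fixed_cosets H p.1 U p.2].

Lemma fixed_cosetsP V A U h : S V -> fixed_cosets H V U A -> A h ->
  [/\ H h, A = ltrans h V & conjs h^-1%g U `<=` V].
Proof.
move=> SV [h0 [Hh0 -> UV]] /ltransP Vh; have oV := trunc_open hS SV.
have hE : h = (h0 * (h0^-1 * h))%g by rewrite mulVKg.
rewrite hE; move: (h0^-1 * h)%g Vh => v Vv; split.
- by apply: (osubM oH Hh0); apply: (trunc_sub hS SV).
- by rewrite ltrans_mem.
- rewrite invgM conjsM conjs_subV; apply: subset_trans UV _ => x Vx.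
  by apply/conjsP; apply/(osubM oV)/Vv/(osubM oV)/Vx/(osubV oV).
Qed.

Lemma fixed_cosetsE V A U : S V ->
  fixed_cosets H V U A <-> cosets H V A /\ forall u, U u -> ltrans u A = A.
Proof.
move=> SV; have oV := trunc_open hS SV; split=> [[h [Hh -> UV]]|[[h Hh <-] UA]].
  split=> [|u Uu]; first by exists h.
  rewrite -ltransM -(mulVKg h (u * h)%g) ltrans_mem //.
  by apply: UV; apply/conjsP; rewrite invgK mulVKg mulgK.
exists h; split=> // x /conjsP; rewrite invgK => Ux.
have : ltrans h V (h * x * h^-1 * h)%g.
  by rewrite -(UA _ Ux); apply/ltransP; rewrite mulKg; apply: ltrans_self.
by move=> /ltransP; rewrite mulgVK mulKg.
Qed.

(** V is the representative of the class of some hVh^-1 containing U, and only finitely many open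
    subgroups contain U. *)
Lemma finite_fixed_index U : S U -> finite_set (fixed_index U).
Proof.
move=> SU; have oU := trunc_open hS SU.
pose r W := xget W (S0 `&` [set V | exists2 h, H h & V = conjs h W]).
pose F := [set W | open_subgroup W /\ U `<=` W].
have fF : finite_set F by apply: finite_above.
have fV : finite_set [set V | S0 V /\ exists A, fixed_cosets H V U A].
  apply: (sub_finite_set _ (finite_image r fF)) => V [S0V [A [h [Hh _ UV]]]].
  have SV := S0S S0V; exists (conjs h V).
    split; first by apply: osub_conjs; apply: trunc_open hS _ SV.
    by rewrite -conjs_subV.
  have [W [_ WU]] := hS0.2 _ (trunc_conjs hS SV Hh).
  rewrite /r; set P := _ `&` _.
  have PV : P V.
    split=> //; exists h^-1%g; [exact: osubV|by rewrite conjsK].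
  have PW Z : P Z -> Z = W by move=> PZ; rewrite (WU Z).
  by rewrite (PW _ (xgetI _ PV)) (PW _ PV).
apply: (sub_finite_set _ (finite_setXR (B := fun V => cosets H V) fV _)) => [p [S0p fp]|V [S0V _]].
  split; first by split=> //; exists p.2.
  by have [] := (fixed_cosetsE p.2 U (S0S S0p)).1 fp.
exact/finite_cosets/(trunc_open hS)/S0S.
Qed.

Definition ghost_term (U V A : set G) (n : tpow Q (cosets K V)) : tpow Q (cosets K U) :=
  let h := xget 1%g A in
  let Uh := conjs h^-1%g U in
  tact h U (tconcat rep (tpow_power (cosets V Uh) n) : tpow Q (cosets K Uh)).

Lemma ghost_mapE (n : forall V : set G, tpow Q (cosets K V)) (U : S) :
  ghost_map H S0 rep n U =
  \sum_(p \in fixed_index (val U)) ghost_term (val U) p.2 (n p.1).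
Proof.
have fI := finite_fixed_index (set_mem (valP U)).
rewrite -(fsum_fibers (C := S0) (g := fst)) //; last by move=> p [].
apply: eq_fsbigr => V /set_mem S0V.
have -> : fixed_index (val U) `&` fst @^-1` [set V] =
    pair V @` fixed_cosets H V (val U).
  apply/seteqP; split=> [[V' A] /= [[/= _ AU] VV']|_ [A AU <-]] //.
  by exists A; rewrite -VV'.
by rewrite fsbig_image // => A A' _ _ [].
Qed.

(* A colouring of the right coset A^-1 of V by the indices of l. *)
Definition colourings (A U : set G) (k : nat) : set (G -> nat) :=
  [set c | (forall x u, U u -> c (x * u)%g = c x) /\
           forall x, if `[< A x^-1%g >] then (c x < k)%N else c x == 0%N].

(** The reindexings of the ghost map combined: writing a = g s with g the representative of aA, the
    colour of s selects a summand of l, and aA its factor. *)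
Definition colour_mu (V A : set G) (l : seq (set G -> Q)) (c : G -> nat) (a : G) : Q :=
  nth (fun=> 0) l (c ((rep V (ltrans a A))^-1 * a)%g) (ltrans a A).

Let colour_ext (V U A : set G) h (c : cosets V (conjs h^-1%g U) -> nat) (x : G) :=
  if `[< A x^-1%g >] then oapp c 0%N (insub (ltrans (x * h)%g (conjs h^-1%g U))) else 0%N.

(** Right translation by h identifies A^-1 with V and turns cosets of U into cosets of h^-1Uh.
    Colourings live on A^-1 so that they do not mention the representative h, which lets H act on
    them. *)
Let colour_ext_bij V A U h k : S0 V -> S U -> fixed_cosets H V U A -> A h ->
  set_bij (choices (fun _ : cosets V (conjs h^-1%g U) => k)) (colourings A U k)
    (@colour_ext V U A h).
Proof.
move=> S0V SU AU Ah; have SV := S0S S0V; have oV := trunc_open hS SV.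
have [Hh AE UV] := fixed_cosetsP SV AU Ah.
have oUh := osub_conjs (trunc_open hS SU) h^-1%g.
have Ax x : A x^-1%g <-> V (x * h)%g.
  by rewrite AE ltransP -(osubVE oV) invgM !invgK.
have xU x u : U u -> ltrans (x * u * h)%g (conjs h^-1%g U) = ltrans (x * h)%g (conjs h^-1%g U).
  move=> Uu; rewrite -!mulgA -[(u * h)%g](mulVKg h) mulgA.
  apply: (ltrans_mem oUh); by apply/conjsP; rewrite invgK mulVKg mulgK.
have Vx x : V (x * h)%g -> cosets V (conjs h^-1%g U) (ltrans (x * h)%g (conjs h^-1%g U)).
  by move=> Vxh; exists (x * h)%g.
split=> [c ck|c c' _ _ cc'|c [cU cA]].
- split=> [x u Uu|x]; rewrite /colour_ext.
    rewrite xU //; congr (if _ then _ else _); apply/asbool_equiv_eq.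
    rewrite !Ax -mulgA -[(u * h)%g](mulVKg h) mulgA osubMr //.
    by apply: UV; apply/conjsP; rewrite invgK mulVKg mulgK.
  case: (asboolP (A x^-1%g)) => // /Ax Vxh.
  by rewrite (insubT (fun C => C \in cosets V _) (mem_set (Vx _ Vxh))) /=; apply: ck.
- apply: funext => C; have [v Vv vC] := set_mem (valP C).
  have := congr1 (@^~ (v * h^-1)%g) cc'; rewrite /= /colour_ext.
  rewrite (asboolT ((Ax _).2 _)); last by rewrite mulgVK.
  by rewrite mulgVK vC valK.
exists (fun C => c (xget 1%g (val C) * h^-1)%g).
  move=> C /=; have VC := set_mem (valP C).
  have := cA (xget 1 (val C) * h^-1)%g; rewrite ifT //; apply/asboolP/Ax.
  have Cx := cosets_xget oUh VC; rewrite mulgVK.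
  have [v Vv vC] := VC; rewrite -{1}vC in Cx; move/ltransP/UV: Cx => Cx.
  by have := osubM oV Vv Cx; rewrite mulVKg.
apply: funext => x; rewrite /colour_ext; case: ifPn => [/asboolP Axx|/negP nA].
  have VC := Vx x ((Ax x).1 Axx).
  rewrite (insubT (fun C => C \in cosets V _) (mem_set VC)) /=.
  have Cx := cosets_xget oUh VC; move: (xget _ _) Cx => y /ltransP/conjsP.
  rewrite invgK => /(cU x); rewrite !mulgA invgM !mulgA => <-; congr c.
  by rewrite mulgK mulgV mul1g.
by have := cA x; move/negP/negPf: nA => -> /eqP ->.
Qed.

Lemma finite_colourings V A U k : S0 V -> S U -> fixed_cosets H V U A ->
  finite_set (colourings A U k).
Proof.
move=> S0V SU AU; have [h [Hh Ah UV]] := AU.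
have Ahh : A h by rewrite Ah; apply: ltrans_self; apply: trunc_open hS _ (S0S S0V).
have [_ _ cov] := colour_ext_bij k S0V SU AU Ahh.
apply: (sub_finite_set cov); apply: finite_image; apply: finite_choices.
exact/finite_cosetsE/osub_conjs/(trunc_open hS SU).
Qed.

(** [hQ] expands the tensor power over the choices of a summand at each coset of h^-1Uh in V; the
    reindexings are additive, and the choices are the colourings. *)
Lemma ghost_termE V A U l : S0 V -> S U -> fixed_cosets H V U A ->
  ghost_term U A (pure_sum V l) =
  \sum_(c \in colourings A U (size l)) pure U (colour_mu V A l c).
Proof.
move=> S0V SU AU; have SV := S0S S0V; have oV := trunc_open hS SV.
have Ah : A (xget 1%g A).
  have [h [Hh -> UV]] := AU; exact: xgetI (ltrans_self oV h).
rewrite /ghost_term; move: (xget 1%g A) Ah => h Ah.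
have [Hh AE UV] := fixed_cosetsP SV AU Ah.
have SUh := trunc_conjs hS SU (osubV oH Hh).
have oUh := trunc_open hS SUh; have oU := trunc_open hS SU.
rewrite /pure_sum (big_nth (fun=> 0)) big_mkord.
rewrite (hQ _ (fun i (C : cosets K V) => nth (fun=> 0) l i (val C)));
  [|exact: finite_cosetsE|exact: finite_cosetsE].
have VK : V `<=` K by move=> x /(trunc_sub hS SV)/HK.
have [tcl tcE] := tconcatE Q oK oUh oV UV VK (hrep S0V).
have [tal taE] := tactE Q oK (conjs h^-1%g U) (HK Hh).
rewrite conjsVK in tal taE.
rewrite fsbig_finite; last exact/finite_choices/finite_cosetsE.
rewrite (morph_add_sum tcl.1) (morph_add_sum tal.1).
rewrite -fsbig_finite; last exact/finite_choices/finite_cosetsE.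
rewrite (reindex_fsbig _ _ _ _ (colour_ext_bij (size l) S0V SU AU Ah)).
apply: eq_fsbigr => c _.
pose cext (c : cosets V (conjs h^-1%g U) -> nat) C := oapp c 0%N (insub C).
have -> : (fun p : cosets K V * cosets V (conjs h^-1%g U) =>
      nth (fun=> 0) l (c p.2) (val p.1)) =
    (fun p => (fun B C => nth (fun=> 0) l (cext c C) B) (val p.1) (val p.2)).
  by apply: funext => p; rewrite /cext valK.
rewrite (tcE (fun B C => nth (fun=> 0) l (cext c C) B)).
rewrite (taE (fun C' => nth (fun=> 0) l (cext c (ltrans (rep V (coset_mul C' V))^-1%g C')) (coset_mul C' V))).
apply: tens_pure => // C a Ca; have KC := set_mem (valP C).
have KC' : cosets K (conjs h^-1%g U) (rtrans (val C) h).
  have := @cosets_rtrans _ _ oK (conjs h^-1%g U) (val C) h (HK Hh).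
  by rewrite conjsVK; apply.
have Cah : rtrans (val C) h (a * h)%g by apply/rtransP; rewrite mulgK.
have E : coset_mul (rtrans (val C) h) V = ltrans a A.
  by rewrite (coset_mulE oUh oV UV KC' Cah) AE ltransM.
rewrite /colour_mu E; congr (nth _ _ _ _).
have Ka : K a.
  by apply: (cosets_mem oK _ KC Ca) => v /(trunc_sub hS SU)/HK.
have KaA : cosets K V (ltrans a A).
  by rewrite AE -ltransM; exists (a * h)%g => //; apply: osubM => //; apply: HK.
have ra : ltrans a A (rep V (ltrans a A)) by apply: hrep.
rewrite /colour_ext ifT.
  rewrite /cext; congr (oapp _ _ (insub _)).
  rewrite (cosets_eq oU KC Ca) ltransM ltransM.
  by rewrite -{1}(conjsVK h U) -ltrans_rtrans -ltrans_conjs.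
by apply/asboolP; rewrite invgM invgK; move/ltransP: ra.
Qed.


(** The part of the ghost vector of L that comes from constant colourings, or the value of a union
    of orbits H/V, one for each m in L V. Unlike the ghost map, it is additive in L. *)
Definition list_val (L : set G -> seq (set G -> Q)) : ghost_group K S Q :=
  fun U => \sum_(p \in fixed_index (val U))
    \sum_(m <- L p.1) pure (val U) (fun a => m (ltrans a p.2)).

Lemma list_val_cat L L' :
  list_val (fun V => L V ++ L' V) = list_val L + list_val L'.
Proof.
apply: functional_extensionality_dep => U.
rewrite -[RHS]/(list_val L U + list_val L' U) /list_val -fsbig_split.
  by apply: eq_fsbigr => p _; rewrite big_cat.
exact: finite_fixed_index (set_mem (valP U)).
Qed.

(** * Ghost vectors as families of colourings *)

Section ColourFamily.
Variable L : set G -> seq (set G -> Q).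

Let X : choiceType := (set G * set G * (G -> nat))%type.

Definition colour_act (g : G) (z : X) : X :=
  (z.1.1, ltrans g z.1.2, fun x => z.2 (x * g)%g).

Definition colour_dom : set X :=
  [set z | [/\ S0 z.1.1, cosets H z.1.1 z.1.2 &
    forall x, if `[< z.1.2 x^-1%g >] then (z.2 x < size (L z.1.1))%N else z.2 x == 0%N]].

Definition colour_fun (z : X) : G -> Q := colour_mu z.1.1 z.1.2 (L z.1.1) z.2.

Definition colour_const : set X :=
  [set z | forall x y, z.1.2 x^-1%g -> z.1.2 y^-1%g -> z.2 x = z.2 y].

Lemma colour_act1 z : colour_act 1%g z = z.
Proof.
case: z => [[V A] c]; rewrite /colour_act /= ltrans1; congr (_, _, _).
by apply: funext => x; rewrite mulg1.
Qed.

Lemma colour_actM g h z : colour_act (g * h)%g z = colour_act g (colour_act h z).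
Proof.
case: z => [[V A] c]; rewrite /colour_act /= ltransM; congr (_, _, _).
by apply: funext => x; rewrite mulgA.
Qed.

Lemma colour_domP U z : S U ->
  (colour_dom `&` fixpts colour_act U) z <->
  fixed_index U z.1 /\ colourings z.1.2 U (size (L z.1.1)) z.2.
Proof.
case: z => [[V A] c] SU; split=> /=.
  move=> [[/= S0V VA cA] zU]; split; last first.
    by split=> // x u Uu; have [_] := zU u Uu; move=> /(congr1 (@^~ x)).
  split=> //; apply/(fixed_cosetsE _ _ (S0S S0V)); split=> // u Uu.
  by have [] := zU u Uu.
move=> [[S0V /(fixed_cosetsE _ _ (S0S S0V))[VA UA]] [cU cA]]; split=> // u Uu.
rewrite /colour_act /= UA //; congr (_, _, _).
by apply: funext => x; apply: cU.
Qed.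

(** E is either everything or the set of nonconstant colourings. *)
Lemma colour_fib U E : S U ->
  \sum_(z \in (colour_dom `&` E) `&` fixpts colour_act U) pure U (colour_fun z) =
  \sum_(p \in fixed_index U)
    \sum_(c \in colourings p.2 U (size (L p.1)) `&` [set c | E (p, c)])
      pure U (colour_mu p.1 p.2 (L p.1) c).
Proof.
move=> SU.
have fD : finite_set ((colour_dom `&` E) `&` fixpts colour_act U).
  apply: (sub_finite_set _ (finite_setXR (B := fun p => colourings p.2 U (size (L p.1)))
    (finite_fixed_index SU) _)) => [z [[Dz _] Uz]|p [S0p pU]].
    by have [] := (colour_domP z SU).1 (conj Dz Uz).
  exact: finite_colourings S0p SU pU.
rewrite -(fsum_fibers (C := fixed_index U) (g := fst)) //; last first.
  by move=> z [[Dz _] Uz]; have [] := (colour_domP z SU).1 (conj Dz Uz).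
apply: eq_fsbigr => p /set_mem pU.
set B := (X in \sum_(_ \in X) _ = _); set C := (X in _ = \sum_(_ \in X) _).
have -> : B = pair p @` C.
  apply/seteqP; split=> [[q c] [[[Dz Ez] Uz] /= qp]|_ [c [cU cE] <-]].
    move: Dz Ez Uz; rewrite qp => Dz Ez Uz; exists c => //; split=> //.
    by have [_] := (colour_domP _ SU).1 (conj Dz Uz).
  have [Dz Uz] := (colour_domP (p, c) SU).2 (conj pU cU).
  by split.
by rewrite fsbig_image // => c c' _ _ [].
Qed.

Lemma colour_family E : (forall h z, H h -> colour_dom z -> E z -> E (colour_act h z)) ->
  is_family K H S colour_act (colour_dom `&` E) colour_fun.
Proof.
move=> hE; split.
- exact: colour_act1.
- exact: colour_actM.
- move=> h z Hh [Dz Ez]; split; last exact: hE.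
  case: z Dz Ez => [[V A] c] [/= S0V VA cA] _; split=> //=.
    have [b Hb <-] := VA; exists (h * b)%g; last by rewrite ltransM.
    exact: osubM.
  move=> x; have := cA (x * h)%g.
  suff -> : `[< A (x * h)^-1%g >] = `[< ltrans h A x^-1%g >] by [].
  by apply/asbool_equiv_eq; rewrite ltransP invgM.
- by move=> h [[V A] c] a _ _ _; rewrite /colour_fun /colour_mu /= -ltransM mulgA.
move=> U SU; apply: (sub_finite_set _ (finite_setXR (B := fun p => colourings p.2 U (size (L p.1)))
    (finite_fixed_index SU) _)) => [z [[Dz _] Uz]|p [S0p pU]].
  by have [] := (colour_domP z SU).1 (conj Dz Uz).
exact: finite_colourings S0p SU pU.
Qed.

Lemma ghost_map_colour :
  ghost_map H S0 rep (fun V => pure_sum V (L V)) =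
  fam_val K colour_act (colour_dom `&` setT) colour_fun :> ghost_group K S Q.
Proof.
apply: functional_extensionality_dep => U; have SU := set_mem (valP U).
rewrite ghost_mapE /fam_val colour_fib //; apply: eq_fsbigr => p /set_mem[S0p pU].
by rewrite ghost_termE // setIT.
Qed.

Lemma ghost_map_fam : fam H 0 (ghost_map H S0 rep (fun V => pure_sum V (L V)) : ghost_group K S Q).
Proof.
rewrite ghost_map_colour.
exists X, colour_act, (colour_dom `&` setT), colour_fun; split=> //.
exact: colour_family.
Qed.

Lemma const_colourings V A U : S0 V -> S U -> fixed_cosets H V U A ->
  \sum_(c \in colourings A U (size (L V)) `&` [set c | colour_const (V, A, c)])
    pure U (colour_mu V A (L V) c) =
  \sum_(m <- L V) pure U (fun a => m (ltrans a A)).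
Proof.
move=> S0V SU AU; have SV := S0S S0V; have oV := trunc_open hS SV.
have [[h Hh hA] UA] := (fixed_cosetsE A U SV).1 AU.
have Ah : A h^-1^-1%g by rewrite invgK -hA; apply: ltrans_self.
pose ci i (x : G) := if `[< A x^-1%g >] then i else 0%N.
have bij : set_bij `I_(size (L V))
    (colourings A U (size (L V)) `&` [set c | colour_const (V, A, c)]) ci.
  split=> [i ik|i j _ _ ij|c [[cU cA] cc]].
  - split; [split=> [x u Uu|x]|move=> x y /= Ax Ay].
    + rewrite /ci; congr (if _ then _ else _); apply/asbool_equiv_eq.
      by rewrite invgM -ltransP UA.
    + by rewrite /ci; case: asboolP.
    + by rewrite /ci !asboolT.
  - by have := congr1 (@^~ h^-1%g) ij; rewrite /ci /= !asboolT.
  exists (c h^-1%g); first by have := cA h^-1%g; rewrite asboolT.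
  apply: funext => x; rewrite /ci; have := cA x.
  by case: asboolP => [Ax _|_ /eqP ->//]; apply: cc.
rewrite (reindex_fsbig _ _ _ _ bij) -fsbig_ord (big_nth (fun=> 0)) big_mkord.
apply: eq_bigr => i _; apply: (pure_ext oK HK hS) => // a Ka.
rewrite /colour_mu /ci asboolT // invgM invgK -ltransP.
apply: hrep => //; rewrite -hA -ltransM; exists (a * h)%g => //.
by apply: (osubM oK Ka); apply: HK.
Qed.

(** Constant colourings give [list_val]. The stabiliser of a nonconstant colouring of hV lies
    strictly inside hVh^-1, so its rank is strictly larger than that of V. *)
Lemma ghost_map_list k : (forall V, S0 V -> L V <> [::] -> (k <= rank S V)%N) ->
  exists2 x, fam H k.+1 x &
    ghost_map H S0 rep (fun V => pure_sum V (L V)) = list_val L + x.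
Proof.
move=> Lk; exists (fam_val K colour_act (colour_dom `&` ~` colour_const) colour_fun).
  exists X, colour_act, (colour_dom `&` ~` colour_const), colour_fun; split=> //.
    apply: colour_family => h [[V A] c] Hh _ nc hc; apply: nc => x y /= Ax Ay.
    have := hc (x * h^-1)%g (y * h^-1)%g; rewrite /= !mulgVK; apply.
      by apply/ltransP; rewrite invgM invgK mulKg.
    by apply/ltransP; rewrite invgM invgK mulKg.
  move=> [[V A] c] [[/= S0V [h Hh hA] cA] nc] Sy.
  have SV := S0S S0V; have oV := trunc_open hS SV.
  have ShV := trunc_conjs hS SV Hh.
  (* A colouring uses at least one colour, because A is not empty. *)
  have LV : L V <> [::].
    have := cA h^-1%g; rewrite asboolT; last by rewrite invgK -hA; apply: ltrans_self.
    by case: (L V).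
  apply: (leq_ltn_trans (Lk V S0V LV)); rewrite -(rank_conjs oH hS SV Hh).
  apply: (rank_lt hS Sy ShV) => [g [Hg [gA _]]|sE].
    apply/conjsP; rewrite -mulgA -ltransP.
    have : A (g * h)%g.
      by rewrite -gA; apply/ltransP; rewrite mulKg -hA; apply: ltrans_self.
    by rewrite -hA.
  (* hVh^-1 acts transitively on A^-1 = Vh^-1, so a colouring fixed by all of it would be
     constant. *)
  apply: nc => x y /=; rewrite -hA => /ltransP Vx /ltransP Vy.
  have : conjs h V (x^-1 * y)%g.
    apply/conjsP; have := osubM oV Vx (osubV oV Vy).
    by rewrite invgM !invgK !mulgA.
  rewrite -sE => -[_ []] _ /(congr1 (@^~ x)) /=.
  by rewrite mulVKg.
apply: functional_extensionality_dep => U; have SU := set_mem (valP U).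
have fI := finite_fixed_index SU.
rewrite -[RHS]/(list_val L U + fam_val _ _ _ _ U) ghost_mapE /fam_val colour_fib //.
rewrite /list_val -fsbig_split //; apply: eq_fsbigr => p /set_mem[S0p pU].
rewrite ghost_termE // -const_colourings // (fsbigID [set c | colour_const (p, c)]) /=.
  by case: p {S0p pU}.
exact: finite_colourings S0p SU pU.
Qed.

End ColourFamily.

Lemma list_val0 : list_val (fun=> [::]) = 0.
Proof.
apply: functional_extensionality_dep => U; apply: fsbig1 => p _.
by rewrite big_nil.
Qed.

(** * Splitting off the orbits of lowest rank *)

Section LeadingTerm.
Variables (X : choiceType) (act : G -> X -> X) (D : set X) (mu : X -> G -> Q).
Variable k : nat.
Hypothesis fD : is_family K H S act D mu.

Let lead : set X := [set y | [/\ D y, S (stab H act y) & rank S (stab H act y) = k]].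

Variable x0 : X.

(** A point of the orbit of y with stabiliser in S0. [xget] depends only on the predicate, which is
    the same along the orbit, so all points of an orbit get the same base point. *)
Let base (y : X) : X :=
  xget x0 [set z | (exists2 h, H h & z = act h y) /\ S0 (stab H act z)].

Let a1 : forall y, act 1%g y = y. Proof. by case: fD. Qed.
Let aM : forall g h y, act (g * h)%g y = act g (act h y). Proof. by case: fD. Qed.
Let aK g y : act g^-1%g (act g y) = y. Proof. by rewrite -aM mulVg a1. Qed.
Let lead_act h y : H h -> lead y -> lead (act h y).
Proof.
move=> Hh [Dy Sy ry]; have [_ _ aD _ _] := fD; split; first exact: aD.
  by rewrite (stab_conjs oH fD) //; exact (trunc_conjs hS Sy Hh).
by rewrite (stab_conjs oH fD) // (rank_conjs oH hS).
Qed.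

Let baseP y : lead y ->
  (exists2 h, H h & base y = act h y) /\ S0 (stab H act (base y)).
Proof.
move=> [Dy Sy _]; rewrite /base; set P := [set z | _].
have [V [[S0V [h Hh VE]] _]] := hS0.2 _ Sy.
apply: (xgetI x0 (P := P) (x := act h y)); split; first by exists h.
by rewrite (stab_conjs oH fD) // -VE.
Qed.

Let base_act h y : H h -> base (act h y) = base y.
Proof.
move=> Hh; rewrite /base; congr xget; apply/seteqP; split=> z [[g Hg ->] S0z]; split=> //.
  by exists (g * h)%g; rewrite ?aM //; apply: osubM.
by exists (g * h^-1)%g; rewrite ?aM ?aK //; apply: osubM => //; apply: osubV.
Qed.

Let B (V : set G) : set X := [set b | [/\ lead b, base b = b & stab H act b = V]].

Let finB V : S V -> finite_set (B V).
Proof.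
have [_ _ _ _ fin] := fD => SV; apply: sub_finite_set (fin _ SV) => b [[Db _ _] _ bV].
by split=> // u; rewrite -bV => -[].
Qed.

Definition lead_list (V : set G) : seq (set G -> Q) :=
  if `[< S0 V >] then [seq (fun C => mu b (xget 1%g C)) | b <- fset_set (B V)]
  else [::].

Lemma lead_list_rank V : S0 V -> lead_list V <> [::] -> rank S V = k.
Proof.
move=> S0V; rewrite /lead_list asboolT //; have fB := finB (S0S S0V).
have [->|/set0P[b Bb]] := eqVneq (B V) set0; first by rewrite fset_set0.
by move=> _; case: Bb => -[_ _ <-] _ ->.
Qed.

(** The identification of the orbit of a base point b with H/V, V the stabiliser of b: the point hb
    corresponds to hV. *)
Let locate (y : X) : set G * set G :=
  (stab H act (base y), [set h | H h /\ act h (base y) = y]).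

Let locate_coset h b : H h ->
  [set g | H g /\ act g b = act h b] = ltrans h (stab H act b).
Proof.
move=> Hh; apply/seteqP; split=> [g [Hg gb]|g /ltransP[Hg gb]].
  apply/ltransP; split; first by apply: osubM => //; apply: osubV.
  by rewrite aM gb aK.
rewrite -(mulVKg h g); split; first exact: osubM.
by rewrite aM gb.
Qed.

Let locate_fixed U y : S U -> lead y -> fixpts act U y -> fixed_index U (locate y).
Proof.
move=> SU ly Uy; have [[h Hh hy] S0b] := baseP ly; split=> //=.
exists h^-1%g; split; first exact: osubV.
  rewrite -(locate_coset (base y) (osubV oH Hh)).
  by have -> : act h^-1%g (base y) = y by rewrite hy aK.
rewrite invgK hy (stab_conjs oH fD) // conjs_sub => u Uu.
by split; [exact: (trunc_sub hS SU)|exact: Uy].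
Qed.

(** Over a fixed coset hV lies exactly one point for each base point b with stabiliser V, namely
    hb. *)
Let locate_fiber U p : S U -> fixed_index U p ->
  (lead `&` fixpts act U) `&` locate @^-1` [set p] = act (xget 1%g p.2) @` B p.1.
Proof.
move=> SU [S0V AU]; case: p S0V AU => V A /= S0V AU; have SV := S0S S0V.
have [[h0 Hh0 hA] UA] := (fixed_cosetsE A U SV).1 AU.
have Ah : A (xget 1%g A).
  by apply: (cosets_xget (trunc_open hS SV) (K := H)); exists h0.
have [Hh AE _] := fixed_cosetsP SV AU Ah.
move: (xget 1%g A) Ah Hh AE => h Ah Hh AE.
apply/seteqP; split=> [y [[ly Uy] [bV bA]]|_ [b [lb bb bV] <-]].
  have [[g Hg gy] S0b] := baseP ly.
  have [_ hb] : [set g | H g /\ act g (base y) = y] h by rewrite bA.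
  exists (base y) => //; split=> //; last by rewrite gy base_act.
  by rewrite gy; apply: lead_act.
have bh : base (act h b) = b by rewrite base_act.
split; last by rewrite /locate /= bh locate_coset // bV -AE.
split; first exact: lead_act.
move=> u Uu; rewrite -aM.
have : A (u * h)%g by rewrite -(UA u Uu); apply/ltransP; rewrite mulKg.
by rewrite AE -bV => /ltransP[_ /(congr1 (act h))]; rewrite -aM mulVKg.
Qed.

Lemma lead_listE (U : S) :
  \sum_(y \in lead `&` fixpts act (val U)) pure (val U) (mu y) = list_val lead_list U.
Proof.
have SU := set_mem (valP U); have [_ _ aD amu fin] := fD.
rewrite -(fsum_fibers (C := fixed_index (val U)) (g := locate)); first last.
- by move=> y [ly Uy]; apply: locate_fixed.
- by apply: sub_finite_set (fin _ SU) => y [[Dy _ _] Uy].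
apply: eq_fsbigr => p /set_mem pU; rewrite locate_fiber //.
have [S0V AU] := pU; have SV := S0S S0V.
rewrite fsbig_image; last by move=> b b' _ _ /(congr1 (act (xget 1%g p.2)^-1%g)); rewrite !aK.
rewrite /lead_list asboolT // big_map fsbig_finite; last exact: finB.
rewrite big_seq [RHS]big_seq; apply: eq_bigr => b.
rewrite in_fset_set; last exact: finB.
move=> /set_mem[[Db _ _] _ bV]; apply: (pure_ext oK HK hS) => // a Ka.
have Ah : p.2 (xget 1%g p.2).
  apply: (cosets_xget (trunc_open hS SV) (K := H)).
  by have [] := (fixed_cosetsE p.2 (val U) SV).1 AU.
have [Hh AE _] := fixed_cosetsP SV AU Ah.
rewrite amu //; set h := xget 1%g p.2 in Ah Hh AE *.
have KaA : cosets K p.1 (ltrans a p.2).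
  by rewrite AE -ltransM; exists (a * h)%g => //; apply: osubM => //; apply: HK.
have xA := cosets_xget (trunc_open hS SV) KaA.
have ahA : ltrans a p.2 (a * h)%g by apply/ltransP; rewrite mulKg.
have := cosets_div (trunc_open hS SV) KaA ahA xA; rewrite -bV => -[Hv vb].
rewrite -{1}vb amu //; first by rewrite mulVKg.
by apply: osubM => //; apply: HK.
Qed.

Lemma fam_val_lead : (forall y, D y -> S (stab H act y) -> (k <= rank S (stab H act y))%N) ->
  exists2 x, fam H k.+1 x & fam_val K act D mu = list_val lead_list + x.
Proof.
move=> rD; have [_ _ aD amu fin] := fD.
exists (fam_val K act (D `&` ~` lead) mu).
  exists X, act, (D `&` ~` lead), mu; split=> //.
    split=> // [h y Hh [Dy ny]|h y a Hh [Dy _]|U SU].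
    - split; first exact: aD.
      by move=> ly; apply: ny; rewrite -(aK h y); apply: lead_act => //; apply: osubV.
    - exact: amu.
    - by apply: sub_finite_set (fin U SU) => y [[]].
  move=> y [Dy ny] Sy; rewrite ltn_neqAle rD // andbT; apply/eqP => ry.
  by apply: ny; split.
apply: functional_extensionality_dep => U; have SU := set_mem (valP U).
rewrite -[RHS]/(list_val _ U + fam_val _ _ _ _ U) -lead_listE /fam_val.
rewrite (fsbigID lead) /=; last exact: fin.
congr (_ + _); apply: eq_fsbigl; apply/seteqP; split=> y.
- by move=> [[_ Uy] ly].
- by move=> [ly Uy]; split=> //; split=> //; case: ly.
- by move=> [[Dy Uy] ny].
- by move=> [[Dy ny] Uy].
Qed.

End LeadingTerm.

Lemma fam_list k (x : ghost_group K S Q) : fam H k x ->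
  exists L, (forall V, S0 V -> L V <> [::] -> rank S V = k) /\
  exists2 x', fam H k.+1 x' & x = list_val L + x'.
Proof.
move=> [X [act [D [mu [fD rD ->]]]]].
(* [lead_list] takes a point of X as the default of [xget], so the empty family is treated
   separately. *)
have [->|/set0P[x0 _]] := eqVneq D set0.
  exists (fun=> [::]); split=> //; exists 0; first exact: fam0.
  rewrite list_val0 addr0; apply: functional_extensionality_dep => U.
  by rewrite /fam_val set0I fsbig_set0.
exists (lead_list act D mu k x0); split; first exact: lead_list_rank.
exact: fam_val_lead.
Qed.

Lemma ghost_term0 V A U : S0 V -> S U -> fixed_cosets H V U A ->
  ghost_term U A (pure_sum V [::]) = 0.
Proof.
move=> S0V SU AU; rewrite ghost_termE // fsbig1 // => c [_ cA]; exfalso.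
have [[h Hh hA] _] := (fixed_cosetsE A U (S0S S0V)).1 AU.
have := cA h^-1%g; rewrite asboolT // invgK -hA.
exact: ltrans_self (trunc_open hS (S0S S0V)) h.
Qed.

(** Empty lists are kept empty, so that the negatives are supported in the same rank. *)
Lemma neg_list (L : set G -> seq (set G -> Q)) : exists L',
  forall V, (L V = [::] -> L' V = [::]) /\ pure_sum V (L' V) = - pure_sum V (L V).
Proof.
suff h V : exists l, (L V = [::] -> l = [::]) /\ pure_sum V l = - pure_sum V (L V).
  by have [L' L'P] := choice h; exists L'.
have [->|/eqP LV] := eqVneq (L V) [::].
  by exists [::]; split=> //; rewrite /pure_sum big_nil oppr0.
by have [l ->] := pure_sum_span (- pure_sum V (L V)); exists l.
Qed.

Lemma ghost_map0 (L : set G -> seq (set G -> Q)) : (forall V, pure_sum V (L V) = 0) ->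
  ghost_map H S0 rep (fun V => pure_sum V (L V)) = 0 :> ghost_group K S Q.
Proof.
move=> L0; apply: functional_extensionality_dep => U; have SU := set_mem (valP U).
rewrite ghost_mapE; apply: fsbig1 => p [S0p pU].
have -> : pure_sum p.1 (L p.1) = pure_sum p.1 [::].
  by rewrite L0 /pure_sum big_nil.
exact: ghost_term0.
Qed.

Lemma pure_sum_cat V l l' : pure_sum V (l ++ l') = pure_sum V l + pure_sum V l'.
Proof. exact: big_cat. Qed.

(** L3 represents the negatives of the pure sums of L2, but its leading part is not the negative of
    that of L2. The ghost vector of L3 ++ L2 is zero, however, so the sum of the two leading parts
    is minus the value w of a family of rank above k, and w goes into the remainder. *)
Lemma fam_diff_step k (x : ghost_group K S Q) : fam_diff H k x ->
  exists L, (forall V, S0 V -> L V <> [::] -> rank S V = k) /\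
  fam_diff H k.+1 (x - ghost_map H S0 rep (fun V => pure_sum V (L V))).
Proof.
move=> [y [z [/fam_list[L1 [rL1 [y1 ky ->]]] /fam_list[L2 [rL2 [z1 kz ->]]] ->]]].
have [L3 L3P] := neg_list L2.
have rL3 V : S0 V -> L3 V <> [::] -> rank S V = k.
  by move=> S0V L3V; apply: rL2 => // L2V; apply: L3V; apply: (L3P V).1.
have rcat (L L' : set G -> seq (set G -> Q)) : (forall V, S0 V -> L V <> [::] -> rank S V = k) ->
    (forall V, S0 V -> L' V <> [::] -> rank S V = k) ->
    forall V, S0 V -> L V ++ L' V <> [::] -> rank S V = k.
  move=> rL rL' V S0V; case: (L V) (rL V S0V) => [|m l] h; last by rewrite h.
  exact: rL'.
exists (fun V => L1 V ++ L3 V); split; first exact: rcat L1 L3 rL1 rL3.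
have le_of (L : set G -> seq (set G -> Q)) : (forall V, S0 V -> L V <> [::] -> rank S V = k) ->
    forall V, S0 V -> L V <> [::] -> (k <= rank S V)%N.
  by move=> rL V S0V LV; rewrite (rL V).
have [u ku ->] := ghost_map_list (le_of _ (rcat L1 L3 rL1 rL3)).
have [w kw] := ghost_map_list (le_of _ (rcat L3 L2 rL3 rL2)).
rewrite ghost_map0 => [E|V]; last by rewrite pure_sum_cat (L3P V).2 addNr.
exists (y1 + w), (z1 + u); split; [exact: famD|exact: famD|].
rewrite !list_val_cat in E *; move: (list_val L1) (list_val L2) (list_val L3) E.
move=> l1 l2 l3 E; have -> : w = - (l3 + l2) by apply/eqP; rewrite -addr_eq0 addrC -E.
rewrite -[l1 + y1 - _]addrA -[l1 + l3 + u]addrA [- (l1 + _)]opprD addrACA subrr add0r.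
by rewrite -!addrA -!opprD addrACA [l2 + l3]addrC.
Qed.

Lemma rank_fixed_index U p : S U -> fixed_index U p -> (rank S p.1 <= rank S U)%N.
Proof.
move=> SU [S0p [h [Hh _ UV]]]; have HhV := osubV oH Hh.
by rewrite -(rank_conjs oH hS SU HhV); exact (rank_le hS (trunc_conjs hS SU HhV) UV).
Qed.

(** Successive approximation, rank by rank. No limit has to be taken: each V is touched only in the
    step of its own rank. *)
Lemma fam_diff_ghost_map (x : ghost_group K S Q) : fam_diff H 0 x ->
  exists n, ghost_map H S0 rep n = x.
Proof.
move=> x0.
pose w L : ghost_group K S Q := ghost_map H S0 rep (fun V => pure_sum V (L V)).
have step (kx : nat * ghost_group K S Q) : exists L : set G -> seq (set G -> Q),
    fam_diff H kx.1 kx.2 ->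
    (forall V, S0 V -> L V <> [::] -> rank S V = kx.1) /\
    fam_diff H kx.1.+1 (kx.2 - w L).
  have [/fam_diff_step[L ?]|nk] := pselect (fam_diff H kx.1 kx.2); first by exists L.
  by exists (fun=> [::]).
have [f fP] := choice step.
(* X k is the remainder after the ranks below k have been treated. *)
pose X k := iteri k (fun k y => y - w (f (k, y))) x.
have XP k : fam_diff H k (X k) by elim: k => // k /(fP (k, _))[].
pose L k := f (k, X k).
have LP k V : S0 V -> L k V <> [::] -> rank S V = k by have [+ _] := fP (k, X k) (XP k); apply.
have XE k : X k = x - \sum_(i < k) w (L i).
  elim: k => [|k IH]; first by rewrite big_ord0 subr0.
  by rewrite big_ord_recr /= opprD addrA -IH.
(* L k is concentrated in rank k, so the steps combine into one vector, coordinate by coordinate. *)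
exists (fun V => pure_sum V (L (rank S V) V)).
apply: functional_extensionality_dep => U; have SU := set_mem (valP U).
have sumE N : (\sum_(i < N) w (L i)) U = \sum_(i < N) w (L i) U.
  by apply: (big_morph (fun y : ghost_group K S Q => y U)).
(* All ranks up to that of U have been treated, so the remainder is zero at U. *)
have := fam_diff_vanish oH hS (XP (rank S (val U)).+1) (ltnSn (rank S (val U))).
have subE (y z : ghost_group K S Q) : (y - z) U = y U - z U by [].
rewrite XE subE => /subr0_eq ->.
rewrite sumE ghost_mapE; have fI := finite_fixed_index SU.
under [RHS]eq_bigr do rewrite /w ghost_mapE fsbig_finite //.
rewrite exchange_big fsbig_finite //= big_seq [RHS]big_seq.
apply: eq_bigr => p; rewrite in_fset_set // => /set_mem pU; have [S0p AU] := pU.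
have rp : (rank S p.1 < (rank S (val U)).+1)%N by apply: rank_fixed_index.
(* Among the steps only the one numbered by the rank of V = p.1 has a nonempty list at V. *)
rewrite (bigD1 (Ordinal rp)) //= big1 ?addr0 // => i ip.
have [->|/eqP Lp] := eqVneq (L i p.1) [::]; first exact: ghost_term0.
by move: ip; rewrite -val_eqE /= (LP i p.1 S0p Lp) eqxx.
Qed.

Lemma ghost_map_fam_any (n : forall V : set G, tpow Q (cosets K V)) :
  fam H 0 (ghost_map H S0 rep n : ghost_group K S Q).
Proof.
have [L nL] := choice (fun V => pure_sum_span (n V)).
by rewrite (functional_extensionality_dep nL); apply: ghost_map_fam.
Qed.

(* The right-hand side does not depend on the choices of S0 and rep. *)
Theorem witt_freeP (x : ghost_group K S Q) :
  x \in subgroup_gen (@ghost_fixed G K H S T Q `&` range (@ghost_map G K H S S0 rep T Q))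
  <-> fam_diff H 0 x.
Proof.
split=> [/asboolP/(_ (fun y => `[< fam_diff H 0 y >])) h|x0].
  suff /asboolP : x \in (fun y => `[< fam_diff H 0 y >] : bool) by [].
  apply: h => [|y [_ [n _ <-]]]; last first.
    exact/asboolP/fam_diff_fam/ghost_map_fam_any.
  split=> [|y z /asboolP hy /asboolP hz]; first exact/asboolP/fam_diff0.
  exact/asboolP/fam_diff_sub.
have [y [z [fy fz ->]]] := x0.
apply/asboolP => P [P0 PB] sub.
have inP u : fam H 0 u -> u \in P.
  move=> fu; apply: sub; split; first exact: fam_fixed fu.
  by have [n <-] := fam_diff_ghost_map (fam_diff_fam fu); exists n.
exact: PB (inP _ fy) (inP _ fz).
Qed.

End GhostExpansion.

(* A family whose values are sums of values of e expands multilinearly: the new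
   indices are an old index together with a choice of a summand at each coset. *)
Section FamilyExpansion.
Variables (G : profiniteGroupType) (K H : set G) (S : set (set G)).
Hypotheses (oK : open_subgroup K) (oH : open_subgroup H) (HK : H `<=` K).
Hypothesis hS : truncation_set H S.
Variables (R : comPzRingType) (M : lmodType R) (Y : Type) (y0 : Y) (e : Y -> M).
Variable terms : M -> seq Y.
Hypothesis termsE : forall m, \sum_(y <- terms m) e y = m.
Variables (X : choiceType) (act : G -> X -> X) (D : set X) (mu : X -> G -> M).
Hypothesis fD : is_family K H S act D mu.

Let X' : choiceType := (X * (G -> nat))%type.

Let act' (g : G) (z : X') : X' := (act g z.1, fun x => z.2 (x * g)%g).

Let colours (x : X) : set (G -> nat) :=
  [set c | forall a, if `[< K a >] then (c a < size (terms (mu x a)))%N else c a == 0%N].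

Let D' : set X' := [set z | D z.1 /\ colours z.1 z.2].

Let mu' (z : X') (a : G) : Y := nth y0 (terms (mu z.1 a)) (z.2 a).

Let inv_colours (x : X) (U : set G) : set (G -> nat) :=
  colours x `&` [set c | forall a u, U u -> c (a * u)%g = c a].

Let D'U U : D' `&` fixpts act' U =
  [set z | (D `&` fixpts act U) z.1 /\ inv_colours z.1 U z.2].
Proof.
apply/seteqP; split=> [[x c] [[/= Dx cx] Ux]|[x c] [[/= Dx Ux] [cx cU]]].
  split; first by split=> // u /Ux[].
  by split=> // a u /Ux[_] /(congr1 (@^~ a)).
split=> // u Uu; rewrite /act' /= Ux //; congr pair.
by apply: funext => a; apply: cU.
Qed.

Let ext (U : set G) (c : cosets K U -> nat) (a : G) : nat := oapp c 0%N (insub (ltrans a U)).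

(** By [family_coset] the list of terms is the same along a coset of U, so an invariant colouring is
    a choice of one term at each coset. *)
Let ext_bij (U : set G) x : S U -> (D `&` fixpts act U) x ->
  set_bij (choices (fun C : cosets K U => size (terms (mu x (xget 1%g (val C))))))
    (inv_colours x U) (@ext U).
Proof.
move=> SU Ux; have oU := trunc_open hS SU.
have UK : U `<=` K by move=> u /(trunc_sub hS SU)/HK.
have KU a : K a -> cosets K U (ltrans a U) by move=> Ka; exists a.
have KUE a : ~ K a -> (ltrans a U \in cosets K U) = false.
  move=> nK; apply/negP => /set_mem KUa; apply: nK.
  by apply: (cosets_mem oK UK KUa); apply: ltrans_self.
split=> [c ck|c c' _ _ cc'|c [cx cU]].
- split=> [a|a u Uu]; last by rewrite /ext ltrans_mem.
  case: asboolP => Ka; last by rewrite /ext insubF // KUE.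
  rewrite /ext (insubT (fun C => C \in cosets K U) (mem_set (KU a Ka))) /=.
  rewrite -(family_coset oK HK hS fD SU Ux (KU a Ka) (ltrans_self oU a)).
  exact: (ck (SigSub (mem_set (KU a Ka)))).
- apply: funext => C; have KC := set_mem (valP C).
  have := congr1 (@^~ (xget 1%g (val C))) cc'; rewrite /= /ext.
  by rewrite -(cosets_eq oU KC (cosets_xget oU KC)) valK.
exists (fun C => c (xget 1%g (val C))) => [C|].
  have KC := set_mem (valP C); have := cx (xget 1%g (val C)); rewrite asboolT //.
  exact: (cosets_mem oK UK KC (cosets_xget oU KC)).
apply: funext => a; rewrite /ext; have [Ka|nK] := pselect (K a).
  rewrite (insubT (fun C => C \in cosets K U) (mem_set (KU a Ka))) /=.
  have xa := cosets_xget oU (KU a Ka).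
  have Ua := cosets_div oU (KU a Ka) (ltrans_self oU a) xa.
  by rewrite -(cU a _ Ua) mulVKg.
by rewrite insubF ?KUE //=; have := cx a; rewrite asboolF // => /eqP ->.
Qed.

Let finite_inv_colours U x : S U -> (D `&` fixpts act U) x -> finite_set (inv_colours x U).
Proof.
move=> SU Ux; have [_ _ cov] := ext_bij SU Ux.
apply: (sub_finite_set cov); apply/finite_image/finite_choices/finite_cosetsE.
exact (trunc_open hS SU).
Qed.

Lemma family_expand : exists (X1 : choiceType) (act1 : G -> X1 -> X1) (D1 : set X1)
    (mu1 : X1 -> G -> Y), is_family K H S act1 D1 mu1 /\
  (fam_val K act D mu : ghost_group K S M) =
    fam_val K act1 D1 (fun z => e \o mu1 z).
Proof.
have [a1 aM aD amu fin] := fD.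
have fin' U : S U -> finite_set (D' `&` fixpts act' U).
  move=> SU; rewrite D'U.
  apply: (sub_finite_set _ (finite_setXR (B := fun x => inv_colours x U) (fin U SU) _)) => [z []|x Ux] //.
  exact: finite_inv_colours.
exists X', act', D', mu'; split.
  split=> // [[x c]|g h [x c]|h [x c] Hh [/= Dx cx]|h [x c] a Hh [/= Dx cx] Ka].
  - by rewrite /act' /= a1; congr pair; apply: funext => a; rewrite mulg1.
  - by rewrite /act' /= aM; congr pair; apply: funext => a; rewrite mulgA.
  - split=> /=; first exact: aD.
    move=> a /=; have := cx (a * h)%g.
    have -> : `[< K (a * h)%g >] = `[< K a >].
      by apply/asbool_equiv_eq/(osubMr oK)/HK.
    by case: asboolP => // Ka; rewrite amu.
  - by rewrite /mu' /= amu.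
apply: functional_extensionality_dep => U; have SU := set_mem (valP U).
have oU := trunc_open hS SU.
rewrite /fam_val -(fsum_fibers (C := D `&` fixpts act (val U)) (g := fst)); first last.
- by move=> z; rewrite D'U => -[].
- exact: fin'.
apply: eq_fsbigr => x /set_mem Ux.
have -> : (D' `&` fixpts act' (val U)) `&` fst @^-1` [set x] = pair x @` inv_colours x (val U).
  rewrite D'U; apply/seteqP; split=> [[y c] [[_ cx] /= yx]|_ [c cx <-] //].
  by rewrite -yx; exists c.
rewrite fsbig_image; last by move=> c c' _ _ [].
rewrite (reindex_fsbig _ _ _ _ (ext_bij SU Ux)).
transitivity (tens (fun C : cosets K (val U) =>
    \sum_(i < size (terms (mu x (xget 1%g (val C)))))
      e (nth y0 (terms (mu x (xget 1%g (val C)))) i))).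
  rewrite /pure; congr tens; apply: funext => C.
  by rewrite -{1}[mu x _]termsE (big_nth y0) big_mkord.
rewrite (multilin_expand (ring_hom_id R) (@tens_multilin R M _) (finite_cosetsE oU K)
  (fun C => size (terms (mu x (xget 1%g (val C)))))
  (fun C i => e (nth y0 (terms (mu x (xget 1%g (val C)))) i))).
apply: eq_fsbigr => c _; congr tens; apply: funext => C.
have KC := set_mem (valP C); rewrite /mu' /= /ext.
by rewrite -(cosets_eq oU KC (cosets_xget oU KC)) valK.
Qed.

End FamilyExpansion.

(** * Hausdorff quotients *)

(** The factors are discrete, so every coordinatewise map is continuous, including one defined by
    choosing preimages. *)
Lemma dprod_map_continuous (I : Type) (T T' : I -> zmodType) (f : forall i, T i -> T' i) :
  continuous (fun x : dprod T => (fun i => f i (x i)) : dprod T').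
Proof.
pose F (x : dprod T) : dprod T' := fun i => f i (x i).
move=> x; have FF : Filter (F @ x) by apply: (fmap_filter F (nbhs_filter x)).
rewrite -/F; apply/cvg_sup => i A [_ [[C _ <-] Cx sCA]].
apply: filterS (dprod_nbhs_coord x i) => t tx; apply: sCA.
by move: Cx; rewrite /F /= tx.
Qed.

Lemma tsub_continuous (E E' : topologicalZmodType) (P : zmodClosed E) (P' : zmodClosed E')
    (F : E -> E') (f : tsub P -> tsub P') :
  continuous F -> (forall x, val (f x) = F (val x)) -> continuous f.
Proof.
move=> cF fF; apply: continuous_comp_initial.
have -> : @tsub_val E' P' \o f = F \o @tsub_val E P by apply: funext => x; apply: fF.
move=> x; apply: continuous_comp; last exact: cF.
exact: initial_continuous.
Qed.

Section HausdorffQuotientTheory.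
Variables (E : topologicalZmodType) (D : set E).

Lemma hquot_pi_eq (x y : E) :
  \pi_(hquot D) x = \pi_(hquot D) y <-> x - y \in closed_gen D.
Proof.
have memE z : (z \in (closed_gen D : zmodClosed E)) = (z \in closed_gen D) by [].
by rewrite -memE Quotient.idealrBE; split=> [->|/eqP].
Qed.

Lemma hquot_piD (x y : E) :
  \pi_(hquot D) (x + y) = \pi_(hquot D) x + \pi_(hquot D) y.
Proof. exact: raddfD. Qed.

Lemma hquot_pi_continuous : continuous (\pi_(hquot D) : E -> hquot D).
Proof. exact/continuousP. Qed.

Lemma hquot_continuous (T : topologicalType) (f : hquot D -> T) :
  continuous (fun x : E => f (\pi_(hquot D) x)) -> continuous f.
Proof. by move=> /continuousP cf; apply/continuousP => A /cf. Qed.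

Lemma repr_closed_gen (x : E) : repr (\pi_(hquot D) x) - x \in closed_gen D.
Proof. by apply/hquot_pi_eq; rewrite reprK. Qed.

Lemma subgroup_gen_sub (P : E -> Prop) : P 0 -> (forall x y, P x -> P y -> P (x - y)) ->
  D `<=` P -> forall x, x \in subgroup_gen D -> P x.
Proof.
move=> P0 PB DP x /asboolP /(_ (fun y => `[<P y>])) xP.
suff /asboolP : x \in (fun y => `[<P y>] : bool) by [].
apply: xP => [|y Dy]; last by apply/asboolP/DP.
split=> [|y z]; first exact/asboolP.
by move=> /asboolP Py /asboolP Pz; apply/asboolP/PB.
Qed.

Lemma closed_gen_sub x : D x -> x \in closed_gen D.
Proof.
move=> Dx; apply/asboolP; apply: subset_closure.
by apply/asboolP => P cP; apply.
Qed.

End HausdorffQuotientTheory.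

Section HausdorffQuotientMap.
Variables (E F : topologicalZmodType) (D : set E) (D' : set F) (f : E -> F).
Hypotheses (fD : {morph f : x y / x + y}) (fc : continuous f).
Hypothesis fgen : forall x, D x -> f x \in closed_gen D'.

Lemma closed_gen_map x : x \in closed_gen D -> f x \in closed_gen D'.
Proof.
move=> /asboolP cx; apply/asboolP.
rewrite (iffLR (closure_id _) (@closed_closure _ _)) => B /fc /cx[y [gy By]].
exists (f y); split=> //; suff /asboolP : f y \in closed_gen D' by [].
move: y gy {By}; apply: subgroup_gen_sub => [|y z fy fz|y] //.
- by rewrite (morph_add0 fD) rpred0.
- by rewrite (morph_addB fD) rpredB.
- exact: fgen.
Qed.

Definition hquot_map (q : hquot D) : hquot D' := \pi_(hquot D') (f (repr q)).

Lemma hquot_map_pi x : hquot_map (\pi_(hquot D) x) = \pi_(hquot D') (f x).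
Proof.
by apply/hquot_pi_eq; rewrite -(morph_addB fD); apply/closed_gen_map/repr_closed_gen.
Qed.

Lemma hquot_mapD : {morph hquot_map : x y / x + y}.
Proof.
move=> x y; rewrite -[x]reprK -[y]reprK -hquot_piD !hquot_map_pi fD.
exact: hquot_piD.
Qed.

Lemma hquot_map_continuous : continuous hquot_map.
Proof.
apply: hquot_continuous; have -> : (fun x => hquot_map (\pi_(hquot D) x)) =
    (\pi_(hquot D') : F -> hquot D') \o f by apply: funext => x; apply: hquot_map_pi.
move=> x; apply: continuous_comp; [exact: fc|exact: hquot_pi_continuous].
Qed.

End HausdorffQuotientMap.

(** f and g are inverse only modulo the closed subgroups, as is usual for maps between two
    presentations. *)
Lemma hquot_map_iso (E F : topologicalZmodType) (D : set E) (D' : set F)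
    (f : E -> F) (g : F -> E) :
  {morph f : x y / x + y} -> {morph g : x y / x + y} -> continuous f -> continuous g ->
  (forall x, D x -> f x \in closed_gen D') -> (forall y, D' y -> g y \in closed_gen D) ->
  (forall x, g (f x) - x \in closed_gen D) -> (forall y, f (g y) - y \in closed_gen D') ->
  is_topological_iso (@hquot_map E F D D' f).
Proof.
move=> fD gD fc gc fgen ggen gf fg; split.
- exact: hquot_mapD fD fc fgen.
- exact: hquot_map_continuous fD fc fgen.
exists (@hquot_map F E D' D g); split; last exact: hquot_map_continuous gD gc ggen.
  move=> q; rewrite -[q]reprK (hquot_map_pi fD fc fgen) (hquot_map_pi gD gc ggen).
  exact/hquot_pi_eq.
move=> q; rewrite -[q]reprK (hquot_map_pi gD gc ggen) (hquot_map_pi fD fc fgen).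
exact/hquot_pi_eq.
Qed.

(** * The associativity isomorphism on ghost groups *)

Lemma tpow_map_comp (R R1 R2 : comPzRingType) (M : lmodType R) (M1 : lmodType R1)
    (M2 : lmodType R2) (I : Type) (a : R -> R1) (b : R1 -> R2) (f : M -> M1)
    (g : M1 -> M2) (t : tpow M I) : ring_hom a -> ring_hom b -> semilin a f -> semilin b g ->
  tpow_map b g (tpow_map a f t) = tpow_map (b \o a) (g \o f) t.
Proof.
move=> ha hb hf hg; have hba := ring_hom_comp ha hb; have hgf := semilin_comp hf hg.
have h1 := semilin_compE (tpow_map_semilin I ha hf) (tpow_map_semilin I hb hg) (fun=> erefl).
apply: (tpow_ext h1 (tpow_map_semilin I hba hgf)) => m.
by rewrite !tpow_map_tens.
Qed.

Lemma tpow_map_square (R R1 R1' R2 : comPzRingType) (M : lmodType R) (M1 : lmodType R1)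
    (M1' : lmodType R1') (M2 : lmodType R2) (I : Type) (a : R -> R1) (b : R1 -> R2)
    (a' : R -> R1') (b' : R1' -> R2) (f : M -> M1) (g : M1 -> M2) (f' : M -> M1')
    (g' : M1' -> M2) (t : tpow M I) :
  ring_hom a -> ring_hom b -> ring_hom a' -> ring_hom b' ->
  semilin a f -> semilin b g -> semilin a' f' -> semilin b' g' ->
  (forall r, b (a r) = b' (a' r)) -> (forall m, g (f m) = g' (f' m)) ->
  tpow_map b g (tpow_map a f t) = tpow_map b' g' (tpow_map a' f' t).
Proof.
move=> ha hb ha' hb' hf hg hf' hg' ab fg; rewrite !tpow_map_comp //.
by have -> : b \o a = b' \o a' by [exact/funext]; have -> : g \o f = g' \o f' by exact/funext.
Qed.

Section GhostGroupMap.
Variables (G : profiniteGroupType) (K : set G) (S : set (set G)).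

Lemma ghost_group_map_comp (R R1 R2 : comPzRingType) (M : lmodType R) (M1 : lmodType R1)
    (M2 : lmodType R2) (a : R -> R1) (b : R1 -> R2) (f : M -> M1) (g : M1 -> M2)
    (x : ghost_group K S M) : ring_hom a -> ring_hom b -> semilin a f -> semilin b g ->
  ghost_group_map b g (ghost_group_map a f x) = ghost_group_map (b \o a) (g \o f) x.
Proof.
by move=> *; apply: functional_extensionality_dep => U; apply: tpow_map_comp.
Qed.

Lemma ghost_group_mapD (R R1 : comPzRingType) (M : lmodType R) (M1 : lmodType R1)
    (a : R -> R1) (f : M -> M1) : ring_hom a -> semilin a f ->
  {morph (ghost_group_map a f : ghost_group K S M -> ghost_group K S M1) : x y / x + y}.
Proof.
move=> ha hf x y; apply: functional_extensionality_dep => U.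
by have [tD _] := tpow_map_semilin (cosets K (val U)) ha hf; apply: tD.
Qed.

Lemma ghost_group_map_ext (R R1 : comPzRingType) (M : lmodType R) (M1 : lmodType R1)
    (a b : R -> R1) (f g : M -> M1) (x : ghost_group K S M) : a =1 b -> f =1 g ->
  ghost_group_map a f x = ghost_group_map b g x :> ghost_group K S M1.
Proof. by move=> /funext -> /funext ->. Qed.

Lemma ghost_group_map_id (R : comPzRingType) (M : lmodType R) (x : ghost_group K S M) :
  ghost_group_map id id x = x.
Proof.
apply: functional_extensionality_dep => U.
have h := tpow_map_semilin (cosets K (val U)) (ring_hom_id R) (semilin_id M).
apply: (tpow_ext h (semilin_id _)) => m.
by rewrite tpow_map_tens.
Qed.

Lemma ghost_group_map_continuous (R R1 : comPzRingType) (M : lmodType R) (M1 : lmodType R1)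
    (a : R -> R1) (f : M -> M1) :
  continuous (ghost_group_map a f : ghost_group K S M -> ghost_group K S M1).
Proof.
exact: (@dprod_map_continuous S (fun U => tpow M (cosets K (val U)))
  (fun U => tpow M1 (cosets K (val U))) (fun U => tpow_map a f)).
Qed.

End GhostGroupMap.

Section Assoc.
Variables (G : profiniteGroupType) (H : set G) (S : set (set G)) (sigma : set G -> G).
Hypotheses (oH : open_subgroup H) (hS : truncation_set H S).
Hypothesis hsigma : coset_reps setT H sigma.
Local Notation I := (cosets (G := G) setT H).

Lemma open_subgroupT : open_subgroup [set: G].
Proof. by split=> //; apply: openT. Qed.
Let oT := open_subgroupT.

Let HT : H `<=` setT. Proof. by []. Qed.

Local Notation join := (@coset_join G setT oT _ H (fun=> sigma) HT hsigma).

Section AssocAt.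
Variable U : set G.
Hypothesis SU : S U.
Let oU := trunc_open hS SU.
Let UH := trunc_sub hS SU.
Local Notation fst := (@coset_fst G setT U H oU oH UH).
Local Notation snd := (@coset_snd G setT U H (fun=> sigma) oU oH UH hsigma).

Let joinK k : join (fst k) (snd k) = k.
Proof. exact: coset_join_split. Qed.
Let fstK i j : fst (join i j) = i.
Proof. exact: coset_fst_join. Qed.
Let sndK i j : snd (join i j) = j.
Proof. exact: coset_snd_join. Qed.

Lemma tpow_assocE (R : comPzRingType) (M : lmodType R) :
  @tpow_assoc G setT H U sigma R M = tpow2 join.
Proof.
have E : (fun m : cosets setT U -> M => tens (fun C : cosets H U => tens (fun A : I =>
    oapp m 0 (insub (ltrans (sigma (val A)) (val C)))))) = tens2 join.
  apply: funext => m; congr tens; apply: funext => C; congr tens; apply: funext => B.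
  rewrite (insubT (fun A => A \in cosets setT U) (valP (join B C))) /=.
  by congr m; apply: val_inj.
by apply: funext => t; rewrite /tpow_assoc E.
Qed.

Lemma tpow_assoc_semilin (R : comPzRingType) (M : lmodType R) :
  semilin id (@tpow_assoc G setT H U sigma R M).
Proof. by rewrite tpow_assocE; apply: (tpow2_semilin M joinK fstK sndK). Qed.

Lemma tpow_assoc_tens (R : comPzRingType) (M : lmodType R) (m : cosets setT U -> M) :
  tpow_assoc H sigma (tens m) = tens (fun C => tens (fun B => m (join B C))).
Proof. by rewrite tpow_assocE (tpow2_tens joinK fstK sndK). Qed.

Lemma tpow_assoc_map (R R' : comPzRingType) (M : lmodType R) (M' : lmodType R')
    (a : R -> R') (f : M -> M') (t : tpow M (cosets setT U)) : ring_hom a -> semilin a f ->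
  tpow_assoc H sigma (tpow_map a f t) = tpow_map a (tpow_map a f) (tpow_assoc H sigma t).
Proof.
move=> ha hf; have hI := tpow_map_semilin I ha hf.
have h1 := semilin_compE (tpow_map_semilin _ ha hf) (tpow_assoc_semilin M') (fun=> erefl).
have h2 := semilin_compE (tpow_assoc_semilin M) (tpow_map_semilin _ ha hI) (fun=> erefl).
apply: (tpow_ext h1 h2) => m.
rewrite tpow_map_tens // !tpow_assoc_tens tpow_map_tens //.
by congr tens; apply: funext => C /=; rewrite tpow_map_tens.
Qed.

Lemma tpow_assoc_bij (T : comPzRingType) (Y : choiceType) :
  bijective (@tpow_assoc G setT H U sigma T (freemod T Y)).
Proof.
have fI := finite_cosetsE oH setT; have fJ := finite_cosetsE oU H.
rewrite tpow_assocE; exists (@tpow2_inv T Y _ _ _ fst snd).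
  exact: (tpow2K joinK fstK sndK fI fJ).
exact: (tpow2_invK joinK fstK sndK fI fJ).
Qed.

Lemma tpow_assoc_pure (R : comPzRingType) (M : lmodType R) (nu : G -> M) :
  (forall g u, U u -> nu (g * u)%g = nu g) ->
  tpow_assoc H sigma (pure setT U nu) =
  pure H U (fun a => tens (fun B : I => nu (sigma (val B) * a)%g)).
Proof.
move=> nuU; rewrite tpow_assoc_tens; congr tens; apply: funext => C.
congr tens; apply: funext => B.
have KJ := set_mem (valP (join B C)); have KC := set_mem (valP C).
(* The element chosen in the joined coset and sigma(B) times the one chosen in C differ by an
   element of U, under which nu is invariant. *)
have JB : val (join B C) (sigma (val B) * xget 1 (val C))%g.
  by apply/ltransP; rewrite mulKg; exact (cosets_xget oU KC).
have JU := cosets_div oU KJ JB (cosets_xget oU KJ).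
by rewrite -[RHS](nuU _ _ JU) mulVKg.
Qed.

End AssocAt.

Section AssocGhost.
Variables (R : comPzRingType) (M : lmodType R).

Definition ghost_assoc (x : ghost_group setT S M) : ghost_group H S (tpow M I) :=
  fun U => tpow_assoc H sigma (x U).

Lemma ghost_assocD : {morph ghost_assoc : x y / x + y}.
Proof.
move=> x y; apply: functional_extensionality_dep => U.
by have [tD _] := tpow_assoc_semilin (set_mem (valP U)) M; apply: tD.
Qed.

Lemma ghost_assoc_continuous : continuous ghost_assoc.
Proof.
exact: (@dprod_map_continuous S (fun U => tpow M (cosets setT (val U)))
  (fun U => tpow (tpow M I) (cosets H (val U))) (fun U t => tpow_assoc H sigma t)).
Qed.

Lemma ghost_assoc_family (X : choiceType) (act : G -> X -> X) (D : set X)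
    (nu : X -> G -> M) : is_family setT H S act D nu ->
  let mu x a := tens (fun B : I => nu x (sigma (val B) * a)%g) in
  is_family H H S act D mu /\
  ghost_assoc (fam_val setT act D nu) = fam_val H act D mu.
Proof.
move=> fD mu; have [a1 aM aD anu af] := fD; split.
  split=> // h x a Hh Dx Ha; congr tens; apply: funext => B.
  by rewrite anu // mulgA.
apply: functional_extensionality_dep => U; have SU := set_mem (valP U).
rewrite /ghost_assoc /fam_val !fsbig_finite ?(morph_add_sum (tpow_assoc_semilin SU M).1);
  [|exact: af|exact: af].
rewrite big_seq [RHS]big_seq; apply: eq_bigr => x.
rewrite in_fset_set; last exact: af.
move=> /set_mem Ux; apply: (tpow_assoc_pure SU) => g u Uu.
exact: (family_mul hS fD SU Ux).
Qed.

Lemma ghost_assoc_fam x : fam H 0 x -> fam H 0 (ghost_assoc x).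
Proof.
move=> [X [act [D [nu [fD _ ->]]]]]; have [fD' ->] := ghost_assoc_family fD.
by exists X, act, D; eexists; split; [exact: fD'| |].
Qed.

Lemma ghost_assoc_fam_diff x : fam_diff H 0 x -> fam_diff H 0 (ghost_assoc x).
Proof.
move=> [y [z [fy fz ->]]]; exists (ghost_assoc y), (ghost_assoc z).
by split; [exact: ghost_assoc_fam|exact: ghost_assoc_fam|rewrite (morph_addB ghost_assocD)].
Qed.

(** Each g is uniquely sigma(B) a with B = gH and a in H, so the factors of the mu x are the values
    of a single function nu x on G. *)
Lemma ghost_assoc_fam_pure (X : choiceType) (act : G -> X -> X) (D : set X)
    (mu : X -> G -> I -> M) : is_family H H S act D mu ->
  exists x, fam H 0 x /\ ghost_assoc x = fam_val H act D (fun x a => tens (mu x a)).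
Proof.
move=> [a1 aM aD amu af].
have KH g : cosets setT H (ltrans g H) by exists g.
pose cl g : I := SigSub (mem_set (KH g)).
pose nu x g := mu x ((sigma (ltrans g H))^-1 * g)%g (cl g).
have fnu : is_family setT H S act D nu.
  split=> // h x g Hh Dx _; rewrite /nu (amu h x) //.
    by rewrite (ltrans_mem oH) // mulgA; congr mu; apply: val_inj; rewrite /= (ltrans_mem oH).
  exact (cosets_div oH (KH g) (hsigma (KH g)) (ltrans_self oH g)).
exists (fam_val setT act D nu); split; first by exists X, act, D, nu.
have [_ ->] := ghost_assoc_family fnu; apply: (fam_val_ext oH _ hS) => // x a Dx Ha.
congr tens; apply: funext => B; have VB := set_mem (valP B).
have E : ltrans (sigma (val B) * a)%g H = val B.
  by rewrite (ltrans_mem oH) // -(cosets_eq oH VB (hsigma VB)).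
rewrite /nu E mulKg; congr mu; exact: val_inj.
Qed.

Lemma ghost_assoc_fam_lift y : fam H 0 y -> exists x, fam H 0 x /\ ghost_assoc x = y.
Proof.
(* [tpow_pure_sum] needs one factor to absorb scalars; the coset H itself serves. *)
have i0 : I := SigSub (mem_set (ex_intro2 _ _ 1%g (Logic.I : setT 1%g) (erefl (ltrans 1%g H)))).
move=> [X [act [D [mu [fD _ ->]]]]].
have [terms termsE] := choice (tpow_pure_sum i0 (M := M)).
have [X1 [act1 [D1 [mu1 [fD1 ->]]]]] := family_expand oH (@subset_refl _ H) hS
  (fun=> 0 : M) (fun t => esym (termsE t)) fD.
exact: ghost_assoc_fam_pure fD1.
Qed.

Lemma ghost_assoc_fam_diff_lift y : fam_diff H 0 y ->
  exists x, fam_diff H 0 x /\ ghost_assoc x = y.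
Proof.
move=> [y1 [y2 [/ghost_assoc_fam_lift[x1 [f1 <-]] /ghost_assoc_fam_lift[x2 [f2 <-]] ->]]].
by exists (x1 - x2); rewrite (morph_addB ghost_assocD); split=> //; exists x1, x2.
Qed.

(* An inverse of ghost_assoc if M is free. *)
Definition ghost_assoc_inv (y : ghost_group H S (tpow M I)) : ghost_group setT S M :=
  fun U => xget 0 [set t | tpow_assoc H sigma t = y U].

Lemma ghost_assoc_inv_continuous : continuous ghost_assoc_inv.
Proof.
exact: (@dprod_map_continuous S (fun U => tpow (tpow M I) (cosets H (val U)))
  (fun U => tpow M (cosets setT (val U)))
  (fun U y => xget 0 [set t | tpow_assoc H sigma t = y])).
Qed.

End AssocGhost.

Lemma ghost_assoc_map (R R' : comPzRingType) (M : lmodType R) (M' : lmodType R')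
    (a : R -> R') (f : M -> M') (x : ghost_group setT S M) : ring_hom a -> semilin a f ->
  ghost_assoc (ghost_group_map a f x) = ghost_group_map a (tpow_map a f) (ghost_assoc x).
Proof.
move=> ha hf; apply: functional_extensionality_dep => U.
exact: (tpow_assoc_map (set_mem (valP U))).
Qed.

Section AssocFree.
Variables (T : comPzRingType) (Y : choiceType).
Local Notation Q := (freemod T Y).

Lemma ghost_assocK : cancel (@ghost_assoc T Q) (@ghost_assoc_inv T Q).
Proof.
move=> x; apply: functional_extensionality_dep => U.
have [g gK _] := tpow_assoc_bij (set_mem (valP U)) T Y.
by apply: xget_unique => // t /(can_inj gK).
Qed.

Lemma ghost_assoc_invK : cancel (@ghost_assoc_inv T Q) (@ghost_assoc T Q).
Proof.
move=> y; apply: functional_extensionality_dep => U.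
have [g _ gK] := tpow_assoc_bij (set_mem (valP U)) T Y.
by apply: (@xgetPex _ 0 [set t | tpow_assoc H sigma t = y U]); exists (g (y U)); apply: gK.
Qed.

Lemma ghost_assoc_invD : {morph @ghost_assoc_inv T Q : x y / x + y}.
Proof.
move=> x y; apply: (can_inj ghost_assocK).
have E := congr2 +%R (ghost_assoc_invK x) (ghost_assoc_invK y).
exact: etrans (ghost_assoc_invK _) (etrans (esym E) (esym (ghost_assocD _ _))).
Qed.

Lemma ghost_assoc_inv_fam_diff y : fam_diff H 0 y -> fam_diff H 0 (@ghost_assoc_inv T Q y).
Proof. by move=> /ghost_assoc_fam_diff_lift[x [fx <-]]; rewrite ghost_assocK. Qed.

End AssocFree.

End Assoc.

Lemma morph_add_eqB (U V W : zmodType) (f : U -> W) (g : V -> W) x x' y y' :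
  {morph f : u v / u + v} -> {morph g : u v / u + v} ->
  f x = g x' -> f y = g y' -> f (x - y) = g (x' - y').
Proof. by move=> fD gD fx fy; rewrite (morph_addB fD) (morph_addB gD) fx fy. Qed.

(** * Lifting pairs of ghost vectors through the resolution *)

Section GhostPairs.
Variables (G : profiniteGroupType) (K H : set G) (S : set (set G)).
Variables (R : comPzRingType) (M : lmodType R).

Definition ghost_d0 : ghost_group K S (FU (FU M)) -> ghost_group K S (FU M) :=
  ghost_group_map (@eps_ring (Zpoly R)) (@eps_mod (Zpoly R) (FU M)).

Definition ghost_d1 : ghost_group K S (FU (FU M)) -> ghost_group K S (FU M) :=
  ghost_group_map (FU_ring (@eps_ring R)) (FU_mod (@eps_ring R) (@eps_mod R M)).

Lemma ghost_d0D : {morph ghost_d0 : x y / x + y}.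
Proof. exact: (ghost_group_mapD (eps_ring_hom _) (eps_mod_semilin _)). Qed.

Lemma ghost_d1D : {morph ghost_d1 : x y / x + y}.
Proof. exact: (ghost_group_mapD (FU_ring_hom _) (FU_mod_semilin _ _)). Qed.

Variables (T : comPzRingType) (P : lmodType T).

(** The lifts Z p are chosen one element at a time, with no additivity, and applied to the families
    that represent x. *)
Lemma fam_pair (a a' : T -> Zpoly R) (f f' : P -> FU M) (x : ghost_group K S P) :
  ring_hom a -> ring_hom a' -> semilin a f -> semilin a' f' ->
  (forall p, eps_mod (f p) = eps_mod (f' p)) -> fam_diff H 0 x ->
  exists z, [/\ fam_diff H 0 z, ghost_d0 z = ghost_group_map a f x &
                ghost_d1 z = ghost_group_map a' f' x].
Proof.
move=> ha ha' hf hf' ff'; have [Z ZP] := choice (fun p => eps_mod_pair (ff' p)).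
have one y : fam H 0 y -> exists z, [/\ fam H 0 z, ghost_d0 z = ghost_group_map a f y &
    ghost_d1 z = ghost_group_map a' f' y].
  move=> [X [act [D [mu [fD _ ->]]]]]; have fZ := family_comp Z fD.
  exists (fam_val K act D (fun x => Z \o mu x)); split.
  - by exists X, act, D, (fun x => Z \o mu x).
  - rewrite /ghost_d0 (fam_val_map (eps_ring_hom _) (eps_mod_semilin _) fZ) (fam_val_map ha hf fD).
    by congr fam_val; apply: funext => y'; apply: funext => b /=; have [-> _] := ZP (mu y' b).
  - rewrite /ghost_d1 (fam_val_map (FU_ring_hom _) (FU_mod_semilin _ _) fZ) (fam_val_map ha' hf' fD).
    by congr fam_val; apply: funext => y'; apply: funext => b /=; have [_ ->] := ZP (mu y' b).
move=> [y1 [y2 [/one[z1 [fz1 a1 b1]] /one[z2 [fz2 a2 b2]] ->]]].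
exists (z1 - z2); split; first by exists z1, z2.
  exact: (morph_add_eqB ghost_d0D (ghost_group_mapD ha hf) a1 a2).
exact: (morph_add_eqB ghost_d1D (ghost_group_mapD ha' hf') b1 b2).
Qed.

End GhostPairs.

Section GhostAssocPairs.
Variables (G : profiniteGroupType) (H : set G) (S : set (set G)) (sigma : set G -> G).
Hypotheses (oH : open_subgroup H) (hS : truncation_set H S).
Hypothesis hsigma : coset_reps setT H sigma.
Local Notation I := (cosets (G := G) setT H).
Local Notation assoc := (@ghost_assoc G H S sigma _ _).
Variables (R : comPzRingType) (M : lmodType R).
Variables (T : comPzRingType) (P : lmodType T).

Local Notation ebar := (tpow_map (@eps_ring R) (@eps_mod R M) : tpow (FU M) I -> tpow M I).

(** As in [fam_pair], but the lifts Z p lie in the tensor power of FU (FU M); expanding the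
    resulting family into pure tensors makes it come from a family over G. *)
Lemma fam_pair_assoc (a a' : T -> Zpoly R) (f f' : P -> tpow (FU M) I)
    (x : ghost_group H S P) :
  ring_hom a -> ring_hom a' -> semilin a f -> semilin a' f' ->
  (forall p, ebar (f p) = ebar (f' p)) -> fam_diff H 0 x ->
  exists z : ghost_group setT S (FU (FU M)),
    [/\ fam_diff H 0 z, assoc (ghost_d0 z) = ghost_group_map a f x &
        assoc (ghost_d1 z) = ghost_group_map a' f' x].
Proof.
move=> ha ha' hf hf' ff'; have fI := finite_cosetsE oH setT.
have [Z ZP] := choice (fun p => FU_tpow_pair fI (ff' p)).
have hd0 := tpow_map_semilin I (eps_ring_hom _) (@eps_mod_semilin _ (FU M)).
have hd1 := tpow_map_semilin I (FU_ring_hom _) (FU_mod_semilin (@eps_ring R) (@eps_mod R M)).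
have one y : fam H 0 y -> exists z : ghost_group setT S (FU (FU M)),
    [/\ fam H 0 z, assoc (ghost_d0 z) = ghost_group_map a f y &
        assoc (ghost_d1 z) = ghost_group_map a' f' y].
  move=> [X [act [D [mu [fD _ ->]]]]]; have fZ := family_comp Z fD.
  have [z [fz zE]] : exists z : ghost_group setT S (FU (FU M)), fam H 0 z /\
      assoc z = fam_val H act D (fun x => Z \o mu x).
    by apply: (ghost_assoc_fam_lift oH hS hsigma); exists X, act, D, (fun x => Z \o mu x).
  exists z; split=> //.
  - rewrite /ghost_d0 (ghost_assoc_map oH hS hsigma _ (eps_ring_hom _) (eps_mod_semilin _)) zE.
    rewrite (fam_val_map (eps_ring_hom _) hd0 fZ) (fam_val_map ha hf fD).
    by apply: (fam_val_ext oH _ hS) => // y' b _ _; exact: (ZP (mu y' b)).1.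
  - rewrite /ghost_d1 (ghost_assoc_map oH hS hsigma _ (FU_ring_hom _) (FU_mod_semilin _ _)) zE.
    rewrite (fam_val_map (FU_ring_hom _) hd1 fZ) (fam_val_map ha' hf' fD).
    by apply: (fam_val_ext oH _ hS) => // y' b _ _; exact: (ZP (mu y' b)).2.
have aD (d : ghost_group setT S (FU (FU M)) -> ghost_group setT S (FU M)) :
    {morph d : u v / u + v} -> {morph (fun z => assoc (d z)) : u v / u + v}.
  by move=> dD u v; exact: etrans (congr1 _ (dD u v)) (ghost_assocD oH hS hsigma _ _).
move=> [y1 [y2 [/one[z1 [fz1 a1 b1]] /one[z2 [fz2 a2 b2]] ->]]].
exists (z1 - z2); split; first by exists z1, z2.
  exact: (morph_add_eqB (aD _ (@ghost_d0D _ _ _ _ _)) (ghost_group_mapD ha hf) a1 a2).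
exact: (morph_add_eqB (aD _ (@ghost_d1D _ _ _ _ _)) (ghost_group_mapD ha' hf') b1 b2).
Qed.

End GhostAssocPairs.

(* The two maps commute with the counits to tpow M I, which is all that is needed:
   they are not inverse to each other, and FU_to_tpow depends on a choice. *)
Section FreeTensorCover.
Variables (I : choiceType) (R : comPzRingType) (M : lmodType R).
Hypothesis fI : finite_set [set: I].
Local Notation ebar := (tpow_map (@eps_ring R) (@eps_mod R M) : tpow (FU M) I -> tpow M I).

Definition tpow_to_FU : tpow (FU M) I -> FU (tpow M I) :=
  @free_tens (Zpoly R) M I (FU (tpow M I)) (fun y => fm_gen (Zpoly R) (tens y)).

Definition FU_to_tpow : FU (tpow M I) -> tpow (FU M) I :=
  fm_lift id (fun t => xget 0 [set q | ebar q = t]).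

Lemma tpow_to_FU_semilin : semilin id tpow_to_FU.
Proof. exact: free_tens_semilin. Qed.

Lemma FU_to_tpow_semilin : semilin id FU_to_tpow.
Proof. exact: (fm_lift_semilin _ (ring_hom_id _)). Qed.

Let ebar_semilin : semilin (@eps_ring R) ebar.
Proof. exact: (tpow_map_semilin I (eps_ring_hom R) (@eps_mod_semilin R M)). Qed.

Lemma eps_tpow_to_FU q : eps_mod (tpow_to_FU q) = ebar q.
Proof.
move: q; have h := semilin_compE tpow_to_FU_semilin (@eps_mod_semilin R (tpow M I)) (fun=> erefl).
apply: (tpow_span_ext (@freemod_spans (Zpoly R) M) fI (eps_ring_hom R) h ebar_semilin) => y.
have -> : tpow_to_FU (tens (fun i => fm_gen (Zpoly R) (y i))) = fm_gen (Zpoly R) (tens y).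
  exact: free_tens_gen.
rewrite eps_mod_gen [RHS](tpow_map_tens (eps_ring_hom R) (@eps_mod_semilin R M)).
by congr tens; apply: funext => i; rewrite /= eps_mod_gen.
Qed.

Lemma eps_FU_to_tpow q : ebar (FU_to_tpow q) = eps_mod q.
Proof.
move: q; have h := semilin_compE FU_to_tpow_semilin ebar_semilin (fun=> erefl).
apply: (freemod_ext h (@eps_mod_semilin R (tpow M I))) => t; rewrite eps_mod_gen.
rewrite /FU_to_tpow (fm_lift_gen _ (ring_hom_id _)).
apply: (@xgetPex _ 0 [set q | ebar q = t]); have [s ->] := tpow_span t.
(* Coefficients are lifted to variables and factors to generators. *)
exists (\sum_(c <- s) Zpoly_var c.1 *: tens (fun i => fm_gen (Zpoly R) (c.2 i))).
rewrite /= (semilin_sum _ _ _ ebar_semilin); apply: eq_bigr => c _.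
rewrite eps_ring_var (tpow_map_tens (eps_ring_hom R) (@eps_mod_semilin R M)).
by congr (_ *: tens _); apply: funext => i; rewrite /= eps_mod_gen.
Qed.

End FreeTensorCover.

(** * The isomorphism of Witt vectors *)

Section TsubVal.
Variables (E : topologicalZmodType) (P : zmodClosed E).
Implicit Types x y : tsub P.

Lemma tsub_valD x y : val (x + y) = val x + val y.
Proof. exact: raddfD. Qed.

Lemma tsub_valB x y : val (x - y) = val x - val y.
Proof. exact: raddfB. Qed.

End TsubVal.

Lemma tsub_ind (E : topologicalZmodType) (P : zmodClosed E) (Pr : E -> Prop) :
  (forall y, y \in P -> Pr y) -> forall x : tsub P, Pr (val x).
Proof. by move=> h x; apply/h/valP. Qed.

Section WittFree.
Variables (G : profiniteGroupType) (K H : set G) (S S0 : set (set G)).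
Variable rep : set G -> set G -> G.
Hypotheses (oK : open_subgroup K) (oH : open_subgroup H) (HK : H `<=` K).
Hypotheses (hS : truncation_set H S) (hS0 : conj_transversal H S S0).
Hypothesis hrep : forall V, S0 V -> coset_reps K V (rep V).
Local Notation W Q := (witt_free K H S S0 rep Q).

Section OneModule.
Variables (T : comPzRingType) (Q : lmodType T).
Hypothesis hQ : has_powers Q.

Lemma has_powers_witt_free (x : W Q) : fam_diff H 0 (val x : ghost_group K S Q).
Proof.
move: x; rewrite /witt_free; apply: tsub_ind => y.
exact: (iffLR (witt_freeP oK oH HK hS hS0 hrep hQ y)).
Qed.

Lemma has_powers_insubd (x : ghost_group K S Q) : fam_diff H 0 x ->
  val (insubd (0 : W Q) x) = x.
Proof. by move=> fx; apply: insubdK; exact: (iffRL (witt_freeP oK oH HK hS hS0 hrep hQ _) fx). Qed.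

End OneModule.

Lemma witt_free_fam (R : comPzRingType) (M : lmodType R) (x : W (FU M)) :
  fam_diff H 0 (val x : ghost_group K S (FU M)).
Proof. exact (has_powers_witt_free (@FU_has_powers R M) x). Qed.

Lemma witt_free_insub (R : comPzRingType) (M : lmodType R) (x : ghost_group K S (FU M)) :
  fam_diff H 0 x -> val (insubd (0 : W (FU M)) x) = x.
Proof. exact (@has_powers_insubd _ _ (@FU_has_powers R M) x). Qed.

Section TwoModules.
Variables (R R' : comPzRingType) (M : lmodType R) (M' : lmodType R').

Lemma val_witt_free_map (a : Zpoly R -> Zpoly R') (f : FU M -> FU M') (x : W (FU M)) :
  ring_hom a -> semilin a f ->
  val (witt_free_map a f x : W (FU M')) = ghost_group_map a f (val x).
Proof. by move=> ha hf; apply/witt_free_insub/fam_diff_map/witt_free_fam. Qed.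

End TwoModules.

Section Differences.
Variables (R : comPzRingType) (M : lmodType R).
Local Notation D := (@witt_differences G K H S S0 rep R M).

Lemma val_witt_difference (z : W (FU (FU M))) :
  val (witt_free_map (@eps_ring (Zpoly R)) (@eps_mod (Zpoly R) (FU M)) z
    - witt_free_map (FU_ring (@eps_ring R)) (FU_mod (@eps_ring R) (@eps_mod R M)) z : W (FU M))
  = ghost_d0 (val z) - ghost_d1 (val z).
Proof.
have v0 := val_witt_free_map z (eps_ring_hom _) (@eps_mod_semilin _ (FU M)).
have v1 := val_witt_free_map z (FU_ring_hom _) (FU_mod_semilin (@eps_ring R) (@eps_mod R M)).
exact: etrans (tsub_valB _ _) (congr2 (fun u v => u - v) v0 v1).
Qed.

Lemma witt_differencesP (x : W (FU M)) :
  D x <-> exists z, fam_diff H 0 z /\ val x = ghost_d0 z - ghost_d1 z.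
Proof.
split=> [[z _ <-]|[z [fz xz]]].
  by exists (val z); split; [exact: witt_free_fam|exact: val_witt_difference].
exists (insubd 0 z) => //; apply: val_inj.
by rewrite val_witt_difference witt_free_insub.
Qed.

(** The principle behind the comparisons in W: semilinear maps that agree after the counit induce
    the same map into the quotient. *)
Lemma witt_differences_pair (T : comPzRingType) (P : lmodType T) (a a' : T -> Zpoly R)
    (f f' : P -> FU M) (y : ghost_group K S P) (x : W (FU M)) :
  ring_hom a -> ring_hom a' -> semilin a f -> semilin a' f' ->
  (forall p, eps_mod (f p) = eps_mod (f' p)) -> fam_diff H 0 y ->
  val x = ghost_group_map a f y - ghost_group_map a' f' y -> x \in closed_gen D.
Proof.
move=> ha ha' hf hf' ff' fy xE; apply/closed_gen_sub/witt_differencesP.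
have [z [fz z0 z1]] := fam_pair ha ha' hf hf' ff' fy.
by exists z; rewrite z0 z1.
Qed.

End Differences.

Section WittMap.
Variables (R R' : comPzRingType) (M : lmodType R) (M' : lmodType R').
Variables (a : R -> R') (f : M -> M').
Hypotheses (ha : ring_hom a) (hf : semilin a f).
Local Notation F := (witt_free_map (FU_ring a) (FU_mod a f) : W (FU M) -> W (FU M')).

Let hF := FU_mod_semilin a f.
Let hFr := FU_ring_hom a.

Lemma witt_free_mapD : {morph F : x y / x + y}.
Proof.
move=> x y; apply: val_inj; rewrite val_witt_free_map //.
have fD := ghost_group_mapD (K := K) (S := S) hFr hF.
apply: etrans (fD (val x) (val y)) _; apply: esym.
by apply: etrans (tsub_valD _ _) _; congr (_ + _); apply: val_witt_free_map.
Qed.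

Lemma witt_free_map_continuous : continuous F.
Proof.
apply: (tsub_continuous (@ghost_group_map_continuous G K S _ _ _ _ (FU_ring a) (FU_mod a f))).
by move=> x; apply: val_witt_free_map.
Qed.

(** The composites with the two face maps agree after the counit, by its naturality. *)
Lemma witt_free_map_differences (x : W (FU M)) :
  witt_differences x -> F x \in closed_gen (@witt_differences G K H S S0 rep R' M').
Proof.
move=> /witt_differencesP[z [fz xz]].
have h0 := @eps_mod_semilin _ (FU M); have h1 := FU_mod_semilin (@eps_ring R) (@eps_mod R M).
have r0 := eps_ring_hom (Zpoly R); have r1 := FU_ring_hom (@eps_ring R).
have c0 := semilin_comp h0 hF; have c1 := semilin_comp h1 hF.
apply: (witt_differences_pair (ring_hom_comp r0 hFr) (ring_hom_comp r1 hFr) c0 c1 _ fz).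
  move=> p /=; have E q := eps_mod_natural q ha hf.
  apply: etrans (E _) _; apply: etrans (esym (E _)); congr f.
  by apply: esym; apply: eps_mod_natural; [exact: eps_ring_hom|exact: eps_mod_semilin].
rewrite val_witt_free_map // xz (morph_addB (ghost_group_mapD hFr hF)).
by congr (_ - _); apply: ghost_group_map_comp.
Qed.

Lemma witt_map_pi (x : W (FU M)) : witt_map a f (\pi_(hquot (@witt_differences _ _ _ _ _ _ _ _)) x) =
  \pi_(hquot (@witt_differences _ _ _ _ _ _ _ _)) (F x).
Proof.
exact: (hquot_map_pi witt_free_mapD witt_free_map_continuous witt_free_map_differences).
Qed.

End WittMap.

Section WittGhost.
Variables (R : comPzRingType) (M : lmodType R).
Local Notation D := (@witt_differences G K H S S0 rep R M).
Local Notation ghost_eps := (ghost_group_map (@eps_ring R) (@eps_mod R M)).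

(** The coordinate at U is discrete, so an element of the closure agrees at U with one of the
    subgroup itself, and the counit kills the differences. *)
Lemma ghost_eps_closed_gen (x : W (FU M)) : x \in closed_gen D ->
  ghost_eps (val x) = 0 :> ghost_group K S M.
Proof.
have gD := ghost_group_mapD (K := K) (S := S) (eps_ring_hom R) (@eps_mod_semilin R M).
move=> /asboolP cx; apply: functional_extensionality_dep => U.
have nU : nbhs x [set y : W (FU M) | (val y : ghost_group K S (FU M)) U = (val x : ghost_group K S (FU M)) U].
  exact: (@initial_continuous _ _ _ x _ (dprod_nbhs_coord (val x) U)).
have [y [gy /= yU]] := cx _ nU.
apply: etrans (congr1 (tpow_map _ _) (esym yU)) _.
suff /(congr1 (fun g : ghost_group K S M => g U)) : ghost_eps (val y) = 0 :> ghost_group K S M by [].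
move: y gy {yU}; apply: subgroup_gen_sub => [|y z y0 z0|y /witt_differencesP[z [_ ->]]].
- exact: (morph_add0 gD).
- have vB : val (y - z) = val y - val z :> ghost_group K S (FU M) by exact: tsub_valB.
  by rewrite vB (morph_addB gD) y0 z0 subrr.
have h0 := @eps_mod_semilin _ (FU M); have h1 := FU_mod_semilin (@eps_ring R) (@eps_mod R M).
have r0 := eps_ring_hom (Zpoly R); have r1 := FU_ring_hom (@eps_ring R).
have he := @eps_mod_semilin R M; have re := eps_ring_hom R.
rewrite (morph_addB gD) /ghost_d0 /ghost_d1; apply/eqP; rewrite subr_eq0; apply/eqP.
apply: etrans (ghost_group_map_comp _ r0 re h0 he) _.
apply: etrans _ (esym (ghost_group_map_comp _ r1 re h1 he)).
apply: ghost_group_map_ext => q; apply: esym.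
  exact: eps_ring_natural.
exact: eps_mod_natural.
Qed.

Lemma witt_ghost_pi (x : W (FU M)) :
  witt_ghost (\pi_(hquot D) x) = ghost_eps (val x) :> ghost_group K S M.
Proof.
have gD := ghost_group_mapD (K := K) (S := S) (eps_ring_hom R) (@eps_mod_semilin R M).
have := ghost_eps_closed_gen (repr_closed_gen D x).
set y := repr _; have vB : val (y - x) = val y - val x :> ghost_group K S (FU M) by exact: tsub_valB.
by rewrite vB (morph_addB gD) => /eqP; rewrite subr_eq0 => /eqP.
Qed.

End WittGhost.

End WittFree.

Lemma congrB (V : zmodType) (x x' y y' : V) : x = x' -> y = y' -> x - y = x' - y'.
Proof. by move=> -> ->. Qed.

(** * Comparison of the two presentations *)

Section WittAssoc.
Variables (G : profiniteGroupType) (H : set G) (S : set (set G)).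
Hypotheses (oH : open_subgroup H) (hS : truncation_set H S).
Variables (S1 : set (set G)) (rep1 : set G -> set G -> G).
Hypothesis hS1 : conj_transversal H S S1.
Hypothesis hrep1 : forall V, S1 V -> coset_reps setT V (rep1 V).
Variables (S2 : set (set G)) (rep2 : set G -> set G -> G).
Hypothesis hS2 : conj_transversal H S S2.
Hypothesis hrep2 : forall V, S2 V -> coset_reps H V (rep2 V).
Variable sigma : set G -> G.
Hypothesis hsigma : coset_reps setT H sigma.

Local Notation I := (cosets (G := G) setT H).
Local Notation W1 Q := (witt_free setT H S S1 rep1 Q).
Local Notation W2 Q := (witt_free H H S S2 rep2 Q).
Local Notation assoc := (@ghost_assoc G H S sigma _ _).
Local Notation assoc_inv := (@ghost_assoc_inv G H S sigma _ _).

Let oT := open_subgroupT G.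
Let HT : H `<=` setT. Proof. by []. Qed.
Let HH : H `<=` H. Proof. by []. Qed.
Let fI := finite_cosetsE oH setT.

Section OneModule.
Variables (R : comPzRingType) (M : lmodType R).
Local Notation beta := (@tpow_to_FU I R M).
Local Notation alpha := (@FU_to_tpow I R M).
Local Notation D1 := (@witt_differences G setT H S S1 rep1 R M).
Local Notation D2 := (@witt_differences G H H S S2 rep2 R (tpow M I)).

Let hbeta : semilin id beta. Proof. exact: tpow_to_FU_semilin. Qed.
Let halpha : semilin id alpha. Proof. exact: FU_to_tpow_semilin. Qed.
Let hid := ring_hom_id (Zpoly R).

Definition ghost_to (x : ghost_group setT S (FU M)) : ghost_group H S (FU (tpow M I)) :=
  ghost_group_map id beta (assoc x).

Definition ghost_from (y : ghost_group H S (FU (tpow M I))) : ghost_group setT S (FU M) :=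
  assoc_inv (ghost_group_map id alpha y : ghost_group H S (tpow (FU M) I)).

Definition witt_to (x : W1 (FU M)) : W2 (FU (tpow M I)) := insubd 0 (ghost_to (val x)).

Definition witt_from (y : W2 (FU (tpow M I))) : W1 (FU M) := insubd 0 (ghost_from (val y)).

Lemma ghost_assoc_FU_inj : injective (@ghost_assoc G H S sigma (Zpoly R) (FU M)).
Proof.
have K := @ghost_assocK G H S sigma oH hS hsigma (Zpoly R) M.
exact (can_inj K).
Qed.

Let assocB := morph_addB (@ghost_assocD G H S sigma oH hS hsigma (Zpoly R) (FU M)).

Lemma ghost_toD : {morph ghost_to : x y / x + y}.
Proof.
move=> x y; apply: etrans (congr1 _ (ghost_assocD oH hS hsigma x y)) _.
exact: ghost_group_mapD.
Qed.

Lemma ghost_fromD : {morph ghost_from : x y / x + y}.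
Proof.
move=> x y; apply: etrans (congr1 _ (ghost_group_mapD hid halpha x y)) _.
exact: (ghost_assoc_invD oH hS hsigma).
Qed.

Lemma ghost_from_assoc y :
  assoc (ghost_from y) = ghost_group_map id alpha y :> ghost_group H S (tpow (FU M) I).
Proof. exact: (ghost_assoc_invK oH hS hsigma). Qed.

Lemma val_witt_to x : val (witt_to x) = ghost_to (val x).
Proof.
apply: (witt_free_insub oH oH HH hS hS2 hrep2).
apply/(fam_diff_map hid hbeta)/(ghost_assoc_fam_diff oH hS hsigma).
exact: (witt_free_fam oT oH HT hS hS1 hrep1).
Qed.

Lemma val_witt_from y : val (witt_from y) = ghost_from (val y).
Proof.
apply: (witt_free_insub oT oH HT hS hS1 hrep1).
apply/(ghost_assoc_inv_fam_diff oH hS hsigma)/(fam_diff_map hid halpha).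
exact: (witt_free_fam oH oH HH hS hS2 hrep2).
Qed.

Lemma witt_toD : {morph witt_to : x y / x + y}.
Proof.
move=> x y; apply: val_inj; apply: etrans (val_witt_to _) _.
apply: etrans (ghost_toD (val x) (val y)) _; apply: esym.
by apply: etrans (tsub_valD _ _) _; congr (_ + _); apply: val_witt_to.
Qed.

Lemma witt_fromD : {morph witt_from : x y / x + y}.
Proof.
move=> x y; apply: val_inj; apply: etrans (val_witt_from _) _.
apply: etrans (ghost_fromD (val x) (val y)) _; apply: esym.
by apply: etrans (tsub_valD _ _) _; congr (_ + _); apply: val_witt_from.
Qed.

Lemma witt_to_continuous : continuous witt_to.
Proof.
apply: (tsub_continuous (F := ghost_to)) val_witt_to => x.
apply: (@continuous_comp _ _ _ (@ghost_assoc G H S sigma (Zpoly R) (FU M)) (ghost_group_map id beta)).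
  exact: ghost_assoc_continuous.
exact: ghost_group_map_continuous.
Qed.

Lemma witt_from_continuous : continuous witt_from.
Proof.
apply: (tsub_continuous (F := ghost_from)) val_witt_from => x.
apply: (@continuous_comp _ _ _ (ghost_group_map id alpha) (@ghost_assoc_inv G H S sigma (Zpoly R) (FU M))).
  exact: ghost_group_map_continuous.
exact: ghost_assoc_inv_continuous.
Qed.

Let h0 : semilin (@eps_ring (Zpoly R)) (@eps_mod (Zpoly R) (FU M)).
Proof. exact: eps_mod_semilin. Qed.
Let h1 : semilin (FU_ring (@eps_ring R)) (FU_mod (@eps_ring R) (@eps_mod R M)).
Proof. exact: FU_mod_semilin. Qed.
Let r0 := eps_ring_hom (Zpoly R).
Let r1 := FU_ring_hom (@eps_ring R).
Let re := eps_ring_hom R.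
Let he := @eps_mod_semilin R M.

(** On the tensor power of FU (FU M), beta composed with the tensor powers of the two face maps
    gives maps that agree after the counit. *)
Lemma witt_to_differences x : D1 x -> witt_to x \in closed_gen D2.
Proof.
move=> /(witt_differencesP oT oH HT hS hS1 hrep1)[z [fz xz]].
have k0 := tpow_map_semilin I r0 h0; have k1 := tpow_map_semilin I r1 h1.
have c0 := semilin_comp k0 hbeta; have c1 := semilin_comp k1 hbeta.
have fz' := ghost_assoc_fam_diff oH hS hsigma fz.
apply: (witt_differences_pair oH oH HH hS hS2 hrep2 r0 r1 c0 c1 _ fz').
  move=> t; apply: etrans (eps_tpow_to_FU fI _) _; apply: etrans _ (esym (eps_tpow_to_FU fI _)).
  apply: (tpow_map_square _ r0 re r1 re h0 he h1 he) => q; apply: esym.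
    exact: eps_ring_natural.
  exact: eps_mod_natural.
apply: etrans (val_witt_to x) _; rewrite xz; apply: etrans (morph_addB ghost_toD _ _) _.
apply: congrB.
  apply: etrans (congr1 _ (ghost_assoc_map oH hS hsigma z r0 h0)) _.
  exact: (ghost_group_map_comp _ r0 hid k0 hbeta).
apply: etrans (congr1 _ (ghost_assoc_map oH hS hsigma z r1 h1)) _.
exact: (ghost_group_map_comp _ r1 hid k1 hbeta).
Qed.

(** The maps alpha d0 and alpha d1 agree after the counit to [tpow M I]; since they land in a tensor
    power, the lift comes from [fam_pair_assoc]. *)
Lemma witt_from_differences y : D2 y -> witt_from y \in closed_gen D1.
Proof.
move=> /(witt_differencesP oH oH HH hS hS2 hrep2)[z [fz yz]].
have k0 := @eps_mod_semilin _ (FU (tpow M I)).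
have k1 := FU_mod_semilin (@eps_ring R) (@eps_mod R (tpow M I)).
have c0 := semilin_comp k0 halpha; have c1 := semilin_comp k1 halpha.
have [p|w [fw w0 w1]] := fam_pair_assoc oH hS hsigma r0 r1 c0 c1 _ fz.
  apply: etrans (eps_FU_to_tpow _) _; apply: etrans _ (esym (eps_FU_to_tpow _)).
  by apply: esym; apply: eps_mod_natural; [|exact: eps_mod_semilin].
apply/closed_gen_sub/(witt_differencesP oT oH HT hS hS1 hrep1); exists w; split=> //.
apply: etrans (val_witt_from y) _; apply: ghost_assoc_FU_inj.
apply: etrans (ghost_from_assoc _) _; rewrite yz.
apply: etrans (morph_addB (ghost_group_mapD hid halpha) _ _) _.
apply: etrans _ (esym (etrans (assocB _ _) (congrB w0 w1))).
exact: (congrB (ghost_group_map_comp _ r0 hid k0 halpha) (ghost_group_map_comp _ r1 hid k1 halpha)).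
Qed.

(** alpha beta and the identity of the tensor power of FU M agree after the counit;
    [ghost_assoc_FU_inj] transports the resulting equation back to G. *)
Lemma witt_toK x : witt_from (witt_to x) - x \in closed_gen D1.
Proof.
have fx := ghost_assoc_fam_diff oH hS hsigma (witt_free_fam oT oH HT hS hS1 hrep1 x).
have c0 := semilin_comp hbeta halpha.
have [p|w [fw w0 w1]] := fam_pair_assoc oH hS hsigma hid hid c0 (semilin_id _) _ fx.
  exact: etrans (eps_FU_to_tpow _) (eps_tpow_to_FU fI _).
apply/closed_gen_sub/(witt_differencesP oT oH HT hS hS1 hrep1); exists w; split=> //.
apply: etrans (tsub_valB _ _) _; rewrite val_witt_from val_witt_to.
apply: ghost_assoc_FU_inj; apply: etrans (assocB _ _) _.
apply: etrans _ (esym (etrans (assocB _ _) (congrB w0 w1))).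
apply: congrB; last by rewrite ghost_group_map_id.
exact: etrans (ghost_from_assoc _) (ghost_group_map_comp _ hid hid hbeta halpha).
Qed.

Lemma witt_fromK y : witt_to (witt_from y) - y \in closed_gen D2.
Proof.
have fy := witt_free_fam oH oH HH hS hS2 hrep2 y.
have c0 := semilin_comp halpha hbeta.
apply: (witt_differences_pair oH oH HH hS hS2 hrep2 hid hid c0 (semilin_id _) _ fy).
  by move=> p; apply: etrans (eps_tpow_to_FU fI _) (eps_FU_to_tpow _).
apply: etrans (tsub_valB _ _) _; apply: congrB; last by rewrite ghost_group_map_id.
apply: etrans (val_witt_to _) _; rewrite val_witt_from /ghost_to ghost_from_assoc.
exact: (ghost_group_map_comp _ hid hid halpha hbeta).
Qed.

Definition witt_assoc : witt setT H S S1 rep1 M -> witt H H S S2 rep2 (tpow M I) :=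
  @hquot_map _ _ D1 D2 witt_to.

Lemma witt_assoc_pi x : witt_assoc (\pi_(hquot D1) x) = \pi_(hquot D2) (witt_to x).
Proof. exact: (hquot_map_pi witt_toD witt_to_continuous witt_to_differences). Qed.

Lemma witt_assoc_iso : is_topological_iso witt_assoc.
Proof.
exact: (hquot_map_iso witt_toD witt_fromD witt_to_continuous witt_from_continuous
  witt_to_differences witt_from_differences witt_toK witt_fromK).
Qed.

(** Both ghost maps are induced by counits, and the counit after beta is the tensor power of the
    counit of M. *)
Lemma witt_assoc_ghost q U : witt_ghost (witt_assoc q) U = tpow_assoc H sigma (witt_ghost q U).
Proof.
rewrite -[q]reprK witt_assoc_pi (witt_ghost_pi oT oH HT hS hS1 hrep1).
rewrite (witt_ghost_pi oH oH HH hS hS2 hrep2) val_witt_to.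
pose x : ghost_group setT S (FU M) := val (repr q); have := ghost_assoc_map oH hS hsigma x re he.
move=> /(congr1 (fun g : ghost_group H S (tpow M I) => g U)) /= => E; apply: etrans _ (esym E).
have E2 := ghost_group_map_comp (assoc x) hid re hbeta (@eps_mod_semilin R (tpow M I)).
rewrite /ghost_to E2; apply: (congr1 (fun g : ghost_group H S (tpow M I) => g U)).
by apply: ghost_group_map_ext => // t; apply: (eps_tpow_to_FU fI).
Qed.

End OneModule.

(** The square of beta with FU of (a, f) need not commute, but its two composites agree after the
    counit. *)
Lemma witt_assoc_natural (R R' : comPzRingType) (M : lmodType R) (M' : lmodType R')
    (a : R -> R') (f : M -> M') q : ring_hom a -> semilin a f ->
  witt_assoc (witt_map a f q) = witt_map a (tpow_map a f) (witt_assoc q).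
Proof.
move=> ha hf; have hT := tpow_map_semilin I ha hf.
rewrite -[q]reprK (witt_map_pi oT oH HT hS hS1 hrep1 ha hf) !witt_assoc_pi.
rewrite (witt_map_pi oH oH HH hS hS2 hrep2 ha hT); apply/hquot_pi_eq.
set x := repr _; have fx := ghost_assoc_fam_diff oH hS hsigma (witt_free_fam oT oH HT hS hS1 hrep1 x).
have hFr := FU_ring_hom a; have hF := FU_mod_semilin a f; have hFT := FU_mod_semilin a (tpow_map a f : tpow M I -> tpow M' I).
have hb := tpow_to_FU_semilin M fI; have hb' := tpow_to_FU_semilin M' fI.
have kF := tpow_map_semilin I hFr hF.
have c0 := semilin_comp kF hb'; have c1 := semilin_comp hb hFT.
apply: (witt_differences_pair oH oH HH hS hS2 hrep2 hFr hFr c0 c1 _ fx).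
  move=> t; apply: etrans (eps_tpow_to_FU fI _) _.
  apply: etrans _ (esym (eps_mod_natural _ ha hT)).
  rewrite (eps_tpow_to_FU fI).
  apply: (tpow_map_square _ hFr (eps_ring_hom R') (eps_ring_hom R) ha hF
    (@eps_mod_semilin R' M') (@eps_mod_semilin R M) hf) => r.
    exact: eps_ring_natural.
  exact: eps_mod_natural.
apply: etrans (tsub_valB _ _) _; apply: congrB.
  apply: etrans (val_witt_to _) _; rewrite (val_witt_free_map oT oH HT hS hS1 hrep1 x hFr hF).
  apply: etrans (congr1 _ (ghost_assoc_map oH hS hsigma (val x) hFr hF)) _.
  exact: (ghost_group_map_comp _ hFr (ring_hom_id _) kF hb').
apply: etrans (val_witt_free_map oH oH HH hS hS2 hrep2 _ hFr hFT) _; rewrite val_witt_to.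
exact: (ghost_group_map_comp _ (ring_hom_id _) hFr hb hFT).
Qed.

End WittAssoc.

Theorem lemma3p26 (G : profiniteGroupType) (H : set G) (S : set (set G))
    (hH : open_subgroup H) (hS : truncation_set H S)
    (* choices entering the definition of W^S for H <= G *)
    (S1 : set (set G)) (rep1 : set G -> set G -> G)
    (hS1 : conj_transversal H S S1)
    (hrep1 : forall V, S1 V -> coset_reps setT V (rep1 V))
    (* choices entering the definition of W^S for H <= H *)
    (S2 : set (set G)) (rep2 : set G -> set G -> G)
    (hS2 : conj_transversal H S S2)
    (hrep2 : forall V, S2 V -> coset_reps H V (rep2 V))
    (sigma : set G -> G) (hsigma : coset_reps setT H sigma) :
  exists phi : forall (R : comPzRingType) (M : lmodType R),
      witt setT H S S1 rep1 M ->
      witt H H S S2 rep2 (tpow M (cosets setT H)),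
    [/\ forall (R : comPzRingType) (M : lmodType R),
          is_topological_iso (@phi R M),
        forall (R R' : comPzRingType) (M : lmodType R) (M' : lmodType R')
            (a : {rmorphism R -> R'}) (f : {linear M -> M' | a \; *:%R})
            (x : witt setT H S S1 rep1 M),
          phi R' M' (witt_map a f x) = witt_map a (tpow_map a f) (phi R M x) &
        (* phi is the isomorphism determined by sigma *)
        forall (R : comPzRingType) (M : lmodType R)
            (x : witt setT H S S1 rep1 M) (U : S),
          witt_ghost (phi R M x) U = tpow_assoc H sigma (witt_ghost x U)].
Proof.
exists (fun R M => @witt_assoc G H S S1 rep1 S2 rep2 sigma R M); split.
- by move=> R M; apply: (witt_assoc_iso hH hS hS1 hrep1 hS2 hrep2 hsigma).
- move=> R R' M M' a f x.
  apply: (witt_assoc_natural hH hS hS1 hrep1 hS2 hrep2 hsigma).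
    exact: ring_hom_rmorphism.
  exact: semilin_linear.
- by move=> R M x U; apply: (witt_assoc_ghost hH hS hS1 hrep1 hS2 hrep2 hsigma).
Qed.
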